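(* Let $a\in\mathbb D$, $b=-a$, and $z=(0,\gamma)$ with $|a|^{3/2}<|\gamma|<|a|$. For $\varepsilon\in\mathbb C\setminus\{0\}$ let $L^\varepsilon_{aVbV}$ and $G^\varepsilon_{aVbV}$ be respectively Coman's Lempert function and the pluricomplex Green function on $\mathbb D^2$ with the four poles $(a,0),(b,0),(b,\varepsilon),(a,\varepsilon)$, all of weight $1$. Then $\liminf_{\varepsilon\to0}L^\varepsilon_{aVbV}(z)>G_{aVbV}(z)$, and consequently, for $|\varepsilon|$ small enough, $G^\varepsilon_{aVbV}(z)<L^\varepsilon_{aVbV}(z)$. In particular, Coman's conjecture (equality of the Lempert and Green functions with equal weights on convex domains) fails in the bidisc.
   Context: $\mathbb D$ is the open unit disc. Green function with poles $p_1,\dots,p_k$ of weight 1 on $\mathbb D^2$: $\sup\{u(z):u$ negative plurisubharmonic on $\mathbb D^2$, $u(x)\le\log\|x-p_j\|+C_j$ near $p_j\}$. Coman's Lempert function: $\inf\{\sum_j\log|\zeta_j|:\varphi:\mathbb D\to\mathbb D^2$ holomorphic, $\varphi(0)=z$, $\zeta_j\in\mathbb D$, $\varphi(\zeta_j)=p_j\}$. With $\Psi_V(w)=\max(\log|w_1|,2\log|w_2|)$, $G_{aVbV}(z)=\sup\{u(z):u$ negative plurisubharmonic on $\mathbb D^2$, $u(x)\le\Psi_V(x-(a,0))+C_1$ near $(a,0)$ and $u(x)\le\Psi_V(x-(b,0))+C_2$ near $(b,0)\}$. *)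

(* Defs.v *)
From HB Require Import structures.
From mathcomp Require Import all_boot all_order all_algebra.
From mathcomp Require Import complex.
From mathcomp Require Import all_classical all_reals all_analysis.
Import Order.TTheory GRing.Theory Num.Theory.
Import numFieldNormedType.Exports.
Import ComplexField.

Set Implicit Arguments.
Unset Strict Implicit.
Unset Printing Implicit Defensive.

Local Open Scope classical_set_scope.
Local Open Scope ring_scope.

(* The complex plane, as a numClosedFieldType (so that it carries its
   canonical normed/topological structure from mathcomp-analysis). *)
Definition CC (R : realType) : numClosedFieldType := R[i].

Section Defs.
Variable R : realType.
Local Notation C := (CC R).
Local Notation C2 := (C * C)%type.

Definition cabs (z : C) : R := @Normc.normc R z.

Definition expi (t : R) : C := (cos t +i* sin t)%C.

Definition disc : set C := [set z | cabs z < 1].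
Definition bidisc : set C2 := [set x | cabs x.1 < 1 /\ cabs x.2 < 1].

Definition sub2 (x y : C2) : C2 := (x.1 - y.1, x.2 - y.2).
Definition affine2 (a b : C2) (zeta : C) : C2 :=
  (a.1 + zeta * b.1, a.2 + zeta * b.2).

Definition norm2 (x : C2) : R := Num.sqrt (cabs x.1 ^+ 2 + cabs x.2 ^+ 2).

Definition elog (r : R) : \bar R := if r == 0 then -oo%E else (ln r)%:E.

Definition int_0_2pi (f : R -> \bar R) : \bar R :=
  (\int[@lebesgue_measure R]_(t in (`[0%R, (2 * pi)%R]%classic : set R)) f t)%E.

Definition usc_on (Omega : set C2) (u : C2 -> \bar R) : Prop :=
  forall x, Omega x -> forall c : R, (u x < c%:E)%E ->
    \forall y \near x, (u y < c%:E)%E.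

Definition psh_on (Omega : set C2) (u : C2 -> \bar R) : Prop :=
  [/\ forall x, Omega x -> (u x < +oo)%E,
      usc_on Omega u &
      forall a b : C2, (forall zeta : C, cabs zeta <= 1 -> Omega (affine2 a b zeta)) ->
        (u a <= ((2 * pi)^-1)%R%:E *
           int_0_2pi (fun t => u (affine2 a b (expi t))))%E].

Definition neg_psh_bidisc (u : C2 -> \bar R) : Prop :=
  psh_on bidisc u /\ forall x, bidisc x -> (u x < 0)%E.

Definition green_poles (k : nat) (p : 'I_k -> C2) (z : C2) : \bar R :=
  ereal_sup [set u z | u in [set u | neg_psh_bidisc u /\
     forall j, exists Cj : R,
       \forall x \near p j, (u x <= elog (norm2 (sub2 x (p j))) + Cj%:E)%E]].

Definition holo_disc_bidisc (phi : C -> C2) : Prop :=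
  (forall w, disc w -> bidisc (phi w)) /\
  (forall w, disc w -> derivable (fun v => (phi v).1) w 1 /\
                       derivable (fun v => (phi v).2) w 1).

Definition lempert_poles (k : nat) (p : 'I_k -> C2) (z : C2) : \bar R :=
  ereal_inf [set s | exists (phi : C -> C2) (zeta : 'I_k -> C),
     [/\ holo_disc_bidisc phi, phi 0 = z,
         forall j, disc (zeta j) /\ phi (zeta j) = p j &
         s = (\sum_(j < k) elog (cabs (zeta j)))%E]].

Definition PsiV (w : C2) : \bar R :=
  Order.max (elog (cabs w.1)) (2%:E * elog (cabs w.2))%E.

Definition green_aVbV (a b : C) (z : C2) : \bar R :=
  ereal_sup [set u z | u in [set u | neg_psh_bidisc u /\
     (exists C1 : R, \forall x \near (a, 0%R : C),
        (u x <= PsiV (sub2 x (a, 0%R)) + C1%:E)%E) /\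
     (exists C2 : R, \forall x \near (b, 0%R : C),
        (u x <= PsiV (sub2 x (b, 0%R)) + C2%:E)%E)]].

Definition four_poles (a b eps : C) : 'I_4 -> C2 :=
  fun j => nth (0, 0) [:: (a, 0); (b, 0); (b, eps); (a, eps)] j.

Definition L_eps (a b eps : C) (z : C2) : \bar R := lempert_poles (four_poles a b eps) z.
Definition G_eps (a b eps : C) (z : C2) : \bar R := green_poles (four_poles a b eps) z.

End Defs.

(* Main.v *)
Require Import Defs.
From HB Require Import structures.
From mathcomp Require Import all_boot all_order all_algebra.
From mathcomp Require Import complex.
From mathcomp Require Import all_classical all_reals all_analysis.
From mathcomp Require Import ring lra.
Import Order.TTheory GRing.Theory Num.Theory.
Import numFieldNormedType.Exports.
Import ComplexField.
Local Open Scope classical_set_scope.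
Local Open Scope ring_scope.
Set Implicit Arguments.
Unset Strict Implicit.
Unset Printing Implicit Defensive.

(* Let [m_c z = (z - c) / (1 - c^* z)].

   Green functions.  Put [P = m_a m_(-a)] and [Q = m_0 m_eps] (with [eps = 0] for the limit
   function).  Every competitor [u] satisfies
   [u x <= (1/2n) ln (|P x1|^(2n) + |Q x2|^(2n))]: the right-hand side is at least about [0]
   near the boundary, has the required singularities, and its Levi form is degenerate, so that
   after a small perturbation the difference has no interior maximum.  A Levi form only sees the
   tangent direction, hence sub-mean values over affine discs suffice.  At [(0, gamma)] and for
   small [eps] this gives [G <= 2 ln |a| + ln 2 / (2n)].

   Lempert function.  Let a disc [(f, h)] through [(0, gamma)] pass through the four poles at
   [z1], [z2], [z3], [z4], with [f z1 = f z4 = a] and [f z2 = f z3 = - a].  The Schwarz lemma for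
   [m_(+-a) o f] gives [|z1 z4| >= |a|] and [|z2 z3| >= |a|].  If the product of all four moduli
   were close to [|a|^2], both inequalities would almost be equalities and
   [m_(+-a) o f] almost Blaschke products of degree two.  Then the two points of at least one
   pair are separated, say [z2] and [z3], while one point of the other pair, say [z1], has modulus
   at most about [|a|^(1/2)].  As [h] vanishes at [z1] and [z2] and equals [eps] at [z3], this
   forces [|gamma| <= |z1 z2 z3| + o(1) <= |a|^(3/2) + o(1)]. *)

(** * Mobius maps of the disc *)

(** The natural majorant is the maximum of [ln |P x1|] and [ln |Q x2|], which is not smooth. The
    exponent [2n] replaces it by the logarithm of a sum of squared moduli of holomorphic functions,
    to which second-order jets apply, at the price [ln 2 / (2n)]. The gain [e] in the Lempert bound
    [ln (|a|^2 (1 + e))] does not depend on [eps], so [n] can be fixed afterwards with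
    [ln 2 / (2n) < ln (1 + e)]. The value [2 ln |a|] arises because [|P 0| = |a|^2] dominates
    [|Q gamma|], which is [|gamma|^2 < |a|^2] at [eps = 0] and stays below [|a|^2] for small [eps].
    An upper bound for the Green functions and a lower bound for the Lempert function suffice, so no
    extremal function is exhibited. The discs are only assumed complex differentiable, with no
    continuity of the derivative, hence Goursat's argument in front of the Schwarz lemma. The
    competitors are merely semicontinuous, hence a comparison at a single maximum point instead of a
    smoothing. *)

Definition cconj (R : realType) (z : CC R) : CC R := @conjc R z.

Definition mob (R : realType) (c z : CC R) : CC R := (z - c) / (1 - cconj c * z).

Section Modulus.
Variable R : realType.
Local Notation C := (CC R).
Local Notation cabs := (@cabs R).
Local Notation cconj := (@cconj R).
Implicit Types z w c : C.

Lemma cabsM z w : cabs (z * w) = cabs z * cabs w.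
Proof. exact: Normc.normcM. Qed.

Lemma cabsD z w : cabs (z + w) <= cabs z + cabs w.
Proof. exact: le_normcD. Qed.

Lemma cabsN z : cabs (- z) = cabs z.
Proof. exact: normcN. Qed.

Lemma cabsBC z w : cabs (z - w) = cabs (w - z).
Proof. by rewrite -cabsN opprB. Qed.

Lemma cabsB z w : cabs (z - w) <= cabs z + cabs w.
Proof. by rewrite -(cabsN w); exact: cabsD. Qed.

Lemma cabs_subl z w : cabs z - cabs w <= cabs (z - w).
Proof. by rewrite lerBlDr; apply: le_trans (cabsD _ _); rewrite subrK. Qed.

Lemma cabs_tri w z c : cabs (z - c) <= cabs (z - w) + cabs (w - c).
Proof. by apply: le_trans (cabsD _ _); rewrite addrA subrK. Qed.

Lemma cabs0 : cabs 0 = 0.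
Proof. exact: Normc.normc0. Qed.

Lemma cabs1 : cabs 1 = 1.
Proof. exact: Normc.normc1. Qed.

Lemma cabsV z : cabs z^-1 = (cabs z)^-1.
Proof. exact: Normc.normcV. Qed.

Lemma cabsX z n : cabs (z ^+ n) = cabs z ^+ n.
Proof. by elim: n => [|n IH]; rewrite ?expr0 ?cabs1// !exprS cabsM IH. Qed.

Lemma cabs_eq0 z : (cabs z == 0) = (z == 0).
Proof.
apply/idP/idP => [/eqP h|/eqP ->]; last by rewrite cabs0.
by apply/eqP; exact: Normc.eq0_normc.
Qed.

Lemma cabs_ge0 z : 0 <= cabs z.
Proof. by case: z => x y; rewrite /Defs.cabs /= sqrtr_ge0. Qed.

Lemma cabs_gt0 z : (0 < cabs z) = (z != 0).
Proof. by rewrite lt_def cabs_ge0 cabs_eq0 andbT. Qed.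

Lemma cabs_sqr z : cabs z ^+ 2 = complex.Re z ^+ 2 + complex.Im z ^+ 2.
Proof. by case: z => x y; rewrite /Defs.cabs /= sqr_sqrtr // addr_ge0 // sqr_ge0. Qed.

Lemma cabsC z : cabs (cconj z) = cabs z.
Proof. by case: z => x y; rewrite /Defs.cabs /= sqrrN. Qed.

Lemma Re_le_cabs z : complex.Re z <= cabs z.
Proof.
apply: le_trans (ler_norm _) _; rewrite -(@ler_pXn2r _ 2) ?nnegrE ?cabs_ge0//.
by rewrite cabs_sqr real_normK ?num_real// lerDl sqr_ge0.
Qed.

Lemma cabs_real (x : R) : cabs (x%:C)%C = `|x|.
Proof. by rewrite /Defs.cabs /= expr0n /= addr0 sqrtr_sqr. Qed.

Lemma cabs_natr (n : nat) : cabs n%:R = n%:R.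
Proof.
rewrite (_ : n%:R = ((n%:R : R)%:C)%C :> C) ?cabs_real ?normr_nat//.
by rewrite rmorph_nat.
Qed.

Lemma lt_normc z (d : R) : (`|z| < (d%:C)%C) = (cabs z < d).
Proof. by rewrite ltcE /= eqxx. Qed.

Lemma cconjM z w : cconj (z * w) = cconj z * cconj w.
Proof. exact: rmorphM. Qed.

Lemma cconjB z w : cconj (z - w) = cconj z - cconj w.
Proof. exact: rmorphB. Qed.

Lemma cconjN z : cconj (- z) = - cconj z.
Proof. exact: rmorphN. Qed.

Lemma cconj1 : cconj 1 = 1.
Proof. exact: rmorph1. Qed.

Lemma cconjV z : cconj z^-1 = (cconj z)^-1.
Proof. exact: conjc_inv. Qed.

Lemma cconjK z : cconj (cconj z) = z.
Proof. exact: conjcK. Qed.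

(** Balls of [CC R] have complex radii; this passes to real radii measured by [cabs]. *)
Lemma cnbhsP z (P : set C) :
  nbhs z P <-> exists2 d : R, 0 < d & forall w, cabs (w - z) < d -> P w.
Proof.
split.
  move=> /nbhs_ballP[[d d'] /= d0 H].
  (* In the order of the complex numbers a positive radius has imaginary part zero. *)
  move: d0; rewrite ltcE /= => /andP[/eqP d'0 d0]; subst d'.
  exists d => // w wz; apply: H; rewrite /ball /=.
  by rewrite (_ : (d +i* 0)%C = (d%:C)%C)// lt_normc cabsBC.
move=> [d d0 H]; apply/nbhs_ballP; exists (d%:C)%C => /=; first by rewrite ltcE /= eqxx.
by move=> w; rewrite /ball /= lt_normc cabsBC; exact: H.
Qed.

Lemma cnbhs2P (x : C * C) (P : set (C * C)) :
  nbhs x P <-> exists2 d : R, 0 < d &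
    forall y : C * C, cabs (y.1 - x.1) < d -> cabs (y.2 - x.2) < d -> P y.
Proof.
split.
  move=> [[A B] /= [/cnbhsP[d1 d10 H1] /cnbhsP[d2 d20 H2]] AB].
  exists (Num.min d1 d2); first by rewrite lt_min d10.
  move=> y; rewrite !lt_min => /andP[y1 _] /andP[_ y2].
  by apply: AB; split; [exact: H1|exact: H2].
move=> [d d0 H].
exists ([set w | cabs (w - x.1) < d], [set w | cabs (w - x.2) < d]) => /=.
  by split; apply/cnbhsP; exists d.
by move=> y [/= h1 h2]; exact: H.
Qed.

Lemma ccontP (f : C -> C) z : {for z, continuous f} <->
  forall e : R, 0 < e -> exists2 d, 0 < d & forall w, cabs (w - z) < d -> cabs (f w - f z) < e.
Proof.
split=> [cf e e0|H].
  have /cf/cnbhsP[d d0 Hd] : nbhs (f z) [set w | cabs (w - f z) < e].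
    by apply/cnbhsP; exists e.
  by exists d.
move=> B /cnbhsP[e e0 HB]; have [d d0 Hd] := H _ e0.
by apply/cnbhsP; exists d => // w /Hd/HB.
Qed.

Lemma cderivP (f : C -> C) z : derivable f z 1 -> exists l : C,
  forall e : R, 0 < e -> exists2 d, 0 < d & forall w, cabs (w - z) < d ->
    cabs (f w - f z - l * (w - z)) <= e * cabs (w - z).
Proof.
move=> /cvg_ex[l /= Hl]; exists l => e e0.
have /Hl : nbhs l [set w | cabs (w - l) < e] by apply/cnbhsP; exists e.
rewrite /= => /cnbhsP[d d0 Hd]; exists d => // w wz.
have [->|wnz] := eqVneq w z.
  by rewrite !subrr mulr0 subr0 cabs0 mulr0.
have h0 : w - z != 0 by rewrite subr_eq0.
have := Hd (w - z); rewrite subr0 => /(_ wz h0) /=.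
rewrite /GRing.scale /= mulr1 subrK => /ltW h.
rewrite (_ : _ - _ - _ = ((w - z)^-1 * (f w - f z) - l) * (w - z)); last first.
  by field.
by rewrite cabsM ler_wpM2r// cabs_ge0.
Qed.

Lemma derivC (f : C -> C) z (l : C) :
  (forall e : R, 0 < e -> exists2 d, 0 < d & forall w, cabs (w - z) < d ->
    cabs (f w - f z - l * (w - z)) <= e * cabs (w - z)) -> derivable f z 1.
Proof.
move=> H; apply/cvg_ex; exists l => /= B /cnbhsP[e e0 HB].
have [|d d0 Hd] := H (e / 2); first by lra.
rewrite /dnbhs /= /within /=; apply/cnbhsP; exists d => // h.
rewrite subr0 => hd h0; apply: HB.
rewrite /GRing.scale /= mulr1.
have := Hd (h + z); rewrite addrK => /(_ hd) K.
rewrite (_ : _ - l = (f (h + z) - f z - l * h) / h); last by field.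
rewrite cabsM cabsV ltr_pdivrMr ?cabs_gt0//.
have : 0 < cabs h by rewrite cabs_gt0.
nra.
Qed.

Lemma mob_den_ge c z : cabs c < 1 -> cabs z <= 1 -> 1 - cabs c <= cabs (1 - cconj c * z).
Proof.
move=> c1 z1; apply: le_trans (cabs_subl _ _); rewrite cabs1 cabsM cabsC.
have := cabs_ge0 c; nra.
Qed.

Lemma mob_den_neq0 c z : cabs c < 1 -> cabs z <= 1 -> 1 - cconj c * z != 0.
Proof.
by move=> c1 z1; rewrite -cabs_gt0 (lt_le_trans _ (mob_den_ge c1 z1))// subr_gt0.
Qed.

(** Rests on [|1 - c^* z|^2 - |z - c|^2 = (1 - |c|^2) (1 - |z|^2)]. *)
Lemma mob_sqr c z : cabs c < 1 -> cabs z <= 1 ->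
  1 - cabs (mob c z) ^+ 2 =
  (1 - cabs c ^+ 2) * (1 - cabs z ^+ 2) / cabs (1 - cconj c * z) ^+ 2.
Proof.
move=> c1 z1; have d0 := mob_den_neq0 c1 z1.
rewrite /mob cabsM cabsV expr_div_n.
have D0 : cabs (1 - cconj c * z) ^+ 2 != 0 by rewrite expf_neq0// cabs_eq0.
have -> : (1 - cabs c ^+ 2) * (1 - cabs z ^+ 2) =
   cabs (1 - cconj c * z) ^+ 2 - cabs (z - c) ^+ 2.
  by rewrite !cabs_sqr; case: (c) (z) => a b [x y] /=; ring.
by rewrite mulrBl divff.
Qed.

Lemma mob_disc c z : cabs c < 1 -> cabs z < 1 -> cabs (mob c z) < 1.
Proof.
move=> c1 z1.
have h := mob_sqr c1 (ltW z1).
rewrite -(@ltr_pXn2r _ 2) ?nnegrE ?cabs_ge0// expr1n -subr_gt0 h.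
have := cabs_ge0 c; have := cabs_ge0 z => z0 c0.
apply: divr_gt0; first by rewrite mulr_gt0// subr_gt0 expr_lt1.
by rewrite exprn_gt0// cabs_gt0 mob_den_neq0// ltW.
Qed.

Lemma mobx0 c : mob c 0 = - c.
Proof. by rewrite /mob mulr0 subr0 divr1 sub0r. Qed.

Lemma mob0x z : mob 0 z = z.
Proof.
rewrite /mob (_ : cconj 0 = 0) ?mul0r ?subr0 ?divr1//; exact: conjc0.
Qed.

Lemma mobxx c : mob c c = 0.
Proof. by rewrite /mob subrr mul0r. Qed.

Lemma mob_eq0 c z : cabs c < 1 -> cabs z <= 1 -> (mob c z == 0) = (z == c).
Proof.
by move=> c1 z1; rewrite /mob mulf_eq0 invr_eq0 (negbTE (mob_den_neq0 c1 z1)) orbF subr_eq0.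
Qed.

Lemma mobK c z : cabs c < 1 -> cabs z <= 1 -> mob (- c) (mob c z) = z.
Proof.
move=> c1 z1; have d0 := mob_den_neq0 c1 z1.
have e0 : 1 - cconj c * c != 0 by apply: mob_den_neq0 => //; exact: ltW.
rewrite /mob cconjN.
have -> : 1 - - cconj c * ((z - c) / (1 - cconj c * z)) =
  (1 - cconj c * c) / (1 - cconj c * z) by field.
by field; rewrite d0 e0.
Qed.

Lemma mobNK c z : cabs c < 1 -> cabs z <= 1 -> mob c (mob (- c) z) = z.
Proof. by move=> c1 z1; rewrite -{1}(opprK c) mobK ?cabsN. Qed.

Lemma cabs_mobC c z : cabs (mob c z) = cabs (mob z c).
Proof.
rewrite /mob !cabsM !cabsV cabsBC; congr (_ * _^-1).
by rewrite -cabsC cconjB cconj1 cconjM cconjK [in LHS]mulrC.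
Qed.

Lemma cabs_mob_mob w x y : cabs w < 1 -> cabs x < 1 -> cabs y < 1 ->
  cabs (mob (mob w x) (mob w y)) = cabs (mob x y).
Proof.
move=> w1 x1 y1.
have dx := mob_den_neq0 w1 (ltW x1); have dy := mob_den_neq0 w1 (ltW y1).
have dw := mob_den_neq0 w1 (ltW w1); have dxy := mob_den_neq0 x1 (ltW y1).
have dx' : 1 - w * cconj x != 0 by rewrite -cabs_eq0 -cabsC cconjB cconj1 cconjM cconjK cabs_eq0.
have -> : mob (mob w x) (mob w y) =
    (1 - w * cconj x) / (1 - cconj w * x) * mob x y.
  rewrite {1}/mob.
  have -> : mob w y - mob w x =
     (y - x) * (1 - cconj w * w) / ((1 - cconj w * x) * (1 - cconj w * y)).
    by rewrite /mob; field; rewrite dx dy.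
  have -> : 1 - cconj (mob w x) * mob w y =
      (1 - cconj x * y) * (1 - cconj w * w) / ((1 - w * cconj x) * (1 - cconj w * y)).
    by rewrite /mob cconjM cconjV !cconjB cconjM cconjK cconj1; field; rewrite dx' dy.
  by rewrite /mob; field; rewrite dx dx' dy dxy dw.
rewrite cabsM cabsM cabsV (_ : cabs (1 - w * cconj x) = cabs (1 - cconj w * x)).
  by rewrite divff ?mul1r// cabs_eq0.
by rewrite -cabsC cconjB cconj1 cconjM cconjK.
Qed.

Lemma mob_sub x y : cabs x < 1 -> cabs y < 1 ->
  cabs (y - x) < 2 * cabs (mob x y) \/ y = x.
Proof.
move=> x1 y1; have [->|yx] := eqVneq y x; [by right|left].
have d0 : 0 < cabs (1 - cconj x * y) by rewrite cabs_gt0 mob_den_neq0// ltW.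
rewrite /mob cabsM cabsV mulrA ltr_pdivlMr// mulrC ltr_pM2r ?cabs_gt0 ?subr_eq0//.
apply: le_lt_trans (cabsB _ _) _; rewrite cabs1 cabsM cabsC.
have := cabs_ge0 x; have := cabs_ge0 y; nra.
Qed.

(** Lipschitz dependence on the centre. Over a common denominator the numerator is a sum of four
    terms, each of modulus at most [|b - c|]. *)
Lemma mob_param b c z : cabs b < 1 -> cabs c < 1 -> cabs z < 1 ->
  cabs (mob b z - mob c z) <= 4 * cabs (b - c) / ((1 - cabs b) * (1 - cabs c)).
Proof.
move=> b1 c1 z1.
have db := mob_den_neq0 b1 (ltW z1); have dc := mob_den_neq0 c1 (ltW z1).
have -> : mob b z - mob c z = ((c - b) + cconj (b - c) * z ^+ 2 +
    (b * cconj (c - b) + (b - c) * cconj b) * z) / ((1 - cconj b * z) * (1 - cconj c * z)).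
  by rewrite /mob !cconjB; field; rewrite db dc.
rewrite cabsM cabsV cabsM.
have D0 : 0 < (1 - cabs b) * (1 - cabs c) by rewrite mulr_gt0// subr_gt0.
have D1 : (1 - cabs b) * (1 - cabs c) <= cabs (1 - cconj b * z) * cabs (1 - cconj c * z).
  by apply: ler_pM; rewrite ?subr_ge0 ?mob_den_ge// ltW.
apply: ler_pM; rewrite ?invr_ge0 ?mulr_ge0 ?cabs_ge0//; last first.
  by rewrite lef_pV2 ?posrE//; exact: lt_le_trans D0 D1.
set w := b * cconj (c - b) + (b - c) * cconj b; set v := cconj (b - c) * z ^+ 2.
have h1 : cabs (c - b + v + w * z) <= cabs (c - b) + cabs v + cabs w * cabs z.
  by apply: le_trans (cabsD _ _) _; rewrite cabsM lerD2r cabsD.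
have hv : cabs v = cabs (b - c) * (cabs z * cabs z) by rewrite /v expr2 !cabsM cabsC.
have hw : cabs w <= cabs b * cabs (b - c) + cabs (b - c) * cabs b.
  by apply: le_trans (cabsD _ _) _; rewrite !cabsM !cabsC (cabsBC c b).
move: h1; rewrite hv (cabsBC c b).
have := cabs_ge0 b; have := cabs_ge0 z; have := cabs_ge0 (b - c).
move: (cabs w) (cabs b) b1 (cabs z) z1 (cabs (b - c)) hw => {D0 D1} W B B1 z' z'1 d hw d0 z0 B0 h1.
have zz := mulr_ile1 z0 z0 (ltW z'1) (ltW z'1).
have dzz := ler_piMr d0 zz.
have Bd := ler_piMl d0 (ltW B1).
have Wd : W <= 2 * d by rewrite mulrC in hw; lra.
have Wz := ler_wpM2r z0 Wd; have dz := ler_piMr d0 (ltW z'1).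
lra.
Qed.

End Modulus.

(** * Goursat's theorem and the maximum principle *)

Section Goursat.
Variable R : realType.
Local Notation mu := (@lebesgue_measure R).
Implicit Types f g : R -> R.

Definition Int (a b : R) (f : R -> R) : R := \int[mu]_(x in `[a, b]) f x.

Definition contI (a b : R) f := forall x, a <= x <= b -> {for x, continuous f}.

Lemma contI_sub a b c d f : a <= c -> d <= b -> contI a b f -> contI c d f.
Proof.
by move=> ac db cf x /andP[cx xd]; apply: cf; rewrite (le_trans ac)// (le_trans xd).
Qed.

Lemma continuous_Int a b f : contI a b f ->
  mu.-integrable `[a, b] (EFin \o f).
Proof.
move=> cf; apply: continuous_compact_integrable; first exact: segment_compact.
by apply: continuous_in_subspaceT => x /set_mem; rewrite /= in_itv; exact: cf.
Qed.

Lemma Int_cst a b (k : R) : a <= b -> Int a b (fun=> k) = k * (b - a).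
Proof.
move=> ab; rewrite /Int Rintegral_cst//= lebesgue_measure_itv/= lte_fin.
by move: ab; rewrite le_eqVlt => /predU1P[->|->]; rewrite ?ltxx ?subrr.
Qed.

Lemma Int_le a b f g : contI a b f -> contI a b g ->
  (forall x, a <= x <= b -> f x <= g x) -> Int a b f <= Int a b g.
Proof.
by move=> cf cg H; apply: le_Rintegral => //; exact: continuous_Int.
Qed.

Lemma contI_cst a b (k : R) : contI a b (fun=> k).
Proof. by move=> x _; exact: cvg_cst. Qed.

Lemma Int_near a b f (c e : R) : a <= b -> contI a b f ->
  (forall x, a <= x <= b -> `|f x - c| <= e) ->
  `|Int a b f - c * (b - a)| <= e * (b - a).
Proof.
move=> ab cf H.
have h1 : Int a b f <= Int a b (fun=> c + e).
  by apply: Int_le => //; [exact: contI_cst|move=> x /H; rewrite ler_norml => /andP[_]; lra].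
have h2 : Int a b (fun=> c - e) <= Int a b f.
  by apply: Int_le => //; [exact: contI_cst|move=> x /H; rewrite ler_norml => /andP[]; lra].
move: h1 h2; rewrite !Int_cst// ler_norml => h1 h2.
rewrite mulrDl in h1; rewrite mulrBl in h2.
by apply/andP; split; lra.
Qed.

Lemma Int_split a c b f : a <= c -> c <= b -> contI a b f ->
  Int a b f = Int a c f + Int c b f.
Proof.
move=> ac cb cf; rewrite /Int.
have := @Rintegral_itvB R f (BLeft a) (BRight b) c (continuous_Int cf).
rewrite !bnd_simp => /(_ ac cb) h.
rewrite Rintegral_itv_obnd_cbnd in h.
  by rewrite -h addrC subrK.
apply: integrableS (continuous_Int (contI_sub ac (lexx b) cf)) => //.
by move=> z /=; rewrite !in_itv/= => /andP[/ltW -> ->].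
Qed.

Lemma IntB a b f g : contI a b f -> contI a b g ->
  Int a b (fun x => f x - g x) = Int a b f - Int a b g.
Proof. by move=> cf cg; rewrite /Int RintegralB//; exact: continuous_Int. Qed.

Variables P Q : R -> R -> R.

(** The real part of the contour integral of [P + i Q] around the rectangle with lower left corner
    [(x, y)] and sides [l], [h]. *)
Definition Jrect (x y l h : R) : R :=
  Int x (x + l) (fun s => P s y - P s (y + h)) -
  Int y (y + h) (fun t => Q (x + l) t - Q x t).

(* Real form of complex differentiability of [P + i Q]: the Cauchy-Riemann equations are built in. *)
Definition CRdiff (x0 y0 : R) := exists k j : R, forall e, 0 < e -> exists2 d, 0 < d &
  forall x y, `|x - x0| < d -> `|y - y0| < d ->
   `|P x y - P x0 y0 - (k * (x - x0) - j * (y - y0))| <= e * (`|x - x0| + `|y - y0|) /\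
   `|Q x y - Q x0 y0 - (j * (x - x0) + k * (y - y0))| <= e * (`|x - x0| + `|y - y0|).

(** The half-plane [x < 0] will be the logarithm of the punctured disc. Continuity is asked only
    along the horizontal sides for [P] and the vertical sides for [Q]. *)
Hypothesis cP : forall x y, x < 0 -> {for x, continuous (P ^~ y)}.
Hypothesis cQ : forall x, x < 0 -> continuous (Q x).

Lemma contIB a b f g : contI a b f -> contI a b g -> contI a b (fun x => f x - g x).
Proof. by move=> cf cg x xab; apply: cvgB; [exact: cf|exact: cg]. Qed.

Let cPx y a b : b < 0 -> contI a b (P ^~ y).
Proof. by move=> b0 x /andP[_ xb]; apply: cP; exact: le_lt_trans b0. Qed.

Let cQy x a b : x < 0 -> contI a b (Q x).
Proof. by move=> x0 y _; exact: cQ. Qed.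

Lemma Jrect_splitx x y l h : 0 <= l -> 0 <= h -> x + (l + l) < 0 ->
  Jrect x y (l + l) h = Jrect x y l h + Jrect (x + l) y l h.
Proof.
move=> l0 h0 xl; rewrite /Jrect.
have xl' : x + l < 0 by lra.
have x' : x < 0 by lra.
have xl'' : x + l + l < 0 by lra.
rewrite (@Int_split x (x + l)) ?lerDl ?lerD2l//; [|lra|by apply: contIB; exact: cPx].
rewrite !IntB ?addrA; try by [exact: cPx|exact: cQy].
lra.
Qed.

Lemma Jrect_splity x y l h : 0 <= l -> 0 <= h -> x + l < 0 ->
  Jrect x y l (h + h) = Jrect x y l h + Jrect x (y + h) l h.
Proof.
move=> l0 h0 xl; rewrite /Jrect.
have x' : x < 0 by lra.
rewrite (@Int_split y (y + h)) ?lerDl ?lerD2l//; [|lra|by apply: contIB; exact: cQy].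
rewrite !IntB ?addrA; try by [exact: cPx|exact: cQy].
lra.
Qed.

(** The affine parts of [P] and [Q] contribute [j h l] and [j l h], which cancel, so only the
    differentiability error remains. *)
Lemma Jrect_small x0 y0 e : CRdiff x0 y0 -> 0 < e -> exists2 d, 0 < d &
  forall x y l h, x + l < 0 -> 0 <= l < d -> 0 <= h < d -> x <= x0 <= x + l -> y <= y0 <= y + h ->
    `|Jrect x y l h| <= 4 * e * (l + h) ^+ 2.
Proof.
move=> [k [j H]] e0; have [d d0 Hd] := H _ e0; exists d => // x y l h xl.
move=> /andP[l0 ld] /andP[h0 hd] /andP[x1 x2] /andP[y1 y2].
have B s t : x <= s <= x + l -> y <= t <= y + h ->
   `|P s t - P x0 y0 - (k * (s - x0) - j * (t - y0))| <= e * (l + h) /\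
   `|Q s t - Q x0 y0 - (j * (s - x0) + k * (t - y0))| <= e * (l + h).
  move=> /andP[s1 s2] /andP[t1 t2].
  have a1 : `|s - x0| <= l.
    by move: s1 s2 x1 x2; clear; rewrite ler_norml => *; apply/andP; split; lra.
  have a2 : `|t - y0| <= h.
    by move: t1 t2 y1 y2; clear; rewrite ler_norml => *; apply/andP; split; lra.
  have [b1 b2] := Hd s t (le_lt_trans a1 ld) (le_lt_trans a2 hd).
  have : e * (`|s - x0| + `|t - y0|) <= e * (l + h) by rewrite ler_pM2l// lerD.
  by move=> b; split; [exact: le_trans b1 b|exact: le_trans b2 b].
have I1 : `|Int x (x + l) (fun s => P s y - P s (y + h)) - (j * h) * (x + l - x)|
    <= 2 * e * (l + h) * (x + l - x).
  apply: Int_near; [by rewrite lerDl|by apply: contIB; exact: cPx|] => s sl.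
  have [||+ _] := B s y => //; first by rewrite lexx lerDl.
  have [||+ _] := B s (y + h) => //; first by rewrite lexx lerDl h0.
  by clear; rewrite !ler_norml => /andP[? ?] /andP[? ?]; apply/andP; split; lra.
have I2 : `|Int y (y + h) (fun t => Q (x + l) t - Q x t) - (j * l) * (y + h - y)|
    <= 2 * e * (l + h) * (y + h - y).
  apply: Int_near; [by rewrite lerDl|apply: contIB; apply: cQy; lra|] => t tl.
  have [||_ +] := B x t => //; first by rewrite lexx lerDl.
  have [||_ +] := B (x + l) t => //; first by rewrite lexx lerDl l0.
  by clear; rewrite !ler_norml => /andP[? ?] /andP[? ?]; apply/andP; split; lra.
rewrite /Jrect; move: I1 I2.
have -> : x + l - x = l by ring.
have -> : y + h - y = h by ring.
move: (Int _ _ _) (Int _ _ _) => X Y.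
rewrite !ler_norml => /andP[? ?] /andP[? ?].
have el : 0 <= e * l * l by rewrite !mulr_ge0// ltW.
have eh : 0 <= e * h * h by rewrite !mulr_ge0// ltW.
have elh : 0 <= e * l * h by rewrite !mulr_ge0// ltW.
by apply/andP; split; lra.
Qed.

Lemma Jrect_quarter x y l h m : 0 <= l -> 0 <= h -> x + l < 0 -> m < `|Jrect x y l h| ->
  exists p : R * R, [/\ m / 4 < `|Jrect p.1 p.2 (l / 2) (h / 2)|,
    (x <= p.1) && (p.1 + l / 2 <= x + l) & (y <= p.2) && (p.2 + h / 2 <= y + h)].
Proof.
move=> l0 h0 xl.
have l2 : 0 <= l / 2 by lra.
have h2 : 0 <= h / 2 by lra.
rewrite {1}(_ : l = l / 2 + l / 2); last by field.
rewrite {1}(_ : h = h / 2 + h / 2); last by field.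
rewrite Jrect_splitx ?addr_ge0//; last by rewrite -splitr.
rewrite !Jrect_splity//; [|by rewrite -addrA -splitr|lra] => mJ.
apply: contrapT => /forallNP N.
have M p : (x <= p.1) && (p.1 + l / 2 <= x + l) ->
    (y <= p.2) && (p.2 + h / 2 <= y + h) -> `|Jrect p.1 p.2 (l / 2) (h / 2)| <= m / 4.
  by move=> px py; rewrite leNgt; apply/negP => ?; apply: (N p).
have := M (x, y); have := M (x + l / 2, y); have := M (x, y + h / 2).
have := M (x + l / 2, y + h / 2).
rewrite /= !lerDl l2 h2 !lexx !lerD2l /=.
rewrite (_ : (l / 2 <= l) = true); last by lra.
rewrite (_ : (h / 2 <= h) = true); last by lra.
rewrite -!addrA -!splitr !lexx => /(_ isT isT) m1 /(_ isT isT) m2 /(_ isT isT) m3 /(_ isT isT) m4.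
move: mJ; apply/negP; rewrite -leNgt.
apply: le_trans (ler_normD _ _) _.
have := ler_normD (Jrect x y (l / 2) (h / 2)) (Jrect x (y + h / 2) (l / 2) (h / 2)).
have := ler_normD (Jrect (x + l / 2) y (l / 2) (h / 2)) (Jrect (x + l / 2) (y + h / 2) (l / 2) (h / 2)).
lra.
Qed.

Lemma nested_sup (u v : nat -> R) : (forall n, u n <= u n.+1) -> (forall n, v n.+1 <= v n) ->
  (forall n, u n <= v n) -> exists x, forall n, u n <= x <= v n.
Proof.
move=> iu dv uv.
have uS n m : u n <= u (n + m)%N.
  by elim: m => [|m IH]; rewrite ?addn0// addnS (le_trans IH).
have vS n m : v (n + m)%N <= v n.
  by elim: m => [|m IH]; rewrite ?addn0// addnS (le_trans _ IH).
have ub n : ubound (range u) (v n).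
  move=> _ [m _ <-]; apply: le_trans (uS m n) _.
  by apply: le_trans (uv _) _; rewrite addnC; exact: vS.
exists (sup (range u)) => n; apply/andP; split.
  by apply: ub_le_sup; [exists (v 0%N); exact: ub|exists n].
by apply: ge_sup; [exists (u 0%N); exists 0%N|exact: ub].
Qed.

Lemma Goursat x y l h : 0 < l -> 0 < h -> x + l < 0 ->
  (forall s t, s < 0 -> CRdiff s t) -> Jrect x y l h = 0.
Proof.
move=> l0 h0 xl HCR; apply/eqP; rewrite -normr_le0 leNgt; apply/negP => J0.
set m := `|Jrect x y l h| / 2.
have m0 : 0 < m by rewrite divr_gt0.
have mJ : m < `|Jrect x y l h| by rewrite /m; lra.
pose len n := l / 2 ^+ n; pose hei n := h / 2 ^+ n.
pose good n (p : R * R) := (p.1 + len n < 0) && (m / 4 ^+ n < `|Jrect p.1 p.2 (len n) (hei n)|).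
have lS n : len n.+1 = len n / 2 by rewrite /len exprS invfM mulrA mulrAC.
have hS n : hei n.+1 = hei n / 2 by rewrite /hei exprS invfM mulrA mulrAC.
have lp n : 0 < len n by rewrite divr_gt0// exprn_gt0.
have hp n : 0 < hei n by rewrite divr_gt0// exprn_gt0.
(* [step] must be total, so outside [good] it returns its argument; along the orbit [s] the
   invariant always holds. *)
have /choice[step Hstep] : forall np : nat * (R * R), exists q : R * R,
    good np.1 np.2 -> [/\ good np.1.+1 q,
      (np.2.1 <= q.1) && (q.1 + len np.1.+1 <= np.2.1 + len np.1) &
      (np.2.2 <= q.2) && (q.2 + hei np.1.+1 <= np.2.2 + hei np.1)].
  move=> [n p]; have [g|g] := pselect (good n p); last by exists p.
  have /andP[g1 g2] := g.
  have [q [q1 q2 q3]] := Jrect_quarter (ltW (lp n)) (ltW (hp n)) g1 g2.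
  by exists q => _; rewrite /= lS hS; split=> //; rewrite /good lS hS exprSr invfM mulrA q1 andbT; have /andP[_] := q2; lra.
pose fix s n : R * R := if n is n'.+1 then step (n', s n') else (x, y).
have gs n : good n (s n).
  elim: n => [|n IH]; last by have [] := Hstep (n, s n) IH.
  by rewrite /good /len /hei !expr0 !divr1 xl.
have st n := Hstep (n, s n) (gs n).
have [x0 Hx0] : exists x0, forall n, (s n).1 <= x0 <= (s n).1 + len n.
  apply: nested_sup => n; last by rewrite lerDl ltW.
  - by have [_ /andP[]] := st n.
  - by have [_ /andP[]] := st n.
have [y0 Hy0] : exists y0, forall n, (s n).2 <= y0 <= (s n).2 + hei n.
  apply: nested_sup => n; last by rewrite lerDl ltW.
  - by have [_ _ /andP[]] := st n.
  - by have [_ _ /andP[]] := st n.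
(* This [e] makes the bound of [Jrect_small] on the [n]-th rectangle equal to [m / 4 ^ n],
   contradicting [good]. *)
have e0 : 0 < m / (4 * (l + h) ^+ 2).
  by rewrite divr_gt0// mulr_gt0// exprn_gt0// addr_gt0.
have x00 : x0 < 0.
  by have /andP[] := Hx0 0%N; rewrite /len /= expr0 divr1; lra.
have [d d0 Hd] := Jrect_small (HCR x0 y0 x00) e0.
have [n Hn] : exists n, (l + h) / 2 ^+ n < d.
  have [n] : exists n, (l + h) / d < n%:R :> R.
    by exists (Num.truncn ((l + h) / d)).+1; rewrite truncnS_gt.
  exists n; rewrite ltr_pdivrMr ?exprn_gt0// mulrC -ltr_pdivrMr//.
  by apply: lt_le_trans p _; rewrite -natrX ler_nat ltnW// ltn_expl.
have := gs n; rewrite /good => /andP[sl]; rewrite ltNge; apply/negP; rewrite negbK.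
have ll : len n < d by apply: le_lt_trans Hn; rewrite ler_pM2r ?lerDl ?invr_gt0 ?exprn_gt0// ltW.
have hl : hei n < d by apply: le_lt_trans Hn; rewrite ler_pM2r ?lerDr ?invr_gt0 ?exprn_gt0// ltW.
apply: le_trans (Hd _ _ _ _ sl _ _ (Hx0 n) (Hy0 n)) _.
- by rewrite ltW.
- by rewrite ltW.
rewrite /len /hei -mulrDl expr_div_n -exprM mulnC exprM.
rewrite (_ : 2 ^+ 2 = 4 :> R); last by rewrite -natrX.
rewrite le_eqVlt; apply/orP; left; apply/eqP; field.
by rewrite expf_neq0// gt_eqF// addr_gt0.
Qed.

End Goursat.

(** * Mean values over circles, by Goursat's theorem in logarithmic polar coordinates *)

Section CircleMean.
Variable R : realType.
Local Notation C := (CC R).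
Local Notation cabs := (@cabs R).
Implicit Types z w : C.

Definition cmk (x y : R) : C := (x +i* y)%C.

Lemma cmkE z : z = cmk (complex.Re z) (complex.Im z).
Proof. by case: z. Qed.

Lemma cabs_cmk (x y : R) : cabs (cmk x y) <= `|x| + `|y|.
Proof.
rewrite -(@ler_pXn2r _ 2) ?nnegrE ?cabs_ge0 ?addr_ge0// cabs_sqr /=.
rewrite -(real_normK (num_real x)) -(real_normK (num_real y)).
have := normr_ge0 x; have := normr_ge0 y; nra.
Qed.

Lemma cconj_mul z : cconj z * z = cmk (cabs z ^+ 2) 0.
Proof.
rewrite cabs_sqr; case: z => x y; apply/eqP; rewrite eq_complex /=.
by apply/andP; split; apply/eqP; ring.
Qed.

Lemma normr_Re z : `|complex.Re z| <= cabs z.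
Proof.
rewrite -(@ler_pXn2r _ 2) ?nnegrE ?cabs_ge0// cabs_sqr real_normK ?num_real//.
by rewrite lerDl sqr_ge0.
Qed.

Lemma normr_Im z : `|complex.Im z| <= cabs z.
Proof.
rewrite -(@ler_pXn2r _ 2) ?nnegrE ?cabs_ge0// cabs_sqr real_normK ?num_real//.
by rewrite lerDr sqr_ge0.
Qed.

Lemma cabs_expi t : cabs (expi t) = 1.
Proof.
by apply/eqP; rewrite -(@eqrXn2 _ 2) ?cabs_ge0// cabs_sqr /= expr1n cos2Dsin2.
Qed.

Lemma expiD s t : expi (s + t) = expi s * expi t :> C.
Proof.
rewrite /expi cosD sinD; apply/eqP; rewrite eq_complex /= !eqxx /=.
by rewrite addrC [X in X + _]mulrC eqxx.
Qed.

(** The complex exponential of [s + i t]: it turns circles into vertical segments and an annulus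
    into a rectangle. *)
Definition cpolar (s t : R) : C := cmk (expR s) 0 * expi t.

Lemma cpolarD s t x y : cpolar (s + x) (t + y) = cpolar s t * cpolar x y.
Proof.
rewrite /cpolar expiD expRD.
rewrite (_ : cmk (expR s * expR x) 0 = cmk (expR s) 0 * cmk (expR x) 0); first by ring.
by apply/eqP; rewrite eq_complex /= !(mulr0, mul0r, subr0, addr0) !eqxx.
Qed.

Lemma cabs_cpolar s t : cabs (cpolar s t) = expR s.
Proof.
by rewrite /cpolar cabsM cabs_expi mulr1 cabs_real ger0_norm// expR_ge0.
Qed.

Lemma is_derive_eps (f : R -> R) (x l : R) : is_derive x 1 f l ->
  forall e, 0 < e -> exists2 d, 0 < d & forall h, `|h| < d ->
    `|f (x + h) - f x - l * h| <= e * `|h|.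
Proof.
move=> [df dl] e e0.
have /cvgrPdist_lt/(_ e e0) : (fun h => h^-1 *: (f (h *: 1 + x) - f x)) @ 0^' --> l.
  by rewrite -dl; exact: df.
rewrite /dnbhs near_withinE => /nbhs_ballP[d /= d0 H].
exists d => // h hd; have [->|h0] := eqVneq h 0.
  by rewrite addr0 subrr mulr0 subr0 normr0 mulr0.
have := H h; rewrite /ball /= sub0r normrN => /(_ hd h0).
rewrite /GRing.scale /= mulr1 (addrC h x) => /ltW.
have {1}-> : l = l * h / h by rewrite mulfK.
rewrite (mulrC h^-1) -mulrBl normrM normfV distrC.
by rewrite ler_pdivrMr ?normr_gt0.
Qed.

Lemma cpolar_jet (e : R) : 0 < e -> exists2 d, 0 < d & forall x y, `|x| < d -> `|y| < d ->
  cabs (cpolar x y - 1 - cmk x y) <= e * (`|x| + `|y|).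
Proof.
move=> e0; pose e1 := e / 5.
have e10 : 0 < e1 by rewrite /e1; lra.
have [d1 d10 H1] := is_derive_eps (is_derive_expR 0) e10.
have [d2 d20 H2] := is_derive_eps (is_derive_cos 0) e10.
have [d3 d30 H3] := is_derive_eps (is_derive_sin 0) e10.
pose d := Num.min (Num.min d1 d2) (Num.min d3 (Num.min 1 e1)).
exists d; first by rewrite /d !lt_min d10 d20 d30 e10 ltr01.
move=> x y; rewrite /d !lt_min => /andP[/andP[x1 _] /andP[_ /andP[x4 x5]]].
move=> /andP[/andP[_ y2] /andP[y3 _]].
have := H1 x x1; have := H2 y y2; have := H3 y y3.
rewrite !(add0r, expR0, cos0, sin0, oppr0, mul0r, subr0, mul1r) => h3 h2 h1.
have -> : cpolar x y - 1 - cmk x y = cmk (expR x - 1 - x) 0 * expi y +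
   cmk (1 + x) 0 * cmk (cos y - 1) (sin y - y) + cmk 0 (x * y).
  by apply/eqP; rewrite eq_complex /=; apply/andP; split; apply/eqP; ring.
apply: le_trans (cabsD _ _) _.
apply: le_trans (lerD (cabsD _ _) (cabs_cmk _ _)) _.
rewrite !cabsM cabs_expi !cabs_real normr0 add0r mulr1 normrM.
have k1 : `|1 + x| <= 2 by apply: le_trans (ler_normD _ _) _; rewrite normr1; lra.
have k2 : cabs (cmk (cos y - 1) (sin y - y)) <= 2 * e1 * `|y|.
  by apply: le_trans (cabs_cmk _ _) _; lra.
have k3 : `|1 + x| * cabs (cmk (cos y - 1) (sin y - y)) <= 2 * (2 * e1 * `|y|).
  by apply: ler_pM => //; rewrite cabs_ge0.
have k4 : `|x| * `|y| <= e1 * `|y| by rewrite ler_wpM2r// ltW.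
have k5 : 0 <= e1 * `|x| by rewrite mulr_ge0// ltW.
rewrite (_ : e = 5 * e1); last by rewrite /e1; field.
lra.
Qed.

Section holomorphic.
Variable f : C -> C.
Hypothesis df : forall z, disc z -> derivable f z 1.

Lemma cpolar_disc s t : s < 0 -> disc (cpolar s t).
Proof. by move=> s0; rewrite /disc /mkset cabs_cpolar expR_lt1. Qed.

Let P (s t : R) : R := complex.Re (f (cpolar s t)).
Let Q (s t : R) : R := complex.Im (f (cpolar s t)).

(** Chain rule: with [l] the derivative of [f] at [z0], composition with the exponential has
    derivative [l * z0], whose real and imaginary parts are the two Cauchy-Riemann coefficients. *)
Lemma CRdiff_polar s t : s < 0 -> CRdiff P Q s t.
Proof.
move=> s0; have z1 := cpolar_disc t s0; set z0 := cpolar s t in z1 *.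
have [l Hl] := cderivP (df z1).
exists (complex.Re (l * z0)), (complex.Im (l * z0)) => e e0.
have e10 : 0 < e / 4 by lra.
have [d1 d10 H1] := Hl _ e10.
have l0 : 0 < 2 * (cabs l + 1) by have := cabs_ge0 l; lra.
pose e2 := Num.min 1 (e / (2 * (cabs l + 1))).
have e20 : 0 < e2 by rewrite lt_min ltr01 divr_gt0.
have [d2 d20 H2] := cpolar_jet e20.
exists (Num.min d2 (d1 / 4)); first by rewrite lt_min d20 divr_gt0.
move=> x y; rewrite !lt_min => /andP[x1 x2] /andP[y1 y2].
set a := x - s in x1 x2 *; set b := y - t in y1 y2 *.
have h2 := H2 a b x1 y1.
have Ez : cpolar x y = z0 * cpolar a b by rewrite -cpolarD /a /b !(addrC _ (_ - _)) !subrK.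
have z0le : cabs z0 <= 1 by exact: ltW.
have ab0 : 0 <= `|a| + `|b| by rewrite addr_ge0.
have e2le1 : e2 <= 1 by rewrite ge_min lexx.
have hz : cabs (cpolar x y - z0) <= 2 * (`|a| + `|b|).
  rewrite Ez (_ : _ - _ = z0 * (cmk a b + (cpolar a b - 1 - cmk a b))); last by ring.
  rewrite cabsM; apply: le_trans (ler_piMl (cabs_ge0 _) z0le) _.
  apply: le_trans (cabsD _ _) _.
  have := cabs_cmk a b; have := ler_wpM2r ab0 e2le1; lra.
have h1 : cabs (f (cpolar x y) - f z0 - l * (cpolar x y - z0)) <= e / 4 * cabs (cpolar x y - z0).
  by apply: H1; apply: le_lt_trans hz _; lra.
have key : cabs (f (cpolar x y) - f z0 - (l * z0) * cmk a b) <= e * (`|a| + `|b|).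
  rewrite (_ : _ - _ = (f (cpolar x y) - f z0 - l * (cpolar x y - z0)) +
     l * (z0 * (cpolar a b - 1 - cmk a b))); last by rewrite Ez; ring.
  apply: le_trans (cabsD _ _) _.
  have k1 : e / 4 * cabs (cpolar x y - z0) <= e / 2 * (`|a| + `|b|).
    by apply: le_trans (ler_wpM2l (ltW e10) hz) _; rewrite le_eqVlt; apply/orP; left; apply/eqP; field.
  have k2 : cabs (l * (z0 * (cpolar a b - 1 - cmk a b))) <= e / 2 * (`|a| + `|b|).
    rewrite cabsM [cabs (z0 * _)]cabsM.
    apply: (@le_trans _ _ (cabs l * cabs (cpolar a b - 1 - cmk a b))).
      by apply: ler_wpM2l; rewrite ?cabs_ge0// ler_piMl// cabs_ge0.
    apply: (@le_trans _ _ (cabs l * (e2 * (`|a| + `|b|)))).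
      by apply: ler_wpM2l; rewrite ?cabs_ge0.
    rewrite mulrA ler_wpM2r//.
    have : e2 <= e / (2 * (cabs l + 1)) by rewrite ge_min lexx orbT.
    rewrite ler_pdivlMr//; lra.
  lra.
have A := normr_Re (f (cpolar x y) - f z0 - (l * z0) * cmk a b).
have B := normr_Im (f (cpolar x y) - f z0 - (l * z0) * cmk a b).
split.
  apply: le_trans key; apply: le_trans A; rewrite le_eqVlt; apply/orP; left; apply/eqP.
  rewrite /P; case: (f _) => f1 f2; case: (f _) => f3 f4; case: (l * z0) => l1 l2 /=.
  by congr (`|_|).
apply: le_trans key; apply: le_trans B; rewrite le_eqVlt; apply/orP; left; apply/eqP.
rewrite /Q; case: (f _) => f1 f2; case: (f _) => f3 f4; case: (l * z0) => l1 l2 /=.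
by congr (`|_|); ring.
Qed.

Lemma Q_continuous s : s < 0 -> continuous (Q s).
Proof.
move=> s0 t; have [k [j H]] := CRdiff_polar t s0.
apply/cvgrPdist_lt => e e0.
have [d d0 Hd] := H 1 ltr01.
have K0 : 0 < `|k| + 1 by rewrite ltr_wpDl.
apply/nbhs_ballP; exists (Num.min d (e / (`|k| + 1))) => /=; first by rewrite lt_min d0 divr_gt0.
move=> y; rewrite /ball /= distrC lt_min => /andP[yd ye].
have [|//|_] := Hd s y; first by rewrite subrr normr0.
rewrite subrr normr0 mulr0 !add0r mul1r => h.
rewrite distrC; rewrite ltr_pdivlMr// in ye; apply: le_lt_trans ye.
have := ler_normD (Q s y - Q s t - k * (y - t)) (k * (y - t)).
rewrite subrK normrM; lra.
Qed.

Lemma P_continuous s t : s < 0 -> {for s, continuous (P ^~ t)}.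
Proof.
move=> s0; have [k [j H]] := CRdiff_polar t s0.
apply/cvgrPdist_lt => e e0.
have [d d0 Hd] := H 1 ltr01.
have K0 : 0 < `|k| + 1 by rewrite ltr_wpDl.
apply/nbhs_ballP; exists (Num.min d (e / (`|k| + 1))) => /=; first by rewrite lt_min d0 divr_gt0.
move=> y; rewrite /ball /= distrC lt_min => /andP[yd ye].
have [//||+ _] := Hd y t; first by rewrite subrr normr0.
rewrite subrr normr0 mulr0 addr0 subr0 mul1r => h.
rewrite distrC; rewrite ltr_pdivlMr// in ye; apply: le_lt_trans ye.
have := ler_normD (P y t - P s t - k * (y - s)) (k * (y - s)).
rewrite subrK normrM; lra.
Qed.

(** Goursat on [[s0, s1] x [0, 2 pi]]: the horizontal sides cancel by periodicity, leaving the
    integrals over the two circles. *)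
Lemma circle_indep s0 s1 : s0 < s1 -> s1 < 0 ->
  Int 0 (2 * pi) (Q s0) = Int 0 (2 * pi) (Q s1).
Proof.
move=> s01 s10.
have pi2 : 0 < 2 * pi :> R by rewrite mulr_gt0// pi_gt0.
have l0 : 0 < s1 - s0 by lra.
have s00 : s0 < 0 by lra.
have sl : s0 + (s1 - s0) < 0 by lra.
have := @Goursat R P Q (fun x y x0 => @P_continuous x y x0) (fun x x0 => @Q_continuous x x0)
  s0 0 (s1 - s0) (2 * pi) l0 pi2 sl (fun s t st => CRdiff_polar t st).
rewrite /Jrect !add0r (_ : s0 + (s1 - s0) = s1); last by ring.
have cQ s : s < 0 -> contI 0 (2 * pi) (Q s) by move=> ? x _; exact: Q_continuous.
rewrite (IntB (cQ _ s10) (cQ _ s00)).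
have -> : Int s0 s1 (fun s => P s 0 - P s (2 * pi)) = Int s0 s1 (fun=> 0).
  rewrite /Int; apply: eq_Rintegral => s _; rewrite /P /cpolar.
  by rewrite /expi mulr_natl cos2pi sin2pi cos0 sin0 subrr.
rewrite Int_cst ?mul0r; last lra.
by move/eqP; rewrite sub0r oppr_eq0 subr_eq0 => /eqP ->.
Qed.

Lemma circle_mean s : s < 0 -> Int 0 (2 * pi) (Q s) = complex.Im (f 0) * (2 * pi).
Proof.
move=> s0; apply/eqP; rewrite -subr_eq0 -normr_le0; apply/ler_addgt0Pr => e e0; rewrite add0r.
have pi2 : 0 < 2 * pi :> R by rewrite mulr_gt0// pi_gt0.
have /ccontP c0 : {for 0, continuous f}.
  by apply/differentiable_continuous/derivable1_diffP/df; rewrite /disc /mkset cabs0.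
have [d d0 Hd] := c0 (e / (2 * pi)) (divr_gt0 e0 pi2).
have [s1 s1s s1d] : exists2 s1, s1 < s & expR s1 < d.
  exists (Num.min (s - 1) (ln d - 1)); first by rewrite gt_min; apply/orP; left; lra.
  rewrite -[ltRHS]lnK ?posrE// ltr_expR gt_min; apply/orP; right; lra.
rewrite -(circle_indep s1s s0).
have cQ : contI 0 (2 * pi) (Q s1) by move=> x _; apply: Q_continuous; lra.
have := @Int_near R 0 (2 * pi) (Q s1) (complex.Im (f 0)) (e / (2 * pi)) (ltW pi2) cQ.
rewrite !subr0 divfK ?gt_eqF//; apply => t _; apply: ltW; rewrite -raddfB /=.
by apply: le_lt_trans (normr_Im _) _; apply: Hd; rewrite subr0 cabs_cpolar.
Qed.

Lemma Im_center_le (r M : R) : 0 < r < 1 -> (forall z, cabs z = r -> complex.Im (f z) <= M) ->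
  complex.Im (f 0) <= M.
Proof.
move=> /andP[r0 r1] H.
have pi2 : 0 < 2 * pi :> R by rewrite mulr_gt0// pi_gt0.
have lr : ln r < 0 by rewrite ln_lt0// r0.
have := Int_cst M (ltW pi2); rewrite subr0 => IM.
rewrite -(ler_pM2r pi2) -(circle_mean lr) -IM.
apply: Int_le; [by move=> x _; apply: Q_continuous|exact: contI_cst|].
by move=> t _; apply: H; rewrite cabs_cpolar lnK.
Qed.

End holomorphic.

(** A unimodular factor [u] rotates [f 0] onto the positive imaginary axis, so its modulus becomes
    an imaginary part and [Im_center_le] applies. *)
Lemma center_le (f : C -> C) (r M : R) : (forall z, disc z -> derivable f z 1) ->
  0 < r < 1 -> (forall z, cabs z = r -> cabs (f z) <= M) -> cabs (f 0) <= M.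
Proof.
move=> df r01 H; have [f0|f0] := eqVneq (f 0) 0.
  rewrite f0 cabs0; have /andP[r0 r1] := r01.
  by apply: le_trans (cabs_ge0 _) (H (cmk r 0) _); rewrite cabs_real gtr0_norm.
pose u : C := cmk 0 1 * cconj (f 0) / cmk (cabs (f 0)) 0.
have n0 : 0 < cabs (f 0) by rewrite cabs_gt0.
have u1 : cabs u = 1.
  rewrite /u !cabsM cabsV cabs_real cabsC ger0_norm ?cabs_ge0// mulfK ?gt_eqF//.
  by apply/eqP; rewrite -(@eqrXn2 _ 2) ?cabs_ge0// cabs_sqr /= expr0n /= add0r.
have uf0 : u * f 0 = cmk 0 (cabs (f 0)).
  rewrite /u; have n0' : cmk (cabs (f 0)) 0 != 0 by rewrite -cabs_gt0 cabs_real gtr0_norm.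
  apply: (mulIf n0'); rewrite mulrAC divfK//.
  rewrite -mulrA cconj_mul; apply/eqP; rewrite eq_complex /=.
  by apply/andP; split; apply/eqP; ring.
have -> : cabs (f 0) = complex.Im (u * f 0) by rewrite uf0.
have dg z : disc z -> derivable (fun z => u * f z) z 1.
  by move=> z1; apply: derivableM; [exact: derivable_cst|exact: df].
apply: (Im_center_le dg r01) => z zr.
apply: le_trans (ler_norm _) _; apply: le_trans (normr_Im _) _.
by rewrite cabsM u1 mul1r; exact: H.
Qed.

End CircleMean.

(** * Schwarz and Schwarz-Pick lemmas with exceptional points *)

Section Schwarz.
Variable R : realType.
Local Notation C := (CC R).
Local Notation cabs := (@cabs R).
Local Notation disc := (@disc R).
Local Notation cconj := (@cconj R).
Implicit Types (z w c : C) (f g k : C -> C) (S T : seq C).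

(* Dividing by a zero produces functions that are only known to be continuous at finitely many
   points; [S] lists these points. *)
Definition hol S f := forall z, disc z ->
  {for z, continuous f} /\ (z \notin S -> derivable f z 1).

Lemma derivable_ccont f z : derivable f z 1 -> {for z, continuous f}.
Proof. by move=> /derivable1_diffP/differentiable_continuous. Qed.

Lemma hol_nil f : (forall z, disc z -> derivable f z 1) -> hol [::] f.
Proof. by move=> H z z1; split=> [|_]; [apply: derivable_ccont|]; exact: H. Qed.

Lemma hol_cst S c : hol S (fun=> c).
Proof. by move=> z _; split=> [|_]; [apply: derivable_ccont|]; exact: derivable_cst. Qed.

Lemma hol_id S : hol S id.
Proof. by move=> z _; split=> [|_]; [apply: derivable_ccont|]; exact: derivable_id. Qed.

Lemma ccontB f g z : {for z, continuous f} -> {for z, continuous g} ->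
  {for z, continuous (fun w => f w - g w)}.
Proof.
move=> /ccontP cf /ccontP cg; apply/ccontP => e e0.
have [|d1 d10 H1] := cf (e / 2); first by rewrite divr_gt0.
have [|d2 d20 H2] := cg (e / 2); first by rewrite divr_gt0.
exists (Num.min d1 d2); first by rewrite lt_min d10.
move=> w; rewrite lt_min => /andP[/H1 h1 /H2 h2].
rewrite (_ : _ - _ = (f w - f z) - (g w - g z)); last by ring.
by apply: le_lt_trans (cabsB _ _) _; lra.
Qed.

Lemma holB S f g : hol S f -> hol S g -> hol S (fun z => f z - g z).
Proof.
move=> hf hg z z1; have [cf df] := hf z z1; have [cg dg] := hg z z1; split.
  exact: ccontB.
by move=> zS; apply: derivableB; [exact: df|exact: dg].
Qed.

Lemma holM S f g : hol S f -> hol S g -> hol S (fun z => f z * g z).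
Proof.
move=> hf hg z z1; have [cf df] := hf z z1; have [cg dg] := hg z z1; split.
  exact: (continuousM cf cg).
by move=> zS; apply: derivableM; [exact: df|exact: dg].
Qed.

Lemma holX S f n : hol S f -> hol S (fun z => f z ^+ n).
Proof.
move=> hf; elim: n => [|n IH].
  rewrite (_ : (fun z => _) = (fun=> 1)); first exact: hol_cst.
  by apply/funext => z; rewrite expr0.
rewrite (_ : (fun z => _) = (fun z => f z * f z ^+ n)); first exact: (holM hf IH).
by apply/funext => z; rewrite exprS.
Qed.

Lemma holV S f : (forall z, disc z -> f z != 0) -> hol S f -> hol S (fun z => (f z)^-1).
Proof.
move=> f0 hf z z1; have [cf df] := hf z z1; split.
  exact: (continuousV (f0 z z1) cf).
by move=> zS; apply: derivableV; [exact: f0|exact: df].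
Qed.

Lemma hol_mob S c f : cabs c < 1 -> (forall z, disc z -> cabs (f z) <= 1) -> hol S f ->
  hol S (fun z => mob c (f z)).
Proof.
move=> c1 f1 hf.
have h1 := holB hf (hol_cst S c).
have h2 := holB (hol_cst S 1) (holM (hol_cst S (cconj c)) hf).
have h0 z : disc z -> 1 - cconj c * f z != 0.
  by move=> z1; rewrite mob_den_neq0// f1.
exact: (holM h1 (holV h0 h2)).
Qed.

Lemma ccont_near f g z (d : R) : 0 < d -> (forall w, cabs (w - z) < d -> f w = g w) ->
  {for z, continuous f} -> {for z, continuous g}.
Proof.
move=> d0 fg /ccontP H; apply/ccontP => e /H[d1 d10 H1].
exists (Num.min d d1); rewrite ?lt_min ?d0// => w; rewrite lt_min => /andP[wd wd1].
by rewrite -!fg ?subrr ?cabs0//; exact: H1.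
Qed.

Lemma derivable_near f g z (d : R) : 0 < d -> (forall w, cabs (w - z) < d -> f w = g w) ->
  derivable f z 1 -> derivable g z 1.
Proof.
move=> d0 fg /cderivP[l H]; apply: (derivC (l := l)) => e /H[d1 d10 H1].
exists (Num.min d d1); rewrite ?lt_min ?d0// => w; rewrite lt_min => /andP[wd wd1].
by rewrite -!fg ?subrr ?cabs0//; exact: H1.
Qed.

Lemma avoid_seq z S : exists2 d : R, 0 < d & forall w, 0 < cabs (w - z) < d -> w \notin S.
Proof.
elim: S => [|s S [d d0 IH]]; first by exists 1.
have [sz|sz] := eqVneq s z.
  exists d => // w wd; rewrite inE negb_or (IH _ wd) andbT sz.
  by move/andP: wd => [+ _]; rewrite cabs_gt0 subr_eq0.
exists (Num.min d (cabs (s - z))); first by rewrite lt_min d0 cabs_gt0 subr_eq0.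
move=> w; rewrite lt_min => /and3P[w0 wd ws]; rewrite inE negb_or IH ?w0// andbT.
by apply: contraTneq ws => ->; rewrite ltxx.
Qed.

Lemma hol_le1_closure S T k : hol S k ->
  (forall z, disc z -> z \notin T -> cabs (k z) <= 1) -> forall z, disc z -> cabs (k z) <= 1.
Proof.
move=> hk H z z1; rewrite leNgt; apply/negP => kz.
have [/ccontP ck _] := hk z z1.
have [|d d0 Hd] := ck (cabs (k z) - 1); first by rewrite subr_gt0.
have [d' d'0 Hd'] := avoid_seq z T.
pose m := Num.min (Num.min d d') (1 - cabs z).
have m0 : 0 < m by rewrite !lt_min d0 d'0 subr_gt0.
have md : m <= d by rewrite !ge_min lexx.
have md' : m <= d' by rewrite !ge_min lexx orbT.
have mz : m <= 1 - cabs z by rewrite !ge_min lexx orbT.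
pose w : C := z + cmk (m / 2) 0.
have wz : cabs (w - z) = m / 2 by rewrite /w addrC addKr cabs_real gtr0_norm// divr_gt0.
have wd : cabs (w - z) < d by rewrite wz; lra.
have : cabs (k w) <= 1.
  apply: H; last by apply: Hd'; rewrite wz; apply/andP; split; lra.
  have := cabs_subl w z; rewrite wz /Defs.disc /mkset; lra.
have := Hd w wd; have := cabs_subl (k z) (k w); rewrite cabsBC; lra.
Qed.

Lemma derivable_subr s z : derivable (fun w => w - s) z 1.
Proof. by apply: derivableB; [exact: derivable_id|exact: derivable_cst]. Qed.

Lemma derivable_prodB S z : derivable (fun w => \prod_(s <- S) (w - s)) z 1.
Proof.
elim: S => [|s S IH].
  rewrite (_ : (fun w => _) = cst 1); first exact: derivable_cst.
  by apply/funext => w; rewrite big_nil.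
rewrite (_ : (fun w => _) = (fun w => (w - s) * \prod_(s <- S) (w - s))).
  exact: (derivableM (@derivable_subr s z) IH).
by apply/funext => w; rewrite big_cons.
Qed.

(** At an exceptional point [z] one factor [w - z] is split off; a function continuous at [z],
    multiplied by [w - z], is differentiable there with its own value as derivative. *)
Lemma derivable_prodM S f z : {for z, continuous f} -> (z \notin S -> derivable f z 1) ->
  derivable (fun w => (\prod_(s <- S) (w - s)) * f w) z 1.
Proof.
move=> cf df; have [zS|zS] := boolP (z \in S); last first.
  exact: (derivableM (@derivable_prodB S z) (df zS)).
pose g w := (\prod_(s <- rem z S) (w - s)) * f w.
have gE w : (\prod_(s <- S) (w - s)) * f w = (w - z) * g w.
  by rewrite (big_rem z)//= mulrA.
have /ccontP cg : {for z, continuous g}.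
  exact: (continuousM (derivable_ccont (@derivable_prodB _ z)) cf).
rewrite (_ : (fun w => _) = (fun w => (w - z) * g w)); last by apply/funext => w; exact: gE.
apply: (derivC (l := g z)) => e /cg[d d0 Hd]; exists d => // w /Hd/ltW h.
rewrite subrr mul0r subr0 (_ : _ - _ = (g w - g z) * (w - z)); last by ring.
by rewrite cabsM ler_wpM2r// cabs_ge0.
Qed.

(* Removes both the exceptional points and the resulting constant factor: apply [center_le] to
   [prod (z - s) * k ^ n] and let [n] tend to infinity. *)
Lemma hol_center_le1 S k : hol S k -> 0 \notin S ->
  (forall e : R, 0 < e -> exists2 r : R, 0 < r < 1 &
     forall z, cabs z = r -> cabs (k z) <= 1 + e) ->
  cabs (k 0) <= 1.
Proof.
move=> hk S0 H; rewrite leNgt; apply/negP => k1.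
pose e := (cabs (k 0) - 1) / 2.
have e0 : 0 < e by rewrite divr_gt0// subr_gt0.
have [r r01 Hr] := H e e0.
pose K : R := \prod_(s <- S) (1 + cabs s).
pose q := cabs (\prod_(s <- S) (0 - s)).
have q0 : 0 < q.
  rewrite cabs_gt0 prodf_seq_neq0; apply/allP => s sS /=.
  by rewrite sub0r oppr_eq0; apply: contraNneq S0 => <-.
have KP z : cabs z < 1 -> cabs (\prod_(s <- S) (z - s)) <= K.
  move=> z1; rewrite /K; elim: S {hk S0 K q q0} => [|s S IH].
    by rewrite !big_nil cabs1.
  rewrite !big_cons cabsM ler_pM ?cabs_ge0//.
  by apply: le_trans (cabsB _ _) _; rewrite lerD2r ltW.
have n_le n : q * cabs (k 0) ^+ n <= K * (1 + e) ^+ n.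
  rewrite -cabsX -cabsM.
  apply: (@center_le R (fun z => (\prod_(s <- S) (z - s)) * k z ^+ n) r) => //.
    by move=> z z1; have [ck dk] := holX n hk z1; exact: derivable_prodM.
  move=> z zr; rewrite cabsM cabsX; have /andP[r0 r1] := r01.
  by apply: ler_pM; rewrite ?cabs_ge0 ?exprn_ge0 ?cabs_ge0 ?KP ?zr// lerXn2r ?nnegrE ?cabs_ge0 ?Hr// addr_ge0// ltW.
(* As [|k 0| = (1 + t) (1 + e)] with [t > 0], the powers of [1 + t] exceed the constant [K / q] by
   Bernoulli's inequality. *)
pose t := cabs (k 0) / (1 + e) - 1.
have e1 : 0 < 1 + e by lra.
have t0 : 0 < t by rewrite /t subr_gt0 ltr_pdivlMr// mul1r /e; lra.
have [n Hn] : exists n, K / q / t < n%:R :> R.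
  by exists (Num.truncn (K / q / t)).+1; rewrite truncnS_gt.
have Bern : 1 + n%:R * t <= (1 + t) ^+ n.
  elim: n {Hn} => [|n IH]; first by rewrite mul0r addr0 expr0.
  rewrite exprS -natr1; apply: le_trans (ler_wpM2l _ IH); last by lra.
  have : 0 <= n%:R * t * t by rewrite !mulr_ge0 ?ler0n ?ltW.
  lra.
have := n_le n; rewrite leNgt => /negP; apply.
have -> : cabs (k 0) = (1 + t) * (1 + e) by rewrite /t addrC subrK divfK// gt_eqF.
rewrite exprMn mulrA ltr_pM2r ?exprn_gt0//.
rewrite mulrC -ltr_pdivrMr//; apply: lt_le_trans Bern.
by move: Hn; rewrite ltr_pdivrMr//; lra.
Qed.

(** The quotient is completed at [c] by the derivative of [f]. Only its continuity is established
    there, so [c] joins the exceptional points. *)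
Lemma hol_div S f c : hol S f -> disc c -> c \notin S -> f c = 0 ->
  exists2 g, hol (c :: S) g & forall z, f z = (z - c) * g z.
Proof.
move=> hf c1 cS fc.
have [l Hl] := cderivP ((hf c c1).2 cS).
exists (fun z => if z == c then l else f z / (z - c)); last first.
  by move=> z; case: eqVneq => [->|zc]; [rewrite subrr mul0r|rewrite mulrC divfK// subr_eq0].
move=> z z1; have [->|zc] := eqVneq z c.
  split; last by rewrite inE eqxx.
  apply/ccontP => e e0; have [|d d0 Hd] := Hl (e / 2); first by lra.
  exists d => // w /Hd; rewrite eqxx; have [->|wc] := eqVneq w c; first by move=> _; rewrite subrr cabs0.
  have w0 : w - c != 0 by rewrite subr_eq0.
  rewrite fc subr0 => h; rewrite (_ : _ - l = (f w - l * (w - c)) / (w - c)); last by field.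
  rewrite cabsM cabsV ltr_pdivrMr ?cabs_gt0//; apply: le_lt_trans h _.
  by rewrite ltr_pM2r ?cabs_gt0//; lra.
have d0 : 0 < cabs (z - c) by rewrite cabs_gt0 subr_eq0.
have E w : cabs (w - z) < cabs (z - c) -> f w * (w - c)^-1 = if w == c then l else f w / (w - c).
  by move=> wz; case: eqVneq => // wc; move: wz; rewrite wc cabsBC ltxx.
have zc0 : z - c != 0 by rewrite subr_eq0.
have dc : derivable (fun w => (w - c)^-1) z 1.
  by apply: derivableV; [exact: zc0|exact: derivable_subr].
have [cf df] := hf z z1; split.
  apply: ccont_near d0 E _; exact: (continuousM cf (derivable_ccont dc)).
rewrite inE negb_or => /andP[_ /df dfz]; apply: derivable_near d0 E _.
exact: (derivableM dfz dc).
Qed.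

Lemma derivable_ccomp g f z : derivable g z 1 -> derivable f (g z) 1 ->
  derivable (fun w => f (g w)) z 1.
Proof.
move=> /derivable1_diffP dg /derivable1_diffP df; apply/derivable1_diffP.
exact: (differentiable_comp dg df).
Qed.

(** Moves [c] to the origin, where [hol_center_le1] applies. Exceptional points outside the disc are
    dropped, so that [mob c] vanishes on the remaining list only at [c] itself. *)
Lemma hol_comp_mob S f c : cabs c < 1 -> hol S f ->
  hol (map (mob c) [seq s <- S | cabs s < 1]) (fun z => f (mob (- c) z)).
Proof.
move=> c1 hf z z1; have c1' : cabs (- c) < 1 by rewrite cabsN.
have mz : disc (mob (- c) z) by exact: mob_disc.
have id1 w : disc w -> cabs (id w) <= 1 by move=> w1; exact: ltW.
have dm : derivable (mob (- c)) z 1.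
  have [_ h] := hol_mob c1' id1 (@hol_id [::]) z1; exact: (h isT).
have [cf df] := hf _ mz; split.
  exact: continuous_comp (derivable_ccont dm) cf.
move=> zS; have /df dfm : mob (- c) z \notin S.
  apply: contraNN zS => mS; rewrite -(mobNK c1 (ltW z1)).
  by rewrite map_f// mem_filter mS andbT.
exact: (derivable_ccomp dm dfm).
Qed.

Lemma mob_boundary c : cabs c < 1 -> forall e : R, 0 < e ->
  exists2 r : R, 0 < r < 1 & forall z, r <= cabs z -> cabs z < 1 -> 1 - e <= cabs (mob c z).
Proof.
move=> c1 e e0; have c0 : 0 < 1 - cabs c by lra.
pose s := Num.min (1 / 2) (e * (1 - cabs c) ^+ 2 / 2).
have s0 : 0 < s by rewrite lt_min; apply/andP; split; [lra|rewrite divr_gt0// mulr_gt0// exprn_gt0].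
have s1 : s <= 1 / 2 by rewrite ge_min lexx.
have s2 : s <= e * (1 - cabs c) ^+ 2 / 2 by rewrite ge_min lexx orbT.
exists (1 - s); first by apply/andP; split; lra.
move=> z zr z1.
have h : 1 - cabs (mob c z) ^+ 2 <= e.
  rewrite mob_sqr ?(ltW z1)//.
  have D := mob_den_ge c1 (ltW z1).
  have D2 : (1 - cabs c) ^+ 2 <= cabs (1 - cconj c * z) ^+ 2 by rewrite lerXn2r ?nnegrE ?cabs_ge0 ?(ltW c0).
  rewrite ler_pdivrMr; last by apply: lt_le_trans D2; rewrite exprn_gt0.
  apply: le_trans (ler_wpM2l (ltW e0) D2).
  have c2 : 1 - cabs c ^+ 2 <= 1 by rewrite gerBl exprn_ge0 ?cabs_ge0.
  have z2 : 1 - cabs z ^+ 2 <= 2 * s by have := cabs_ge0 z; rewrite expr2; nra.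
  have z20 : 0 <= 1 - cabs z ^+ 2 by rewrite subr_ge0 expr_le1 ?cabs_ge0// ltW.
  apply: le_trans (ler_wpM2r z20 c2) _; lra.
have m1 : cabs (mob c z) ^+ 2 <= cabs (mob c z).
  by rewrite expr2 ler_piMl ?cabs_ge0// ltW// mob_disc.
lra.
Qed.

(** The Schwarz lemma as a division, so that it can be iterated on the quotient [k]. Near the unit
    circle [|mob c|] is close to [1], hence [|k|] is at most [1 + e]; the maximum principle is
    applied after moving each point [z0] to the origin. *)
Lemma Schwarz_div S f c : hol S f -> (forall z, disc z -> cabs (f z) <= 1) ->
  disc c -> c \notin S -> f c = 0 ->
  exists k, [/\ hol (c :: S) k, forall z, disc z -> cabs (k z) <= 1 &
    forall z, disc z -> f z = mob c z * k z].
Proof.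
move=> hf f1 c1 cS fc; have [g hg fE] := hol_div hf c1 cS fc.
pose k z := g z * (1 - cconj c * z).
have hk : hol (c :: S) k.
  exact: (holM hg (holB (hol_cst _ 1) (holM (hol_cst _ (cconj c)) (@hol_id _)))).
have kE z : disc z -> f z = mob c z * k z.
  by move=> z1; rewrite fE /k /mob; field; rewrite mob_den_neq0// ltW.
exists k; split=> //; apply: (hol_le1_closure (T := c :: S) hk) => z0 z01 z0S.
have := @hol_center_le1 _ _ (hol_comp_mob z01 hk).
rewrite mobx0 opprK; apply.
  apply/negP => /mapP[s]; rewrite mem_filter => /andP[s1 sS] /esym/eqP.
  by rewrite mob_eq0 ?(ltW s1)// => /eqP sz; move: sS; rewrite sz (negbTE z0S).
move=> e e0; pose d := mob z0 c.
have d1 : cabs d < 1 by exact: mob_disc.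
(* Chosen because [1 - e / (1 + e)] is the inverse of [1 + e]. *)
have e'0 : 0 < e / (1 + e) by rewrite divr_gt0//; lra.
have [r r01 Hr] := mob_boundary d1 e'0.
pose r' := Num.max r ((1 + cabs d) / 2).
have /andP[r0 r1] := r01.
have r'01 : 0 < r' < 1 by rewrite lt_max gt_max r0 r1 /=; lra.
exists r' => // w wr'; have w1 : cabs w < 1 by rewrite wr'; case/andP: r'01.
have wd : w != d.
  apply/eqP => wd; have : (1 + cabs d) / 2 <= r' by rewrite /r' le_max lexx orbT.
  rewrite -wr' wd; lra.
have {}Hr := Hr w; have rw : r <= cabs w by rewrite wr' le_max lexx.
have h := Hr rw w1.
have pw : disc (mob (- z0) w) by apply: mob_disc; rewrite ?cabsN.
have mE : cabs (mob c (mob (- z0) w)) = cabs (mob d w).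
  by rewrite -(@cabs_mob_mob R z0) ?mobNK ?(ltW w1).
have := f1 _ pw; rewrite kE// cabsM mE.
rewrite (_ : 1 - e / (1 + e) = (1 + e)^-1) in h; last by field; rewrite gt_eqF//; lra.
have e1 : 0 < 1 + e by lra.
rewrite -(ler_pM2r e1) mulVf ?gt_eqF// in h.
have k0 := cabs_ge0 (k (mob (- z0) w)).
move=> h2; have := ler_wpM2r k0 h.
have := ler_wpM2l (ltW e1) h2; lra.
Qed.

(** Stated without a denominator because [|k|] may reach [1]. The usual argument is run on [t * k]
    with [t = 1 - e], whose values lie strictly inside the disc, and [e] is then sent to [0]. *)
Lemma Schwarz_Pick0 S k : hol S k -> 0 \notin S -> (forall z, disc z -> cabs (k z) <= 1) ->
  forall z, disc z -> cabs (k z - k 0) <= cabs z * cabs (1 - cconj (k 0) * k z).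
Proof.
move=> hk S0 k1 z z1; apply/ler_addgt0Pr => e0 e00.
pose e := Num.min (1 / 2) (e0 / 4).
have e_gt0 : 0 < e by rewrite lt_min; apply/andP; split; lra.
have e_le : e <= 1 / 2 by rewrite ge_min lexx.
have e_le' : e <= e0 / 4 by rewrite ge_min lexx orbT.
pose t : C := cmk (1 - e) 0.
have ct : cabs t = 1 - e by rewrite cabs_real ger0_norm; lra.
have D0 : disc 0 by rewrite /Defs.disc /mkset cabs0.
have tk w : disc w -> cabs (t * k w) < 1.
  move=> w1; rewrite cabsM ct; have := k1 w w1; have := cabs_ge0 (k w); nra.
have htk : hol S (fun w => t * k w) by exact: (holM (hol_cst _ t) hk).
have tk1 w : disc w -> cabs (t * k w) <= 1 by move=> /tk/ltW.
have tk0 : cabs (t * k 0) < 1 by exact: tk.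
have hF := hol_mob tk0 tk1 htk.
have F_le1 w : disc w -> cabs (mob (t * k 0) (t * k w)) <= 1.
  by move=> w1; apply: ltW; apply: mob_disc; exact: tk.
have F0 : mob (t * k 0) (t * k 0) = 0 by rewrite mobxx.
have [k' [_ k'1 k'E]] := Schwarz_div hF F_le1 D0 S0 F0.
have F1 : cabs (mob (t * k 0) (t * k z)) <= cabs z.
  by rewrite k'E// mob0x cabsM ler_piMr ?cabs_ge0 ?k'1.
have dn : 0 < cabs (1 - cconj (t * k 0) * (t * k z)).
  by rewrite cabs_gt0 mob_den_neq0 ?tk// ltW// tk.
move: F1; rewrite /mob cabsM cabsV ler_pdivrMr// -mulrBr cabsM ct.
have tt : cconj t = t by apply/eqP; rewrite eq_complex /= oppr0 !eqxx.
have -> : 1 - cconj (t * k 0) * (t * k z) =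
    (1 - cconj (k 0) * k z) + (1 - t ^+ 2) * (cconj (k 0) * k z) by rewrite cconjM tt; ring.
have := cabsD (1 - cconj (k 0) * k z) ((1 - t ^+ 2) * (cconj (k 0) * k z)).
have : cabs ((1 - t ^+ 2) * (cconj (k 0) * k z)) <= 2 * e.
  rewrite (_ : 1 - t ^+ 2 = cmk (1 - (1 - e) ^+ 2) 0); last first.
    by apply/eqP; rewrite eq_complex /= expr2 /=; apply/andP; split; apply/eqP; ring.
  rewrite !cabsM cabsC cabs_real ger0_norm; last by rewrite expr2; nra.
  have h1 : cabs (k 0) * cabs (k z) <= 1 by apply: mulr_ile1; rewrite ?cabs_ge0 ?k1.
  have h0 : 0 <= cabs (k 0) * cabs (k z) by rewrite mulr_ge0 ?cabs_ge0.
  have h2 : 1 - (1 - e) ^+ 2 <= 2 * e by rewrite expr2; nra.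
  have h3 : 0 <= 1 - (1 - e) ^+ 2 by rewrite expr2; nra.
  by apply: le_trans (ler_piMr h3 h1) h2.
have : cabs (k z - k 0) <= 2 by apply: le_trans (cabsB _ _) _; have := k1 _ z1; have := k1 _ D0; lra.
have := cabs_ge0 z; have z1' : cabs z < 1 := z1.
move: (cabs (k z - k 0)) (cabs z) z1' (cabs (1 - _ + _)) (cabs (1 - _)) (cabs (_ * _)).
move=> X Z Z1 A B D Z0 X2 hD hA h.
have ZA := ler_wpM2l Z0 hA.
have ZD := ler_wpM2l Z0 hD.
have Ze : Z * e <= e by rewrite ler_piMl// ltW.
have eX : e * X <= e * 2 by rewrite ler_wpM2l// ltW.
lra.
Qed.

End Schwarz.

(** * Lower bound for the Lempert function *)

Section LempertBound.
Variable R : realType.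
Local Notation C := (CC R).
Local Notation cabs := (@cabs R).
Local Notation disc := (@disc R).
Local Notation cconj := (@cconj R).
Implicit Types (z w c p q r : C) (f g h k : C -> C) (S : seq C).

Lemma Schwarz_div2 f p q : hol [::] f -> (forall z, disc z -> cabs (f z) <= 1) ->
  disc p -> disc q -> p != q -> f p = 0 -> f q = 0 ->
  exists k, [/\ hol [:: q; p] k, forall z, disc z -> cabs (k z) <= 1 &
    forall z, disc z -> f z = mob p z * mob q z * k z].
Proof.
move=> hf f1 p1 q1 pq fp fq.
have [k1 [hk1 k11 E1]] := Schwarz_div hf f1 p1 (isT : p \notin [::]) fp.
have qp : q \notin [:: p] by rewrite inE eq_sym.
have k1q : k1 q = 0.
  have := E1 q q1; rewrite fq => /esym/eqP; rewrite mulf_eq0 mob_eq0 ?(ltW q1)//.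
  by rewrite eq_sym (negbTE pq) => /eqP.
have [k [hk k1' E]] := Schwarz_div hk1 k11 q1 qp k1q.
by exists k; split=> // z z1; rewrite E1// E// mulrA.
Qed.

Lemma Schwarz_Pick f x y : hol [::] f -> (forall z, disc z -> cabs (f z) < 1) ->
  disc x -> disc y -> cabs (mob (f x) (f y)) <= cabs (mob x y).
Proof.
move=> hf f1 x1 y1.
have f1' z : disc z -> cabs (f z) <= 1 by move=> /f1/ltW.
have hF := hol_mob (f1 _ x1) f1' hf.
have F1 z : disc z -> cabs (mob (f x) (f z)) <= 1.
  by move=> z1; apply/ltW/mob_disc; exact: f1.
have Fx : mob (f x) (f x) = 0 by rewrite mobxx.
have [k [_ k1 E]] := Schwarz_div hF F1 x1 (isT : x \notin [::]) Fx.
by rewrite E// cabsM ler_piMr ?cabs_ge0 ?k1.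
Qed.

(** Write [h = mob p * mob q * k]. Smallness of [h r] and the two separations give
    [|k r| <= e / (s d)], and Schwarz-Pick yields [|k 0| <= |r| + 2 |k r|]; finally
    [|h 0| = |p| |q| |k 0|]. *)
Lemma three_point_bound h p q r (e s d : R) : hol [::] h ->
  (forall z, disc z -> cabs (h z) <= 1) -> disc p -> disc q -> disc r ->
  p != 0 -> q != 0 -> p != q -> h p = 0 -> h q = 0 -> cabs (h r) <= e ->
  0 < s -> 0 < d -> s <= cabs (mob p r) -> d <= cabs (mob q r) ->
  cabs (h 0) <= cabs p * (cabs q * cabs r) + 2 * e / (s * d).
Proof.
move=> hh h1 p1 q1 r1 p0 q0 pq hp hq hr s0 d0 sp dq.
have [k [hk k1 E]] := Schwarz_div2 hh h1 p1 q1 pq hp hq.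
have D0 : disc 0 by rewrite /Defs.disc /mkset cabs0.
have sd : 0 < s * d by rewrite mulr_gt0.
have kr : cabs (k r) <= e / (s * d).
  rewrite ler_pdivlMr//; apply: le_trans hr; rewrite E// 2!cabsM mulrC.
  apply: ler_wpM2r; first exact: cabs_ge0.
  exact: (ler_pM (ltW s0) (ltW d0) sp dq).
have S0 : 0 \notin [:: q; p] by rewrite !inE negb_or !(eq_sym 0) q0 p0.
have SP := Schwarz_Pick0 hk S0 k1 r1.
have k01 := k1 0 D0; have kr1 := k1 r r1.
have h2 : cabs (1 - cconj (k 0) * k r) <= 1 + cabs (k r).
  apply: le_trans (cabsB _ _) _; rewrite cabs1 cabsM cabsC lerD2l.
  by rewrite ler_piMl// cabs_ge0.
have h3 := ler_wpM2l (cabs_ge0 r) h2.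
have h4 : cabs r * cabs (k r) <= cabs (k r) by rewrite ler_piMl ?cabs_ge0// ltW.
have h5 := cabs_subl (k 0) (k r); rewrite cabsBC in h5.
have k0r : cabs (k 0) <= cabs r + 2 * (e / (s * d)) by lra.
rewrite E// !mobx0 !cabsM !cabsN.
have pq1 : cabs p * cabs q <= 1 by rewrite mulr_ile1 ?cabs_ge0// ltW.
have pq0 : 0 <= cabs p * cabs q by rewrite mulr_ge0 ?cabs_ge0.
apply: le_trans (ler_wpM2l pq0 k0r) _; rewrite mulrDr !mulrA lerD2l.
have e0 : 0 <= 2 * e / (s * d).
  by rewrite divr_ge0 ?(ltW sd)// mulr_ge0// (le_trans (cabs_ge0 _) hr).
rewrite -!mulrA mulrA; apply: ler_piMl => //.
by rewrite -mulrA in e0.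
Qed.

(** In Schwarz-Pick, [1 - (k 0)^* k z] equals [1 - |k 0|^2] minus [(k 0)^* (k z - k 0)]. With
    [D = |k z - k 0|] this gives [D <= rho (2 e + D)], which is solved for [D]. *)
Lemma almost_constant S k (e rho : R) z : hol S k -> 0 \notin S ->
  (forall z, disc z -> cabs (k z) <= 1) -> 1 - e <= cabs (k 0) -> 0 <= e ->
  rho < 1 -> cabs z <= rho -> cabs (k z - k 0) <= 2 * e / (1 - rho).
Proof.
move=> hk S0 k1 ke e0 rho1 zr.
have z1 : disc z by exact: le_lt_trans zr rho1.
have D0 : disc 0 by rewrite /Defs.disc /mkset cabs0.
have SP := Schwarz_Pick0 hk S0 k1 z1.
have k01 := k1 0 D0; have k00 := cabs_ge0 (k 0).
have E : 1 - cconj (k 0) * k z = cmk (1 - cabs (k 0) ^+ 2) 0 - cconj (k 0) * (k z - k 0).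
  have := cconj_mul (k 0) => /= h.
  have -> : cmk (1 - cabs (k 0) ^+ 2) 0 = 1 - cmk (cabs (k 0) ^+ 2) 0.
    by apply/eqP; rewrite eq_complex /= oppr0 addr0 !eqxx.
  by rewrite -h; ring.
have sq1 : 0 <= 1 - cabs (k 0) ^+ 2 by rewrite subr_ge0 expr_le1.
have h2 : cabs (1 - cconj (k 0) * k z) <= 2 * e + cabs (k z - k 0).
  rewrite E; apply: le_trans (cabsB _ _) _; rewrite cabs_real ger0_norm// cabsM cabsC.
  apply: lerD; last by rewrite ler_piMl ?cabs_ge0.
  rewrite expr2; nra.
have rho0 : 0 <= rho by apply: le_trans zr; exact: cabs_ge0.
have h3 : cabs z * cabs (1 - cconj (k 0) * k z) <= rho * (2 * e + cabs (k z - k 0)).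
  by apply: ler_pM; rewrite ?cabs_ge0.
have h4 : rho * (2 * e) <= 2 * e by rewrite ler_piMl ?mulr_ge0// ltW.
by rewrite ler_pdivlMr ?subr_gt0//; lra.
Qed.

(** The left argument [w] is the coordinate of a point with respect to the centre of an involution,
    and [- w] that of its image: they stay apart when [w] is not small. *)
Lemma mob_opp_ge w : cabs w < 1 -> cabs w <= cabs (mob w (- w)).
Proof.
move=> w1; have w1' : cabs (- w) <= 1 by rewrite cabsN ltW.
rewrite /mob cabsM cabsV ler_pdivlMr ?cabs_gt0 ?mob_den_neq0//.
have -> : - w - w = - (2 * w) by ring.
rewrite cabsN cabsM cabs_natr mulrC ler_wpM2r ?cabs_ge0//.
apply: le_trans (cabsB _ _) _; rewrite cabs1 cabsM cabsC cabsN.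
have := cabs_ge0 w; nra.
Qed.

Lemma mob_sqr_lower c z (t : R) : cabs c < 1 -> cabs z < 1 -> 0 <= t ->
  t <= (1 - cabs c ^+ 2) * (1 - cabs z ^+ 2) -> t / 4 <= 1 - cabs (mob c z) ^+ 2.
Proof.
move=> c1 z1 t0 tle; rewrite mob_sqr ?(ltW z1)//.
have d0 : 0 < cabs (1 - cconj c * z) by rewrite cabs_gt0 mob_den_neq0// ltW.
have d2 : cabs (1 - cconj c * z) <= 2.
  apply: le_trans (cabsB _ _) _; rewrite cabs1 cabsM cabsC.
  have := cabs_ge0 c; have := cabs_ge0 z; nra.
rewrite ler_pdivlMr ?exprn_gt0//; apply: le_trans tle.
have : cabs (1 - cconj c * z) ^+ 2 <= 4.
  by rewrite (_ : 4 = 2 ^+ 2); [rewrite lerXn2r ?nnegrE ?cabs_ge0|rewrite -natrX].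
nra.
Qed.

Lemma le_of_sqr (x t : R) : 0 <= t -> t <= 1 -> x ^+ 2 <= 1 - t -> x <= 1 - t / 2.
Proof. by move=> t0 t1; rewrite expr2 => h; nra. Qed.

(** For nearby points [|x| |y|] is almost [|x|^2], hence [|x|^2] is almost at most [A]. The square
    of [(1 + A) / 2] exceeds [A] by [(1 - A)^2 / 4], which is the room left for the errors. *)
Lemma close_radius x y (A e d : R) : cabs x < 1 -> cabs y < 1 -> 0 < A < 1 -> 0 <= e ->
  cabs (mob x y) < d -> 0 < d -> cabs x * cabs y <= A * (1 + e) -> e + 2 * d <= (1 - A) ^+ 2 / 4 ->
  cabs (y - x) <= 2 * d /\ cabs x <= (1 + A) / 2.
Proof.
move=> x1 y1 /andP[A0 A1] e0 md d0 xy ed.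
have yx : cabs (y - x) <= 2 * d.
  case: (mob_sub x1 y1) => [|->]; first lra.
  by rewrite subrr cabs0; lra.
split=> //; rewrite leNgt; apply/negP => xA.
have := cabs_subl x y; rewrite cabsBC => h.
have x0 := cabs_ge0 x; have y0 := cabs_ge0 y.
have h1 : cabs x * (cabs x - 2 * d) <= A * (1 + e) by apply: le_trans xy; apply: ler_wpM2l => //; lra.
have h2 : cabs x * d <= d by rewrite ler_piMl ?ltW.
have h3 : A * e <= e by rewrite ler_piMl// ltW.
have : ((1 + A) / 2) ^+ 2 < cabs x ^+ 2 by rewrite ltr_pXn2r ?nnegrE//; lra.
have : ((1 + A) / 2) ^+ 2 = A + (1 - A) ^+ 2 / 4 by field.
rewrite [cabs x ^+ 2]expr2; lra.
Qed.

(* If both pairs were close, [f] would be invariant, up to a small error, under the disc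
   involutions fixing [z1] and [z2]: indeed [mob a \o f] is almost a unimodular multiple of
   [mob z1 ^+ 2].  Then [f] would almost take the value [a] at the image [p'] of [z1] under the
   involution fixing [z2], where [mob a \o f] has modulus about [mob z1 p' ^+ 2]. *)
Lemma preimages_separated (a : C) : a != 0 -> cabs a < 1 ->
  exists2 d : R, 0 < d & forall f z1 z2 z3 z4, hol [::] f -> (forall z, disc z -> cabs (f z) < 1) ->
    f 0 = 0 -> disc z1 -> disc z2 -> disc z3 -> disc z4 -> z1 != z4 -> z2 != z3 ->
    f z1 = a -> f z4 = a -> f z2 = - a -> f z3 = - a ->
    cabs z1 * cabs z4 <= cabs a * (1 + d) -> cabs z2 * cabs z3 <= cabs a * (1 + d) ->
    d <= cabs (mob z1 z4) \/ d <= cabs (mob z2 z3).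
Proof.
move=> a0 a1; pose A := cabs a; have A0 : 0 < A by rewrite cabs_gt0.
have A1 : A < 1 by [].
have A01 : 0 < A < 1 by rewrite A0.
have na1 : cabs (- a) < 1 by rewrite cabsN.
pose r0 := (1 + A) / 2; have r01 : r0 < 1 by rewrite /r0; lra.
have r00 : 0 < r0 by rewrite /r0; lra.
(* Lower bound for [1 - |p'|^2]: [p'] arises from [z1] and [z2], of modulus at most [r0], by two
   Mobius maps, each costing a factor [4] in [mob_sqr_lower]. Hence [|p'| <= rho]. *)
pose B := (1 - r0 ^+ 2) ^+ 3 / 16.
have u0 : 0 < 1 - r0 ^+ 2 by rewrite subr_gt0 expr_lt1// ltW.
have u1 : 1 - r0 ^+ 2 <= 1 by rewrite gerBl exprn_ge0// ltW.
have u3 : (1 - r0 ^+ 2) ^+ 3 <= 1 - r0 ^+ 2 by rewrite exprS ler_piMr ?(ltW u0)// exprn_ile1// ltW.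
have B0 : 0 < B by rewrite divr_gt0// exprn_gt0.
have B1 : B <= 1 - r0 ^+ 2 by rewrite /B; lra.
pose rho := 1 - B / 2.
have rho1 : rho < 1 by rewrite /rho; lra.
pose s0 := cabs (mob (- a) a).
have s00 : 0 < s0.
  rewrite cabs_gt0 mob_eq0 ?(ltW a1)// -addr_eq0 -mulr2n -mulr_natl mulf_eq0 (negbTE a0) orbF.
  by rewrite pnatr_eq0.
pose c1 := 1 - s0; have c10 : 0 < c1 by rewrite subr_gt0 mob_disc.
have s01 : s0 < 1 by rewrite /c1 in c10; lra.
(* The common error. The bound [s0 / 2] keeps [mob z4 p'] away from [0], [1 / 4] does so for
   [kg p'], and the third makes the final [c1 s0^2 / 4 <= 4 tau] impossible. *)
pose tau := Num.min (Num.min (s0 / 2) (1 / 4)) (c1 * s0 ^+ 2 / 32).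
have tau0 : 0 < tau.
  rewrite !lt_min; apply/andP; split; last by rewrite divr_gt0// mulr_gt0// exprn_gt0.
  by apply/andP; split; lra.
have tau1 : tau <= s0 / 2 by rewrite !ge_min lexx.
have tau2 : tau <= 1 / 4 by rewrite !ge_min lexx orbT.
have tau3 : tau <= c1 * s0 ^+ 2 / 32 by rewrite ge_min lexx orbT.
(* In turn: moving a Mobius centre by [2 d] changes its values by at most [tau]; [close_radius]
   applies; quotients with [|k 0| >= 1 - d] are constant up to [tau] on [|z| <= rho]. *)
pose d := Num.min (Num.min (tau * (1 - r0) ^+ 2 / 8) ((1 - A) ^+ 2 / 16)) (tau * B / 4).
have d0 : 0 < d.
  rewrite !lt_min; apply/andP; split; last by rewrite divr_gt0// mulr_gt0.
  by apply/andP; split; rewrite divr_gt0 ?mulr_gt0 ?exprn_gt0 ?subr_gt0.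
have d1 : 8 * d / (1 - r0) ^+ 2 <= tau.
  rewrite ler_pdivrMr ?exprn_gt0 ?subr_gt0//.
  have : d <= tau * (1 - r0) ^+ 2 / 8 by rewrite !ge_min lexx.
  lra.
have d2 : d <= (1 - A) ^+ 2 / 16 by rewrite !ge_min lexx orbT.
have d3 : 2 * d / (1 - rho) <= tau.
  have B2 : 0 < B / 2 by lra.
  rewrite /rho opprB addrC subrK ler_pdivrMr//.
  have : d <= tau * B / 4 by rewrite ge_min lexx orbT.
  lra.
have d4 : d <= tau.
  have : d <= tau * B / 4 by rewrite ge_min lexx orbT.
  have : tau * B <= tau by rewrite ler_piMr ?(ltW tau0)//; lra.
  lra.
exists d; first exact: d0.
move=> f z1 z2 z3 z4 hf f1 f0 z11 z21 z31 z41 z14 z23 fz1 fz4 fz2 fz3 p14 p23.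
have [|m14] := leP d (cabs (mob z1 z4)); first by left.
have [|m23] := leP d (cabs (mob z2 z3)); [by right|exfalso].
have m41 : cabs (mob z4 z1) < d by rewrite cabs_mobC.
have m32 : cabs (mob z3 z2) < d by rewrite cabs_mobC.
have dd : d + 2 * d <= (1 - A) ^+ 2 / 4 by lra.
have p41 : cabs z4 * cabs z1 <= A * (1 + d) by rewrite mulrC.
have p32 : cabs z3 * cabs z2 <= A * (1 + d) by rewrite mulrC.
have [y14 r1] := close_radius z11 z41 A01 (ltW d0) m14 d0 p14 dd.
have [_ r4] := close_radius z41 z11 A01 (ltW d0) m41 d0 p41 dd.
have [y23 r2] := close_radius z21 z31 A01 (ltW d0) m23 d0 p23 dd.
have [_ r3] := close_radius z31 z21 A01 (ltW d0) m32 d0 p32 dd.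
have f1' z : disc z -> cabs (f z) <= 1 by move=> /f1/ltW.
have D0 : disc 0 by rewrite /Defs.disc /mkset cabs0.
have z10 : z1 != 0 by apply: contra_neq a0 => z0; rewrite -fz1 z0.
have z40 : z4 != 0 by apply: contra_neq a0 => z0; rewrite -fz4 z0.
have z20 : z2 != 0 by apply: contra_neq a0 => z0; rewrite -[a]opprK -fz2 z0 f0 oppr0.
have z30 : z3 != 0 by apply: contra_neq a0 => z0; rewrite -[a]opprK -fz3 z0 f0 oppr0.
(* At [0] the factorisation reads [A = |x| |y| |k 0|], so the near-equality [|x| |y| <= A (1 + d)]
   forces [|k 0|] close to [1]. *)
have factor c x y : cabs c = A -> disc x -> disc y -> x != y -> x != 0 -> y != 0 ->
    f x = c -> f y = c -> cabs x * cabs y <= A * (1 + d) ->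
    exists k, [/\ hol [:: y; x] k, forall z, disc z -> cabs (k z) <= 1,
      forall z, disc z -> mob c (f z) = mob x z * mob y z * k z,
      forall z, cabs z <= rho -> cabs (k z - k 0) <= tau & 1 - d <= cabs (k 0)].
  move=> cA x1 y1 xy x0 y0 fx fy pxy.
  have c11 : cabs c < 1 by rewrite cA.
  have hg := hol_mob c11 f1' hf.
  have g1 z : disc z -> cabs (mob c (f z)) <= 1 by move=> zz; apply/ltW/mob_disc => //; exact: f1.
  have gx : mob c (f x) = 0 by rewrite fx mobxx.
  have gy : mob c (f y) = 0 by rewrite fy mobxx.
  have [k [hk k1 E]] := Schwarz_div2 hg g1 x1 y1 xy gx gy.
  have k0 : 1 - d <= cabs (k 0).
    have := E 0 D0; rewrite f0 !mobx0 => /(congr1 cabs).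
    rewrite cabsN 2!cabsM !cabsN cA => Ak.
    have h : A <= A * (1 + d) * cabs (k 0) by rewrite {1}Ak ler_wpM2r ?cabs_ge0.
    have {}h : 1 <= (1 + d) * cabs (k 0) by rewrite -mulrA ler_pMr in h.
    by move: h (ler_wpM2l (ltW d0) (k1 0 D0)); clear; lra.
  exists k; split => // z zr; apply: le_trans d3.
  apply: (almost_constant hk _ k1 k0 (ltW d0) rho1 zr).
  by rewrite !inE negb_or !(eq_sym 0) x0 y0.
have [kg [hkg kg1 Eg kgc kg0]] := factor a z1 z4 (erefl A) z11 z41 z14 z10 z40 fz1 fz4 p14.
have [kh [hkh kh1 Eh khc _]] := factor (- a) z2 z3 (cabsN a) z21 z31 z23 z20 z30 fz2 fz3 p23.
(* In the coordinate [mob z2], [z1] is [w] and [p'] is [- w]: [p'] is the image of [z1] under the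
   involution fixing [z2]. *)
pose w := mob z2 z1; pose p' := mob (- z2) (- w).
have w1 : cabs w < 1 by exact: mob_disc.
have nw1 : cabs (- w) < 1 by rewrite cabsN.
have nz2 : cabs (- z2) < 1 by rewrite cabsN.
have mp' : mob z2 p' = - w by rewrite /p' mobNK// ltW.
have p'1 : disc p' by exact: mob_disc.
have sq x : cabs x <= r0 -> 1 - r0 ^+ 2 <= 1 - cabs x ^+ 2.
  by move=> xr; rewrite lerB// lerXn2r ?nnegrE ?cabs_ge0// ltW.
have p'rho : cabs p' <= rho.
  have hw : (1 - r0 ^+ 2) ^+ 2 / 4 <= 1 - cabs w ^+ 2.
    apply: mob_sqr_lower => //; first by rewrite exprn_ge0// ltW.
    by rewrite expr2; apply: ler_pM; rewrite ?(ltW u0) ?sq.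
  have : (1 - r0 ^+ 2) ^+ 3 / 4 / 4 <= 1 - cabs p' ^+ 2.
    apply: mob_sqr_lower => //; first by rewrite divr_ge0// exprn_ge0// ltW.
    rewrite !cabsN exprS -mulrA; apply: ler_pM; rewrite ?(ltW u0) ?sq//.
    by rewrite divr_ge0// exprn_ge0// ltW.
  move=> h; apply: le_of_sqr; first exact: ltW.
    by apply: le_trans B1 u1.
  by move: h; rewrite /B; clear; lra.
have z1rho : cabs z1 <= rho.
  by apply: le_of_sqr; [exact: ltW|exact: le_trans B1 u1|move: (sq _ r1) B1; clear; lra].
have near x y z : disc x -> disc y -> disc z -> cabs x <= r0 -> cabs y <= r0 ->
    cabs (y - x) <= 2 * d -> cabs (mob y z - mob x z) <= tau.
  move=> x1 y1 zz xr yr yx; apply: le_trans (mob_param y1 x1 zz) _; apply: le_trans d1.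
  have q0 : 0 < (1 - r0) ^+ 2 by rewrite exprn_gt0// subr_gt0.
  have yp : 1 - r0 <= 1 - cabs y by rewrite lerB.
  have xp : 1 - r0 <= 1 - cabs x by rewrite lerB.
  have v0 : 0 < 1 - r0 by rewrite subr_gt0.
  have q1 : (1 - r0) ^+ 2 <= (1 - cabs y) * (1 - cabs x).
    by rewrite expr2; exact: (ler_pM (ltW v0) (ltW v0) yp xp).
  have q2 : 0 < (1 - cabs y) * (1 - cabs x) by exact: lt_le_trans q1.
  apply: ler_pM.
  - by rewrite mulr_ge0 ?cabs_ge0.
  - by rewrite invr_ge0 ltW.
  - by move: yx; clear; lra.
  - by rewrite lef_pV2 ?posrE.
have n1 := near _ _ _ z21 z31 p'1 r2 r3 y23.
have n2 := near _ _ _ z21 z31 z11 r2 r3 y23.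
have n3 := near _ _ _ z11 z41 p'1 r1 r4 y14.
have ws : s0 <= cabs w by rewrite /s0 -{1}fz2 -fz1; exact: Schwarz_Pick.
(* If [z3] were [z2] and [kh] constant, the values at [p'] and [z1] would agree, as [w] enters
   squared. Each of the two perturbations costs [2 tau]. *)
have hdiff : cabs (mob (- a) (f p') - mob (- a) a) <= 4 * tau.
  rewrite -[X in _ - mob _ X]fz1 !Eh// mp' -/w.
  rewrite (_ : _ - _ = - w * ((mob z3 p' + mob z3 z1) * kh p' +
     mob z3 z1 * (kh z1 - kh p'))); last by ring.
  rewrite cabsM cabsN; apply: le_trans (ler_piMl (cabs_ge0 _) (ltW w1)) _.
  apply: le_trans (cabsD _ _) _.
  have e1 : cabs (mob z3 p' + mob z3 z1) <= 2 * tau.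
    rewrite (_ : _ + _ = (mob z3 p' - mob z2 p') + (mob z3 z1 - mob z2 z1)); last by rewrite mp' /w; ring.
    by apply: le_trans (cabsD _ _) _; move: n1 n2; clear; lra.
  have e2 : cabs (kh z1 - kh p') <= 2 * tau.
    apply: le_trans (cabs_tri (kh 0) _ _) _; rewrite [X in _ + X]cabsBC.
    by move: (khc _ p'rho) (khc _ z1rho); clear; lra.
  have e3 : cabs ((mob z3 p' + mob z3 z1) * kh p') <= 2 * tau.
    rewrite cabsM; apply: le_trans e1; rewrite ler_piMr ?cabs_ge0//; exact: kh1.
  have e4 : cabs (mob z3 z1 * (kh z1 - kh p')) <= 2 * tau.
    rewrite cabsM; apply: le_trans e2; rewrite ler_piMl ?cabs_ge0//; exact/ltW/mob_disc.
  by move: e3 e4; clear; lra.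
have fp'1 : cabs (f p') < 1 by exact: f1.
(* Invariance under [mob (- a)] converts the previous estimate into closeness of [f p'] to [a]; [c1]
   bounds the Mobius denominator from below. *)
have upper : cabs (mob a (f p')) * c1 <= 4 * tau.
  rewrite -(@cabs_mob_mob R (- a))// {1}/mob cabsM cabsV.
  have H1 : cabs (mob (- a) a) < 1 by exact: mob_disc.
  have H2 : cabs (mob (- a) (f p')) < 1 by exact: mob_disc.
  have den := mob_den_ge H1 (ltW H2).
  have den0 : 0 < cabs (1 - cconj (mob (- a) a) * mob (- a) (f p')) by exact: lt_le_trans den.
  rewrite mulrAC ler_pdivrMr//.
  apply: (@le_trans _ _ (4 * tau * c1)); first by rewrite ler_pM2r.
  by rewrite ler_pM2l// mulr_gt0.
have l1 : s0 <= cabs (mob z1 p').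
  rewrite -(@cabs_mob_mob R z2)// mp' -/w; exact: le_trans ws (mob_opp_ge w1).
have l2 : s0 / 2 <= cabs (mob z4 p').
  have := cabs_subl (mob z1 p') (mob z4 p'); rewrite cabsBC.
  by move: l1 n3 tau1; clear; lra.
have l3 : 1 / 2 <= cabs (kg p').
  have := cabs_subl (kg 0) (kg p'); rewrite cabsBC.
  by move: (kgc _ p'rho) kg0 tau2 d4; clear; lra.
have lower : s0 * (s0 / 2) * (1 / 2) <= cabs (mob a (f p')).
  have half0 : 0 <= s0 / 2 by rewrite divr_ge0// ltW.
  rewrite Eg// 2!cabsM; apply: ler_pM => //; last exact: (ler_pM (ltW s00) half0 l1 l2).
  by rewrite mulr_ge0// ltW.
have fin1 := le_trans (ler_wpM2r (ltW c10) lower) upper.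
have fin2 : 0 < c1 * s0 ^+ 2 by rewrite mulr_gt0// exprn_gt0.
move: fin1; rewrite (_ : _ * c1 = c1 * s0 ^+ 2 / 4); last by field.
by clear -fin2 tau3; move: (c1 * s0 ^+ 2) fin2 tau3 => X; lra.
Qed.

End LempertBound.

(** * The gap for the Lempert function with four poles *)

Section LempertGap.
Variable R : realType.
Local Notation C := (CC R).
Local Notation cabs := (@cabs R).
Local Notation disc := (@disc R).
Implicit Types (z w c p q r : C) (f g h k : C -> C).

(** The power [3/2] in squared form: [x <= B^(1/2)] and [y <= B] give [x y <= B^(3/2)]. It is used
    with [x = |p|], [y = |q r|] and [B = |a| (1 + e)]. *)
Lemma sqr_le_cube (G x y B k : R) : 0 <= x -> 0 <= y -> x ^+ 2 <= B -> y <= B ->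
  0 <= G - k -> G <= x * y + k -> (G - k) ^+ 2 <= B ^+ 3.
Proof.
move=> x0 y0 xB yB Gk GB.
have h : (G - k) ^+ 2 <= (x * y) ^+ 2 by rewrite lerXn2r ?nnegrE ?mulr_ge0//; lra.
apply: (le_trans h); rewrite exprMn exprS.
have B0 : 0 <= B by exact: le_trans yB.
by apply: ler_pM; [exact: sqr_ge0|exact: sqr_ge0|exact: xB|rewrite lerXn2r ?nnegrE].
Qed.

Lemma mob_lower c z : cabs c < 1 -> cabs z < 1 -> cabs z - 2 * cabs c <= cabs (mob c z).
Proof.
move=> c1 z1; have [le0|gt0] := leP (cabs z - 2 * cabs c) 0.
  by apply: le_trans le0 _; exact: cabs_ge0.
rewrite /mob cabsM cabsV ler_pdivlMr; last by rewrite cabs_gt0 mob_den_neq0// ltW.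
apply: le_trans (cabs_subl z c).
have n2 : cabs (1 - cconj c * z) <= 1 + cabs c.
  apply: le_trans (cabsB _ _) _; rewrite cabs1 cabsM cabsC lerD2l.
  by rewrite ler_piMr ?cabs_ge0// ltW.
apply: le_trans (ler_wpM2l (ltW gt0) n2) _.
have := cabs_ge0 c; nra.
Qed.

(** Four cases, by the separated pair and the smaller point of the other pair. They reduce to one by
    symmetry: if the smaller point lies at height [eps], [mob eps \o h] replaces [h]. *)
Lemma lempert_gap (a gamma : C) : a != 0 -> cabs a < 1 -> cabs gamma < 1 ->
  cabs a ^+ 3 < cabs gamma ^+ 2 ->
  exists e d : R, [/\ 0 < e, 0 < d & forall (eps : C) f h z1 z2 z3 z4, 0 < cabs eps < d ->
    hol [::] f -> (forall z, disc z -> cabs (f z) < 1) -> f 0 = 0 ->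
    hol [::] h -> (forall z, disc z -> cabs (h z) < 1) -> h 0 = gamma ->
    disc z1 -> disc z2 -> disc z3 -> disc z4 ->
    f z1 = a -> f z2 = - a -> f z3 = - a -> f z4 = a ->
    h z1 = 0 -> h z2 = 0 -> h z3 = eps -> h z4 = eps ->
    cabs a ^+ 2 * (1 + e) <= cabs z1 * cabs z2 * cabs z3 * cabs z4].
Proof.
move=> a0 a1 g1 ag; pose A := cabs a; pose g := cabs gamma.
have A0 : 0 < A by rewrite cabs_gt0.
have g0 : 0 <= g by exact: cabs_ge0.
have [d d0 sep] := preimages_separated a0 a1.
have na1 : cabs (- a) < 1 by rewrite cabsN.
pose s := cabs (mob (- a) a).
have ana : a != - a.
  by rewrite -addr_eq0 -mulr2n -mulr_natl mulf_eq0 (negbTE a0) orbF pnatr_eq0.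
have s0 : 0 < s by rewrite cabs_gt0 mob_eq0 ?(ltW a1).
pose th := g ^+ 2 - A ^+ 3; have th0 : 0 < th by rewrite subr_gt0.
have thg : th <= g.
  have := exprn_gt0 3 A0; rewrite /th expr2.
  have : g * g <= g by rewrite ler_piMr// ltW.
  lra.
pose k := th / 8; have k0 : 0 < k by rewrite divr_gt0.
have k_le : k <= g by rewrite /k; lra.
(* As [(1 + e)^3 <= 1 + 7 e], the bound [th / 14] costs at most [th / 2], while [k = th / 8] costs
   at most [th / 4] in [(g - k)^2]; together less than [th]. *)
pose e := Num.min d (Num.min 1 (th / 14)).
have e0 : 0 < e by rewrite !lt_min d0 ltr01 divr_gt0.
have e_d : e <= d by rewrite ge_min lexx.
have e_1 : e <= 1 by rewrite !ge_min lexx orbT.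
have e_th : e <= th / 14 by rewrite !ge_min lexx !orbT.
have cube : (A * (1 + e)) ^+ 3 < (g - k) ^+ 2.
  have h1 : (1 + e) ^+ 3 <= 1 + 7 * e.
    rewrite (_ : (1 + e) ^+ 3 = 1 + 3 * e + 3 * (e * e) + e * (e * e)); last by ring.
    have ee : e * e <= e by rewrite ler_piMr// ltW.
    have := ler_wpM2l (ltW e0) ee; lra.
  have A31 : A ^+ 3 <= 1 by rewrite exprn_ile1// ltW.
  have A30 : 0 <= A ^+ 3 by rewrite exprn_ge0// ltW.
  have h2 : A ^+ 3 * (1 + e) ^+ 3 <= A ^+ 3 + th / 2.
    apply: le_trans (ler_wpM2l A30 h1) _; rewrite mulrDr mulr1 lerD2l.
    have := ler_piMl (ltW e0) A31; lra.
  have h3 : k * g <= k by rewrite ler_piMr// ltW.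
  rewrite exprMn; apply: le_lt_trans h2 _.
  rewrite (_ : (g - k) ^+ 2 = A ^+ 3 + th - 2 * (k * g) + k ^+ 2); last by rewrite /th; ring.
  have := sqr_ge0 k; have k8 : k = th / 8 by [].
  lra.
(* Collects both [eps] errors: [2 |eps| / (s d)] from [three_point_bound] and [2 |eps|] from
   replacing [h] by [mob eps \o h]. *)
pose m0 := 2 / (s * d) + 2.
have m00 : 0 < m0 by rewrite addr_gt0// divr_gt0// mulr_gt0.
pose dl := Num.min (1 / 2) (k / m0).
have dl0 : 0 < dl by rewrite lt_min divr_gt0//= divr_gt0.
exists e, dl; split=> // eps f h z1 z2 z3 z4 /andP[eps0 epsd].
move=> hf f1 f0 hh h1 hg z11 z21 z31 z41 fz1 fz2 fz3 fz4 hz1 hz2 hz3 hz4.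
have eps1 : cabs eps < 1.
  by have : dl <= 1 / 2; [rewrite ge_min lexx|lra].
have epsk : 2 * cabs eps / (s * d) + 2 * cabs eps <= k.
  have : cabs eps <= k / m0 by rewrite (le_trans (ltW epsd))// ge_min lexx orbT.
  by rewrite ler_pdivlMr// /m0 mulrDr; lra.
have eps_ne : eps != 0 by rewrite -cabs_gt0.
have f1' z : disc z -> cabs (f z) <= 1 by move=> /f1/ltW.
have h1' z : disc z -> cabs (h z) <= 1 by move=> /h1/ltW.
have z_ne c x : f x = c -> c != 0 -> x != 0 by move=> fx; apply: contra_neq => x0; rewrite -fx x0.
have na0 : - a != 0 by rewrite oppr_eq0.
have z10 := z_ne _ _ fz1 a0; have z20 := z_ne _ _ fz2 na0.
have z30 := z_ne _ _ fz3 na0; have z40 := z_ne _ _ fz4 a0.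
have z14 : z1 != z4 by apply: contra_neq eps_ne => zz; rewrite -hz4 -zz.
have z23 : z2 != z3 by apply: contra_neq eps_ne => zz; rewrite -hz3 -zz.
have opp x y : f x = a -> f y = - a -> x != y by move=> fx fy; apply: contra_neq ana => xy; rewrite -fy -xy.
rewrite leNgt; apply/negP => small.
have pair c x y : cabs c = A -> disc x -> disc y -> x != y -> f x = c -> f y = c ->
    A <= cabs x * cabs y.
  move=> cA x1 y1 xy fx fy; have c1 : cabs c < 1 by rewrite cA.
  have D0 : disc 0 by rewrite /Defs.disc /mkset cabs0.
  have G1 z : disc z -> cabs (mob c (f z)) <= 1.
    by move=> zz; apply/ltW/mob_disc => //; exact: f1.
  have Gx : mob c (f x) = 0 by rewrite fx mobxx.
  have Gy : mob c (f y) = 0 by rewrite fy mobxx.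
  have [kk [_ kk1 E]] := Schwarz_div2 (hol_mob c1 f1' hf) G1 x1 y1 xy Gx Gy.
  have := E 0 D0; rewrite f0 !mobx0 => /(congr1 cabs).
  rewrite cabsN 2!cabsM !cabsN cA => ->; rewrite ler_piMr ?mulr_ge0 ?cabs_ge0//.
  exact: kk1.
have P14 := pair a _ _ (erefl A) z11 z41 z14 fz1 fz4.
have P23 := pair (- a) _ _ (cabsN a) z21 z31 z23 fz2 fz3.
have small' : (cabs z1 * cabs z4) * (cabs z2 * cabs z3) < A * (A * (1 + e)).
  by move: small; rewrite expr2 -!mulrA [cabs z2 * (_ * _)]mulrA [(cabs z2 * _) * _]mulrC.
have A1e : 0 < A * (1 + e) by rewrite mulr_gt0// addr_gt0.
(* Each pair has product at least [A], so an upper bound on the product of all four moduli bounds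
   each pair from above. *)
have U14 : cabs z1 * cabs z4 <= A * (1 + e).
  rewrite leNgt; apply/negP => U; move: small'; apply/negP; rewrite -leNgt mulrC.
  by apply: ler_pM => //; exact: ltW.
have U23 : cabs z2 * cabs z3 <= A * (1 + e).
  rewrite leNgt; apply/negP => U; move: small'; apply/negP; rewrite -leNgt.
  by apply: ler_pM => //; exact: ltW.
have le_d x : x <= A * (1 + e) -> x <= A * (1 + d).
  by move=> /le_trans; apply; rewrite ler_pM2l// lerD2l.
have s_opp x y : disc x -> disc y -> f x = a -> f y = - a ->
    s <= cabs (mob x y) /\ s <= cabs (mob y x).
  move=> x1 y1 fx fy; suff h0 : s <= cabs (mob y x) by rewrite [cabs (mob x y)]cabs_mobC.
  by rewrite /s -{1}fy -fx; exact: Schwarz_Pick.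
have sq_min x y : cabs x <= cabs y -> cabs x * cabs y <= A * (1 + e) ->
    cabs x ^+ 2 <= A * (1 + e).
  by move=> xy; apply: le_trans; rewrite expr2 ler_wpM2l ?cabs_ge0.
(* Here [(q, r)] is the separated pair and [p] the smaller point of the other one; [p] and [q] share
   a height, at which [H] vanishes. *)
have conclude H p q r : hol [::] H -> (forall z, disc z -> cabs (H z) <= 1) ->
    g - 2 * cabs eps <= cabs (H 0) -> disc p -> disc q -> disc r ->
    p != 0 -> q != 0 -> p != q -> H p = 0 -> H q = 0 -> cabs (H r) <= cabs eps ->
    s <= cabs (mob p r) -> d <= cabs (mob q r) ->
    cabs p ^+ 2 <= A * (1 + e) -> cabs q * cabs r <= A * (1 + e) -> False.
  move=> hH H1 H0 p1 q1 r1 p0 q0' pq Hp Hq Hr sp dq pp qr.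
  have B := three_point_bound hH H1 p1 q1 r1 p0 q0' pq Hp Hq Hr s0 d0 sp dq.
  have gk : 0 <= g - k by rewrite subr_ge0.
  have Gle : g <= cabs p * (cabs q * cabs r) + k.
    move: (cabs p * (cabs q * cabs r)) (2 * cabs eps / (s * d)) epsk (cabs (H 0)) H0 B.
    by clear => X Y h1 Z h2 h3; lra.
  have := sqr_le_cube (cabs_ge0 p) (mulr_ge0 (cabs_ge0 q) (cabs_ge0 r)) pp qr gk Gle.
  by rewrite leNgt cube.
have hH2 := hol_mob eps1 h1' hh.
have H21 z : disc z -> cabs (mob eps (h z)) <= 1.
  by move=> zz; apply/ltW/mob_disc => //; exact: h1.
have H1_0 : g - 2 * cabs eps <= cabs (h 0).
  by rewrite hg -/g gerBl mulr_ge0 ?cabs_ge0.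
have H2_0 : g - 2 * cabs eps <= cabs (mob eps (h 0)).
  by rewrite hg; exact: mob_lower.
have H2z3 : mob eps (h z3) = 0 by rewrite hz3 mobxx.
have H2z4 : mob eps (h z4) = 0 by rewrite hz4 mobxx.
have H2z1 : cabs (mob eps (h z1)) <= cabs eps by rewrite hz1 mobx0 cabsN.
have H2z2 : cabs (mob eps (h z2)) <= cabs eps by rewrite hz2 mobx0 cabsN.
have h_z3 : cabs (h z3) <= cabs eps by rewrite hz3.
have h_z4 : cabs (h z4) <= cabs eps by rewrite hz4.
have [s12 s21] := s_opp _ _ z11 z21 fz1 fz2; have [s13 s31] := s_opp _ _ z11 z31 fz1 fz3.
have [s42 s24] := s_opp _ _ z41 z21 fz4 fz2; have [s43 s34] := s_opp _ _ z41 z31 fz4 fz3.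
have U41 : cabs z4 * cabs z1 <= A * (1 + e) by rewrite mulrC.
have U32 : cabs z3 * cabs z2 <= A * (1 + e) by rewrite mulrC.
have ne12 := opp _ _ fz1 fz2; have ne43 := opp _ _ fz4 fz3.
have ne21 : z2 != z1 by rewrite eq_sym.
have ne34 : z3 != z4 by rewrite eq_sym.
have [d14|d23] := sep f z1 z2 z3 z4 hf f1 f0 z11 z21 z31 z41 z14 z23 fz1 fz4 fz2 fz3
  (le_d _ U14) (le_d _ U23).
  have d41 : d <= cabs (mob z4 z1) by rewrite cabs_mobC.
  have [m|/ltW m] := leP (cabs z2) (cabs z3).
    exact: (conclude h z2 z1 z4 hh h1' H1_0 z21 z11 z41 z20 z10 ne21 hz2 hz1 h_z4 s24 d14 (sq_min _ _ m U23) U14).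
  exact: (conclude _ z3 z4 z1 hH2 H21 H2_0 z31 z41 z11 z30 z40 ne34 H2z3 H2z4 H2z1 s31 d41 (sq_min _ _ m U32) U41).
have d32 : d <= cabs (mob z3 z2) by rewrite cabs_mobC.
have [m|/ltW m] := leP (cabs z1) (cabs z4).
  exact: (conclude h z1 z2 z3 hh h1' H1_0 z11 z21 z31 z10 z20 ne12 hz1 hz2 h_z3 s13 d23 (sq_min _ _ m U14) U23).
exact: (conclude _ z4 z3 z2 hH2 H21 H2_0 z41 z31 z21 z40 z30 ne43 H2z4 H2z3 H2z2 s42 d32 (sq_min _ _ m U41) U32).
Qed.

Lemma L_eps_lower (a gamma : C) : a != 0 -> cabs a < 1 -> cabs gamma < 1 ->
  cabs a ^+ 3 < cabs gamma ^+ 2 ->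
  exists e d : R, [/\ 0 < e, 0 < d & forall eps : C, 0 < cabs eps < d ->
    ((ln (cabs a ^+ 2 * (1 + e)))%:E <= L_eps a (- a) eps (0%R, gamma))%E].
Proof.
move=> a0 a1 g1 ag; have [e [d [e0 d0 H]]] := lempert_gap a0 a1 g1 ag.
exists e, d; split=> // eps epsd; apply: le_ereal_inf_tmp => _ [phi [zeta [[phi1 phid] phi0 pz ->]]].
have hf : hol [::] (fun v => (phi v).1).
  apply: hol_nil => z zz; have [h _] := phid z zz; exact: h.
have hh : hol [::] (fun v => (phi v).2).
  apply: hol_nil => z zz; have [_ h] := phid z zz; exact: h.
have f1 z : disc z -> cabs (phi z).1 < 1 by move=> zz; have [h _] := phi1 z zz.
have h1 z : disc z -> cabs (phi z).2 < 1 by move=> zz; have [_ h] := phi1 z zz.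
have f0 : (phi 0).1 = 0 by rewrite phi0.
have h0 : (phi 0).2 = gamma by rewrite phi0.
pose j0 : 'I_4 := ord0; pose j1 : 'I_4 := lift ord0 ord0.
pose j2 : 'I_4 := lift ord0 (lift ord0 ord0).
pose j3 : 'I_4 := lift ord0 (lift ord0 (lift ord0 ord0)).
have [z01 p0] := pz j0; have [z11 p1] := pz j1; have [z21 p2] := pz j2; have [z31 p3] := pz j3.
have B := H eps _ _ _ _ _ _ epsd hf f1 f0 hh h1 h0 z01 z11 z21 z31
  (congr1 fst p0) (congr1 fst p1) (congr1 fst p2) (congr1 fst p3)
  (congr1 snd p0) (congr1 snd p1) (congr1 snd p2) (congr1 snd p3).
have L0 : 0 < cabs a ^+ 2 * (1 + e) by rewrite mulr_gt0 ?exprn_gt0 ?cabs_gt0// addr_gt0.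
have P0 := lt_le_trans L0 B.
(* The lower bound is positive, so no modulus vanishes and no [elog] takes the value [-oo]. *)
have := lt0r_neq0 P0; rewrite !mulf_eq0 !negb_or => /andP[/andP[/andP[n0 n1] n2] n3].
have elogE (x : R) : x != 0 -> elog x = (ln x)%:E by rewrite /elog => /negbTE ->.
rewrite !big_ord_recl big_ord0 adde0 -/j0 -/j1 -/j2 -/j3 !elogE// -!EFinD lee_fin.
have pos z : cabs z != 0 -> 0 < cabs z by rewrite cabs_eq0 cabs_gt0.
have [[[q0 q1] q2] q3] := (pos _ n0, pos _ n1, pos _ n2, pos _ n3).
have q23 := mulr_gt0 q2 q3; have q123 := mulr_gt0 q1 q23.
rewrite -(lnM q2 q3) -(lnM q1 q23) -(lnM q0 q123).
rewrite ler_ln ?posrE; [|exact: L0|exact: (mulr_gt0 q0 q123)].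
by rewrite !mulrA; exact: B.
Qed.

End LempertGap.

(** * Second order jets *)

Section Jets.
Variable R : realType.
Local Notation C := (CC R).
Local Notation cabs := (@cabs R).
Local Notation disc := (@disc R).
Local Notation cconj := (@cconj R).
Local Notation Re := (@complex.Re R).
Implicit Types (z w x c v a b : C) (f g : C -> C).

Definition poly2 (c0 c1 c2 z : C) : C := c0 + c1 * z + c2 * z ^+ 2.

(** A cubic remainder is what the sub-mean value argument tolerates: on small circles it is
    dominated by a quadratic term [k |z|^2]. *)
Definition jet2 f (c0 c1 c2 : C) := exists K r : R, [/\ 0 <= K, 0 < r &
  forall z, cabs z < r -> cabs (f z - poly2 c0 c1 c2 z) <= K * cabs z ^+ 3].

Lemma poly2_le c0 c1 c2 z : cabs z <= 1 ->
  cabs (poly2 c0 c1 c2 z) <= cabs c0 + cabs c1 + cabs c2.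
Proof.
move=> z1; apply: le_trans (cabsD _ _) _; apply: lerD.
  apply: le_trans (cabsD _ _) _; rewrite lerD2l cabsM ler_piMr ?cabs_ge0//.
by rewrite cabsM cabsX ler_piMr ?cabs_ge0// exprn_ile1 ?cabs_ge0.
Qed.

Lemma cube_le1 (t : R) : 0 <= t -> t <= 1 -> t ^+ 3 <= 1.
Proof. by move=> t0 t1; rewrite exprn_ile1. Qed.

Lemma lin2_le c1 c2 z : cabs z <= 1 -> cabs (c1 * z + c2 * z ^+ 2) <= (cabs c1 + cabs c2) * cabs z.
Proof.
move=> z1; apply: le_trans (cabsD _ _) _; rewrite (cabsM c1) (cabsM c2) cabsX mulrDl lerD2l.
by rewrite ler_wpM2l ?cabs_ge0// expr2 ler_piMl ?cabs_ge0.
Qed.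

Lemma jet2_poly c0 c1 c2 : jet2 (poly2 c0 c1 c2) c0 c1 c2.
Proof. by exists 0, 1; split=> // z _; rewrite subrr cabs0 mul0r. Qed.

Lemma jet2_ext f g c0 c1 c2 d0 d1 d2 : (forall z, f z = g z) -> c0 = d0 -> c1 = d1 -> c2 = d2 ->
  jet2 f c0 c1 c2 -> jet2 g d0 d1 d2.
Proof.
move=> fg <- <- <- [K [r [K0 r0 H]]]; exists K, r; split=> // z zr.
by rewrite -fg; exact: H.
Qed.

Lemma jet2M f g a0 a1 a2 b0 b1 b2 : jet2 f a0 a1 a2 -> jet2 g b0 b1 b2 ->
  jet2 (fun z => f z * g z) (a0 * b0) (a0 * b1 + a1 * b0) (a0 * b2 + a1 * b1 + a2 * b0).
Proof.
move=> [K1 [r1 [K10 r10 H1]]] [K2 [r2 [K20 r20 H2]]].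
pose Ma := cabs a0 + cabs a1 + cabs a2; pose Mb := cabs b0 + cabs b1 + cabs b2.
have Ma0 : 0 <= Ma by rewrite !addr_ge0 ?cabs_ge0.
have Mb0 : 0 <= Mb by rewrite !addr_ge0 ?cabs_ge0.
pose N := cabs (a1 * b2 + a2 * b1) + cabs (a2 * b2).
exists (K1 * (Mb + K2) + Ma * K2 + N), (Num.min (Num.min r1 r2) 1); split.
- by rewrite !addr_ge0 ?mulr_ge0 ?addr_ge0 ?cabs_ge0.
- by rewrite !lt_min r10 r20 ltr01.
move=> z; rewrite !lt_min => /andP[/andP[/H1 h1 /H2 h2] /ltW z1].
have z30 : 0 <= cabs z ^+ 3 by rewrite exprn_ge0// cabs_ge0.
have z31 : cabs z ^+ 3 <= 1 by exact: cube_le1 (cabs_ge0 z) z1.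
have pa : cabs (poly2 a0 a1 a2 z) <= Ma by exact: poly2_le.
have pb : cabs (poly2 b0 b1 b2 z) <= Mb by exact: poly2_le.
have gz : cabs (g z) <= Mb + K2.
  rewrite -[g z](subrK (poly2 b0 b1 b2 z)) addrC; apply: le_trans (cabsD _ _) _.
  apply: lerD => //; apply: le_trans h2 _; by rewrite ler_piMr.
rewrite (_ : _ - _ = (f z - poly2 a0 a1 a2 z) * g z +
   poly2 a0 a1 a2 z * (g z - poly2 b0 b1 b2 z) +
   ((a1 * b2 + a2 * b1) + (a2 * b2) * z) * z ^+ 3); last by rewrite /poly2; ring.
have e1 : cabs ((f z - poly2 a0 a1 a2 z) * g z) <= K1 * (Mb + K2) * cabs z ^+ 3.
  by rewrite cabsM mulrAC; apply: ler_pM; rewrite ?cabs_ge0.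
have e2 : cabs (poly2 a0 a1 a2 z * (g z - poly2 b0 b1 b2 z)) <= Ma * K2 * cabs z ^+ 3.
  by rewrite cabsM -mulrA; apply: ler_pM; rewrite ?cabs_ge0.
have e3 : cabs (((a1 * b2 + a2 * b1) + (a2 * b2) * z) * z ^+ 3) <= N * cabs z ^+ 3.
  rewrite cabsM cabsX ler_wpM2r//; apply: le_trans (cabsD _ _) _.
  by rewrite lerD2l cabsM ler_piMr ?cabs_ge0.
have -> : (K1 * (Mb + K2) + Ma * K2 + N) * cabs z ^+ 3 = K1 * (Mb + K2) * cabs z ^+ 3 +
   Ma * K2 * cabs z ^+ 3 + N * cabs z ^+ 3 by ring.
apply: le_trans (cabsD _ _) _; apply: lerD => //.
by apply: le_trans (cabsD _ _) _; exact: lerD.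
Qed.

Lemma jet2_lower f c0 c1 c2 : jet2 f c0 c1 c2 -> c0 != 0 ->
  exists2 r : R, 0 < r & forall z, cabs z < r -> cabs c0 / 2 <= cabs (f z).
Proof.
move=> [K [r [K0 r0 H]]] c00.
have n0 : 0 < cabs c0 by rewrite cabs_gt0.
pose M := cabs c1 + cabs c2 + K + 1.
have M0 : 0 < M by rewrite ltr_wpDl ?addr_ge0 ?cabs_ge0.
exists (Num.min r (Num.min 1 (cabs c0 / (2 * M)))).
  by rewrite !lt_min r0 ltr01 divr_gt0// mulr_gt0.
move=> z; rewrite !lt_min => /and3P[/H hz /ltW z1 zM]; have z0 := cabs_ge0 z.
have : cabs (c0 - f z) <= cabs z * M.
  rewrite (_ : c0 - f z = - ((f z - poly2 c0 c1 c2 z) + (c1 * z + c2 * z ^+ 2))); last by rewrite /poly2; ring.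
  rewrite cabsN; apply: le_trans (cabsD _ _) _.
  have zzz : cabs z ^+ 3 <= cabs z by rewrite exprS ler_piMr// exprn_ile1.
  have h1 := lin2_le c1 c2 z1.
  have h2 : K * cabs z ^+ 3 <= K * cabs z by rewrite ler_wpM2l.
  rewrite /M; lra.
have := cabs_subl c0 (f z).
have : cabs z * M <= cabs c0 / 2.
  move: zM; rewrite ltr_pdivlMr ?mulr_gt0//; lra.
lra.
Qed.

(** The candidate polynomial times [f] has jet [1, 0, 0]; division by [f], bounded below near [0],
    keeps the remainder cubic. *)
Lemma jet2V f c0 c1 c2 : jet2 f c0 c1 c2 -> c0 != 0 ->
  exists d2, jet2 (fun z => (f z)^-1) c0^-1 (- c1 / c0 ^+ 2) d2.
Proof.
move=> jf c00.
pose d1 := - c1 / c0 ^+ 2; pose d2 := c1 ^+ 2 / c0 ^+ 3 - c2 / c0 ^+ 2.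
exists d2.
have [K [r [K0 r0 H]]] : jet2 (fun z => f z * poly2 c0^-1 d1 d2 z) 1 0 0.
  apply: jet2_ext (jet2M jf (jet2_poly c0^-1 d1 d2)) => //.
  - by rewrite divff.
  - by rewrite /d1; field.
  - by rewrite /d1 /d2; field.
have [r' r'0 H'] := jet2_lower jf c00.
have n0 : 0 < cabs c0 by rewrite cabs_gt0.
exists (2 * K / cabs c0), (Num.min r r'); split.
- by rewrite divr_ge0 ?mulr_ge0// ltW.
- by rewrite lt_min r0 r'0.
move=> z; rewrite lt_min => /andP[/H hz /H' fz].
have fz0 : 0 < cabs (f z) by apply: lt_le_trans fz; rewrite divr_gt0.
have fne : f z != 0 by rewrite -cabs_gt0.
rewrite (_ : _ - _ = - (f z * poly2 c0^-1 d1 d2 z - poly2 1 0 0 z) / f z); last first.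
  by rewrite /(poly2 1) mul0r mul0r !addr0; field.
rewrite cabsM cabsN cabsV ler_pdivrMr//; apply: le_trans hz _.
have := ler_wpM2l (mulr_ge0 (divr_ge0 (mulr_ge0 (ler0n R 2) K0) (ltW n0)) (exprn_ge0 3 (cabs_ge0 z))) fz.
rewrite (_ : 2 * K / cabs c0 * cabs z ^+ 3 * (cabs c0 / 2) = K * cabs z ^+ 3) //.
by field; rewrite gt_eqF.
Qed.

Definition hasjet f x := exists c1 c2, jet2 (fun z => f (x + z)) (f x) c1 c2.

Lemma hasjetM f g x : hasjet f x -> hasjet g x -> hasjet (fun z => f z * g z) x.
Proof. by move=> [a1 [a2 jf]] [b1 [b2 jg]]; do 2 eexists; exact: (jet2M jf jg). Qed.

Lemma hasjetX f x n : hasjet f x -> hasjet (fun z => f z ^+ n) x.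
Proof.
move=> jf; elim: n => [|n IH].
  exists 0, 0; apply: jet2_ext (jet2_poly 1 0 0) => // z.
  by rewrite /poly2 !mul0r !addr0 expr0.
have [d1 [d2 H]] := hasjetM jf IH.
by exists d1, d2; apply: jet2_ext H => // [z|]; rewrite exprS.
Qed.

Lemma hasjet_mob c x : cabs c < 1 -> cabs x <= 1 -> hasjet (mob c) x.
Proof.
move=> c1 x1; have d0 := mob_den_neq0 c1 x1.
have j1 := jet2_poly (x - c) 1 0.
have [d2 j2] := jet2V (jet2_poly (1 - cconj c * x) (- cconj c) 0) d0.
do 2 eexists; apply: jet2_ext (jet2M j1 j2) => // z.
by rewrite /poly2 /mob; congr (_ / _); ring.
Qed.

Lemma jet2_scale f c0 c1 c2 v : jet2 f c0 c1 c2 ->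
  jet2 (fun z => f (z * v)) c0 (c1 * v) (c2 * v ^+ 2).
Proof.
move=> [K [r [K0 r0 H]]]; pose s := cabs v + 1.
have s0 : 0 < s by rewrite ltr_wpDl ?cabs_ge0.
exists (K * cabs v ^+ 3), (r / s); split.
- by rewrite mulr_ge0 ?exprn_ge0 ?cabs_ge0.
- by rewrite divr_gt0.
move=> z; rewrite ltr_pdivlMr// => zr.
have zv : cabs (z * v) < r.
  rewrite cabsM; apply: le_lt_trans zr; rewrite ler_wpM2l ?cabs_ge0// /s lerDl//.
rewrite (_ : poly2 _ _ _ z = poly2 c0 c1 c2 (z * v)); last by rewrite /poly2; ring.
apply: le_trans (H _ zv) _; rewrite cabsM exprMn; rewrite le_eqVlt; apply/orP; left; apply/eqP; ring.
Qed.

Lemma hasjet_cont f x : hasjet f x -> {for x, continuous f}.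
Proof.
move=> [c1 [c2 [K [r [K0 r0 H]]]]]; apply/ccontP => e e0.
pose M := cabs c1 + cabs c2 + K + 1.
have M0 : 0 < M by rewrite ltr_wpDl ?addr_ge0 ?cabs_ge0.
exists (Num.min r (Num.min 1 (e / M))); first by rewrite !lt_min r0 ltr01 divr_gt0.
move=> w; rewrite !lt_min => /and3P[wr /ltW w1]; rewrite ltr_pdivlMr// => we.
have := H _ wr; rewrite (addrC x (w - x)) subrK => h; move: w1 we h.
set z := w - x => z1 we h; have z0 := cabs_ge0 z.
rewrite (_ : f w - f x = (f w - poly2 (f x) c1 c2 z) + (c1 * z + c2 * z ^+ 2)); last by rewrite /poly2; ring.
apply: le_lt_trans we; apply: le_trans (cabsD _ _) _.
have zzz : cabs z ^+ 3 <= cabs z by rewrite exprS ler_piMr// exprn_ile1.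
have h1 := lin2_le c1 c2 z1.
have h2 : K * cabs z ^+ 3 <= K * cabs z by rewrite ler_wpM2l.
rewrite /M; lra.
Qed.

Lemma sqr_cabsD a b : cabs (a + b) ^+ 2 = cabs a ^+ 2 + 2 * Re (cconj a * b) + cabs b ^+ 2.
Proof. by rewrite !cabs_sqr; case: a => a1 a2; case: b => b1 b2 /=; ring. Qed.

(** Without a linear term, [|f|^2] has no [|z|^2] contribution: it is harmonic up to a cubic
    error. *)
Lemma jet2_sqr f c0 c2 : jet2 f c0 0 c2 -> exists K r : R, [/\ 0 <= K, 0 < r &
  forall z, cabs z < r ->
    cabs (f z) ^+ 2 <= cabs c0 ^+ 2 + 2 * Re (cconj c0 * c2 * z ^+ 2) + K * cabs z ^+ 3].
Proof.
move=> [K [r [K0 r0 H]]]; pose M := cabs c2 + K.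
have M0 : 0 <= M by rewrite addr_ge0 ?cabs_ge0.
exists (2 * cabs c0 * K + M ^+ 2), (Num.min r 1); split.
- by rewrite addr_ge0 ?mulr_ge0 ?cabs_ge0 ?sqr_ge0.
- by rewrite lt_min r0 ltr01.
move=> z; rewrite lt_min => /andP[/H h /ltW z1]; have z0 := cabs_ge0 z.
set e := f z - poly2 c0 0 c2 z in h.
rewrite (_ : f z = c0 + (c2 * z ^+ 2 + e)); last by rewrite /e /poly2; ring.
rewrite sqr_cabsD mulrDr raddfD /= mulrA.
have h1 : Re (cconj c0 * e) <= cabs c0 * (K * cabs z ^+ 3).
  by apply: le_trans (Re_le_cabs _) _; rewrite cabsM cabsC ler_wpM2l ?cabs_ge0.
have h2 : cabs (c2 * z ^+ 2 + e) <= M * cabs z ^+ 2.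
  apply: le_trans (cabsD _ _) _; rewrite cabsM cabsX mulrDl lerD2l.
  by apply: le_trans h _; rewrite ler_wpM2l// [leLHS]exprSr ler_piMr ?exprn_ge0.
have h3 : cabs (c2 * z ^+ 2 + e) ^+ 2 <= M ^+ 2 * cabs z ^+ 3.
  apply: (@le_trans _ _ ((M * cabs z ^+ 2) ^+ 2)).
    by rewrite lerXn2r ?nnegrE ?mulr_ge0 ?exprn_ge0 ?cabs_ge0.
  rewrite exprMn ler_wpM2l ?sqr_ge0// -exprM /= [leLHS]exprSr ler_piMr ?exprn_ge0//.
lra.
Qed.

(** The difference of the two sides has derivative [(t - 1)^3 / t], hence its minimum [0] at
    [t = 1]. *)
Lemma ln_le_cubic (t : R) : 0 < t -> ln t <= (t - 1) - (t - 1) ^+ 2 / 2 + (t - 1) ^+ 3 / 3.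
Proof.
move=> t0.
pose f (t : R) := (t - 1) - (t - 1) ^+ 2 / 2 + (t - 1) ^+ 3 / 3 - ln t.
pose df (t : R) := (t - 1) ^+ 3 / t.
have Df (s : R) : 0 < s -> is_derive s 1 f (df s).
  move=> s0; have l := is_derive1_ln s0.
  apply: is_derive_eq; rewrite /df /GRing.scale /=.
  by field; rewrite gt_eqF.
have cf (s : R) : 0 < s -> {for s, continuous f}.
  by move=> /Df [d _]; apply/differentiable_continuous/derivable1_diffP.
suff : 0 <= f t by rewrite /f; lra.
have f1 : f 1 = 0 by rewrite /f subrr !expr0n /= !mul0r ln1 !subr0 addr0.
have cw (a b : R) : 0 < a -> {within `[a, b], continuous f}.
  move=> a0; apply: continuous_in_subspaceT => x /set_mem /=; rewrite in_itv/= => /andP[ax _].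
  by apply: cf; exact: lt_le_trans ax.
have dw (a b x : R) : 0 < a -> x \in `]a, b[ -> is_derive x 1 f (df x).
  by move=> a0; rewrite in_itv/= => /andP[ax _]; apply: Df; exact: lt_trans ax.
have [t1|t1|->] := ltgtP t 1; last by rewrite f1.
  have [c] := MVT t1 (fun x : R => @dw t 1 x t0) (cw _ _ t0).
  rewrite in_itv/= => /andP[tc c1] E.
  have c0 : 0 < c by exact: lt_trans tc.
  have : df c * (1 - t) <= 0.
    rewrite mulr_le0_ge0// ?subr_ge0 ?(ltW t1)// /df mulr_le0_ge0 ?invr_ge0 ?(ltW c0)//.
    by rewrite exprS mulr_le0_ge0 ?sqr_ge0// subr_le0 ltW.
  by rewrite -E f1; lra.
have [c] := MVT t1 (fun x : R => @dw 1 t x ltr01) (cw _ _ ltr01).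
rewrite in_itv/= => /andP[c1 ct] E.
have c0 : 0 < c by exact: lt_trans c1.
have : 0 <= df c * (t - 1).
  rewrite mulr_ge0// ?subr_ge0 ?(ltW t1)// /df divr_ge0 ?(ltW c0)//.
  by rewrite exprn_ge0// subr_ge0 ltW.
by rewrite -E f1; lra.
Qed.

(** The expansion of twice the real part of [log (1 + l z)], obtained from the real logarithm
    alone. *)
Lemma ln_norm_jet l : exists K r : R, [/\ 0 <= K, 0 < r & forall z, cabs z < r ->
  1 + l * z != 0 /\
  ln (cabs (1 + l * z) ^+ 2) <= Re (2 * l * z - l ^+ 2 * z ^+ 2) + K * cabs z ^+ 3].
Proof.
pose L := cabs l; have L0 : 0 <= L := cabs_ge0 l.
exists (10 * L ^+ 3), (1 / (2 * (L + 1))); split.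
- by rewrite mulr_ge0// exprn_ge0.
- by rewrite divr_gt0// mulr_gt0// ltr_wpDl.
move=> z; rewrite ltr_pdivlMr ?mulr_gt0// ?ltr_wpDl// => zr.
have z0 := cabs_ge0 z.
have w2 : cabs (l * z) <= 1 / 2 by rewrite cabsM -/L; have := mulr_ge0 L0 z0; lra.
have -> : 10 * L ^+ 3 * cabs z ^+ 3 = 10 * cabs (l * z) ^+ 3.
  by rewrite cabsM -/L; ring.
have -> : 2 * l * z - l ^+ 2 * z ^+ 2 = 2 * (l * z) - (l * z) ^+ 2 by ring.
move: (l * z) w2 => w w2; have w0 := cabs_ge0 w.
have n0 : 1 + w != 0.
  rewrite -cabs_gt0; have := cabs_subl 1 (- w); rewrite cabsN cabs1 opprK; lra.
split=> //.
apply: le_trans (ln_le_cubic _) _; first by rewrite exprn_gt0// cabs_gt0.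
pose p := Re w; pose q := cabs w.
have E1 : cabs (1 + w) ^+ 2 - 1 = 2 * p + q ^+ 2.
  by rewrite /p /q !cabs_sqr; case: (w) => x y /=; ring.
have E2 : Re (2 * w - w ^+ 2) = 2 * p - 2 * p ^+ 2 + q ^+ 2.
  by rewrite /p /q !cabs_sqr expr2; case: (w) => x y /=; ring.
have pq : `|p| <= q by exact: normr_Re.
rewrite E1 E2 -/q; move: pq; rewrite ler_norml -/q in w2 w0 * => /andP[pl pu].
have q0 : 0 <= q := w0; have q2 : q <= 1 / 2 := w2.
have y2 : 2 * p + q ^+ 2 <= 5 / 2 * q by rewrite expr2; nra.
have y2' : - (5 / 2 * q) <= 2 * p + q ^+ 2 by have := sqr_ge0 q; lra.
have cub : (2 * p + q ^+ 2) ^+ 3 <= (5 / 2 * q) ^+ 3.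
  have [y0|y0] := leP 0 (2 * p + q ^+ 2); first by rewrite lerXn2r ?nnegrE// mulr_ge0.
  apply: (@le_trans _ _ 0); last by rewrite exprn_ge0// mulr_ge0.
  by rewrite exprS mulr_le0_ge0 ?sqr_ge0// ltW.
have h1 : - (p * q ^+ 2) <= q ^+ 3.
  by rewrite -mulNr [leRHS]exprS ler_wpM2r ?sqr_ge0//; lra.
have q30 : 0 <= q ^+ 3 by rewrite exprn_ge0.
have := sqr_ge0 (q ^+ 2).
rewrite exprMn in cub.
have -> : (2 * p + q ^+ 2) ^+ 2 = 4 * p ^+ 2 + 4 * (p * q ^+ 2) + (q ^+ 2) ^+ 2 by ring.
have c3 : (5 / 2 : R) ^+ 3 <= 16 by rewrite !exprS expr0; lra.
have := ler_wpM2r q30 c3.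
lra.
Qed.

End Jets.

(** * Comparison principle for plurisubharmonic functions *)

Section SubMean.
Variable R : realType.
Local Notation C := (CC R).
Local Notation C2 := (C * C)%type.
Local Notation cabs := (@cabs R).
Local Notation disc := (@disc R).
Local Notation bidisc := (@bidisc R).
Local Notation Re := (@complex.Re R).
Implicit Types (x y v : C2) (u : C2 -> \bar R).

(* Neither integrand is assumed measurable: the integral is a difference of suprema over
   simple functions. *)
Lemma le_integral_any (mu : {measure set (measurableTypeR R) -> \bar R}) (D : set R)
    (f g : R -> \bar R) :
  (forall t, D t -> (f t <= g t)%E) ->
  (\int[mu]_(t in D) f t <= \int[mu]_(t in D) g t)%E.
Proof.
move=> fg.
have fgD t : ((f \_ D) t <= (g \_ D) t)%E.
  by rewrite /patch; case: ifPn => // /set_mem; exact: fg.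
rewrite /integral; apply: leeB; apply: ereal_sup_le => _ [h hle <-];
  exists h => // t; apply: le_trans (hle t) _.
  by rewrite !funeposE ge_max !le_max fgD lexx orbT.
by rewrite !funenegE ge_max !le_max leeN2 fgD lexx orbT.
Qed.

Lemma affine2_scale x v (rho z : C) :
  affine2 x (rho * v.1, rho * v.2) z = affine2 x v (rho * z).
Proof. by rewrite /affine2 /=; congr (_, _); ring. Qed.

(** The harmonic part has mean zero on circles, so the mean of [u] on a small circle of radius [rho]
    is at most [m - k rho^2 + K rho^3 < m], against the sub-mean value property. *)
Lemma psh_no_strict_max u x v (c1 c2 : C) (m k K r : R) : psh_on bidisc u ->
  u x = m%:E -> 0 < k -> 0 < r ->
  (forall z : C, cabs z < r -> bidisc (affine2 x v z) /\
    (u (affine2 x v z) <= (m + Re (c1 * z + c2 * z ^+ 2) - k * cabs z ^+ 2 + K * cabs z ^+ 3)%:E)%E) ->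
  False.
Proof.
move=> [_ _ sub] ux k0 r0 H.
pose rho := Num.min (r / 2) (Num.min (1 / 2) (k / (2 * (`|K| + 1)))).
have K1 : 0 < 2 * (`|K| + 1) by rewrite mulr_gt0// ltr_wpDl.
have rho0 : 0 < rho by rewrite !lt_min !divr_gt0.
have rho_r : rho < r by have : rho <= r / 2; [rewrite ge_min lexx|lra].
have rho_1 : rho < 1 by have : rho <= 1 / 2; [rewrite !ge_min lexx orbT|lra].
have rho_K : rho * (2 * (`|K| + 1)) <= k by rewrite -ler_pdivlMr// !ge_min lexx !orbT.
have crho : cabs (cmk rho 0) = rho by rewrite cabs_real gtr0_norm.
have cz z : cabs z <= 1 -> cabs (cmk rho 0 * z) < r.
  by move=> z1; rewrite cabsM crho; apply: le_lt_trans rho_r; rewrite ler_piMr// ltW.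
pose b : C2 := (cmk rho 0 * v.1, cmk rho 0 * v.2).
have inD z : cabs z <= 1 -> bidisc (affine2 x b z).
  by move=> z1; rewrite affine2_scale; have [] := H _ (cz _ z1).
have := sub _ _ inD; rewrite ux.
(* The factor [i] turns the real part into an imaginary part, the form in which [circle_mean] is
   stated. *)
pose f (z : C) : C := cmk 0 1 * (c1 * z + c2 * z ^+ 2).
have hf : hol [::] (fun z => cmk 0 1 * (c1 * z - - c2 * z ^+ 2)).
  apply: (holM (hol_cst _ (cmk 0 1))).
  exact: (holB (holM (hol_cst _ c1) (@hol_id _ _)) (holM (hol_cst _ (- c2)) (holX 2 (@hol_id _ _)))).
have df z : disc z -> derivable f z 1.
  move=> z1; have [_ /(_ isT)] := hf z z1.
  by rewrite (_ : (fun z => _) = f)//; apply/funext => w; rewrite /f; ring.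
have lr : ln rho < 0 by rewrite ln_lt0// rho0.
pose Q t := complex.Im (f (cpolar (ln rho) t)).
have cQ : contI 0 (2 * pi) Q by move=> t _; exact: (Q_continuous df lr).
pose c := k * rho ^+ 2 - K * rho ^+ 3 - m.
have cG : contI 0 (2 * pi) (fun t => Q t - c) by apply: contIB => //; exact: contI_cst.
have pi2 : 0 < 2 * pi :> R by rewrite mulr_gt0// pi_gt0.
have IQ := circle_mean df lr.
have f0 : f 0 = 0 by rewrite /f !mulr0 expr0n mulr0 addr0 mulr0.
have IG : Int 0 (2 * pi) (fun t => Q t - c) = - (c * (2 * pi)).
  have := Int_cst c (ltW pi2); rewrite subr0 => Ic.
  by rewrite (IntB cQ (@contI_cst _ _ _ c)) Ic IQ f0 mul0r sub0r.
have bound : (int_0_2pi (fun t => u (affine2 x b (expi t)))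
    <= (- (c * (2 * pi)))%:E)%E.
  rewrite -IG /Int /Rintegral fineK; last first.
    by apply: integrable_fin_num => //; exact: continuous_Int.
  apply: le_integral_any => t _.
  rewrite affine2_scale (_ : cmk rho 0 * expi t = cpolar (ln rho) t); last by rewrite /cpolar lnK.
  have cr : cabs (cpolar (ln rho) t) = rho by rewrite cabs_cpolar lnK.
  have zr : cabs (cpolar (ln rho) t) < r by rewrite cr.
  have [_ h] := H _ zr; rewrite cr in h.
  apply: le_trans h _; rewrite lee_fin /Q /f /c.
  rewrite (_ : complex.Im (cmk 0 1 * _) = Re (c1 * cpolar (ln rho) t + c2 * cpolar (ln rho) t ^+ 2)).
    by rewrite le_eqVlt; apply/orP; left; apply/eqP; ring.
  by case: (c1 * _ + _) => p q /=; ring.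
move=> h; have ipi : (0 <= ((2 * pi)^-1)%:E :> \bar R)%E by rewrite lee_fin invr_ge0 ltW.
have := le_trans h (lee_wpmul2l ipi bound).
rewrite -EFinM lee_fin mulrN mulrC mulfK ?gt_eqF// /c.
have rho2 : 0 < rho ^+ 2 by rewrite exprn_gt0.
have Kle : K * rho ^+ 3 <= `|K| * rho ^+ 3 by rewrite ler_wpM2r ?exprn_ge0 ?ler_norm// ltW.
have : `|K| * rho ^+ 3 < k * rho ^+ 2.
  rewrite exprS mulrA ltr_pM2r//; apply: lt_le_trans rho_K; rewrite mulrC ltr_pM2l//.
  have := normr_ge0 K; lra.
lra.
Qed.

Lemma closed_disc_compact (r : R) : compact [set z : C | cabs z <= r].
Proof.
pose f (p : R * R) : C := cmk p.1 p.2.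
have cf : continuous f.
  move=> p B /cnbhsP[d d0 H]; apply/nbhs_ballP; exists (d / 2) => /=; first by rewrite divr_gt0.
  move=> q [/= q1 q2]; apply: H.
  rewrite (_ : f q - f p = cmk (q.1 - p.1) (q.2 - p.2)); last first.
    by apply/eqP; rewrite eq_complex /= !eqxx.
  apply: le_lt_trans (cabs_cmk _ _) _.
  by move: q1 q2; rewrite /ball /= distrC [`|p.2 - _|]distrC; lra.
have cS : compact (f @` (`[(- r), r] `*` `[(- r), r])).
  apply: continuous_compact; first exact: continuous_subspaceT.
  by apply: compact_setX; exact: segment_compact.
apply: subclosed_compact cS _; last first.
  move=> z /= zr; exists (complex.Re z, complex.Im z); last by rewrite /f -cmkE.
  have := normr_Re z; have := normr_Im z; rewrite !ler_norml /= !in_itv /= => /andP[? ?] /andP[? ?].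
  by split; apply/andP; split; lra.
move=> z clz /=; rewrite leNgt; apply/negP => zr.
have [|w [/= wr wz]] := clz [set w | cabs (w - z) < cabs z - r].
  by apply/cnbhsP; exists (cabs z - r) => //; rewrite subr_gt0.
by have := cabs_subl z w; rewrite cabsBC; lra.
Qed.

End SubMean.

(** Were the supremum not attained, the sets [w < c n], with [c n] increasing to it, would cover
    [K]; by compactness one of them would contain [K], lowering the supremum. *)
Lemma usc_max (R : realType) (T : topologicalType) (K : set T) (w : T -> \bar R) (x0 : T) : compact K -> K x0 ->
  (forall x, K x -> (w x < +oo)%E) ->
  (forall x, K x -> forall c : R, (w x < c%:E)%E -> \forall y \near x, (w y < c%:E)%E) ->
  exists2 x, K x & forall y, K y -> (w y <= w x)%E.
Proof.
move=> /compact_near_coveringP cK Kx0 wfin wusc.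
apply: contrapT => /forall2NP N.
pose M := ereal_sup (w @` K).
have wM x : K x -> (w x < M)%E.
  move=> Kx; rewrite ltNge; apply/negP => Mw.
  have [//|] := N x; apply => y Ky; apply: le_trans Mw.
  by apply: ereal_sup_ubound; exists y.
have [c [cM ci cw]] : exists c : nat -> R, [/\ forall n, ((c n)%:E < M)%E,
    forall n k, (n <= k)%N -> c n <= c k & forall x, K x -> exists n, (w x < (c n)%:E)%E].
  have Mw := wM x0 Kx0; case: M wM Mw => [M| |]; last by move=> _; rewrite ltNge leNye.
    move=> wM _; exists (fun n => M - n.+1%:R^-1); split.
    - by move=> n; rewrite lte_fin gtrBl invr_gt0.
    - by move=> n k nk; rewrite lerB// lef_pV2 ?posrE// ler_nat ltnS.
    - move=> x Kx; have := wM x Kx; case: (w x) => [s| |]; last 2 first.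
      + by rewrite ltNge leey.
      + by exists 0%N; rewrite ltNyr.
      rewrite lte_fin -subr_gt0 => sM.
      exists (Num.truncn (M - s)^-1); rewrite lte_fin ltrBrDr addrC -ltrBrDr.
      by rewrite invf_plt ?posrE// truncnS_gt.
  move=> _ _; exists (fun n => n%:R); split.
  - by move=> n; rewrite ltry.
  - by move=> n k nk; rewrite ler_nat.
  - move=> x Kx; have := wfin x Kx; case: (w x) => [s| |] //; last by exists 0%N; rewrite ltNyr.
    by move=> _; exists (Num.truncn s).+1; rewrite lte_fin truncnS_gt.
have := cK nat \oo (fun n y => (w y < (c n)%:E)%E) _.
case.
  move=> x Kx; have [n wn] := cw x Kx.
  exists ([set y | (w y < (c n)%:E)%E], [set k | (n <= k)%N]).
    by split; [exact: wusc|exists n].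
  move=> [y k] [/= wy nk]; apply: lt_le_trans wy _; rewrite lee_fin; exact: ci.
move=> n _ /(_ n (leqnn n)) Hn.
have : (M <= (c n)%:E)%E by apply: ge_ereal_sup => _ [y Ky <-]; apply: ltW; exact: Hn.
by rewrite leNgt cM.
Qed.

Section Comparison.
Variable R : realType.
Local Notation C := (CC R).
Local Notation C2 := (C * C)%type.
Local Notation cabs := (@cabs R).
Local Notation disc := (@disc R).
Local Notation bidisc := (@bidisc R).
Local Notation cconj := (@cconj R).
Local Notation Re := (@complex.Re R).

Lemma ln_le_sub1 (t : R) : 0 < t -> ln t <= t - 1.
Proof.
move=> t0; have := expR_ge1Dx (ln t); rewrite lnK ?posrE//; lra.
Qed.

Section Pair.
Variables A B : C -> C.

Definition sqsum (x : C2) : R := cabs (A x.1) ^+ 2 + cabs (B x.2) ^+ 2.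

Lemma sqsum_ge0 x : 0 <= sqsum x.
Proof. by rewrite addr_ge0 ?sqr_ge0. Qed.

(* Along [v] the curve [(A, B)] is to first order proportional to [(A, B) x], so
   the Levi form of [ln sqsum] vanishes in this direction. *)
Lemma ln_sqsum_line (x : C2) : hasjet A x.1 -> hasjet B x.2 -> 0 < sqsum x ->
  exists (v : C2) (c1 c2 : C) (K r : R), [/\ 0 < cabs v.1 ^+ 2 + cabs v.2 ^+ 2, 0 < r &
    forall z : C, cabs z < r -> 0 < sqsum (affine2 x v z) /\
      ln (sqsum (affine2 x v z)) <= ln (sqsum x) + Re (c1 * z + c2 * z ^+ 2) + K * cabs z ^+ 3].
Proof.
move=> [a1 [a2 jA]] [b1 [b2 jB]] S0.
set A0 := A x.1 in jA; set B0 := B x.2 in jB.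
have pos (p q : C) : p != 0 \/ q != 0 -> 0 < cabs p ^+ 2 + cabs q ^+ 2.
  by case=> h; [rewrite ltr_pwDl ?sqr_ge0|rewrite ltr_wpDl ?sqr_ge0]; rewrite // exprn_gt0// cabs_gt0.
(* The pair [(A0 * b1, B0 * a1)] solves the equation; when it is zero both sides vanish identically
   and any direction will do. *)
have [v [v0 par]] : exists v : C2, 0 < cabs v.1 ^+ 2 + cabs v.2 ^+ 2 /\
    A0 * (b1 * v.2) = B0 * (a1 * v.1).
  have [e1|n1] := eqVneq (A0 * b1) 0; have [e2|n2] := eqVneq (B0 * a1) 0.
  - exists (1, 1); split; first exact: (pos 1 1 (or_introl (oner_neq0 _))).
    by rewrite !mulr1 e1 e2.
  - exists (A0 * b1, B0 * a1); split; [exact: (pos _ _ (or_intror n2))|rewrite /=; ring].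
  - exists (A0 * b1, B0 * a1); split; [exact: (pos _ _ (or_introl n1))|rewrite /=; ring].
  - exists (A0 * b1, B0 * a1); split; [exact: (pos _ _ (or_introl n1))|rewrite /=; ring].
have AB0 : A0 != 0 \/ B0 != 0.
  have [A00|] := eqVneq A0 0; last by left.
  right; apply/negP => /eqP B00; move: S0.
  by rewrite /sqsum -/A0 -/B0 A00 B00 cabs0 expr0n addr0 ltxx.
(* [l] is the common logarithmic derivative of both components along [v]; dividing them by [1 + l z]
   removes their linear terms. *)
have [l [lA lB]] : exists l, a1 * v.1 = l * A0 /\ b1 * v.2 = l * B0.
  have [A00|A00] := eqVneq A0 0.
    have B00 : B0 != 0 by case: AB0 => //; rewrite A00 eqxx.
    exists (b1 * v.2 / B0); rewrite divfK//; split=> //.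
    move: par; rewrite A00 mul0r mulr0 => /esym/eqP; rewrite mulf_eq0 (negbTE B00) /=.
    by move=> /eqP.
  exists (a1 * v.1 / A0); rewrite divfK//; split=> //.
  by apply: (mulfI A00); rewrite par mulrC; field.
have jA' := jet2_scale v.1 jA; have jB' := jet2_scale v.2 jB.
have [d2 jI] := jet2V (jet2_poly 1 l 0) (oner_neq0 _).
have [K1 [r1 [K10 r10 H1]]] := ln_norm_jet l.
have jtA : jet2 (fun z => A (x.1 + z * v.1) * (poly2 1 l 0 z)^-1) A0 0
    (A0 * d2 + a1 * v.1 * (- l) + a2 * v.1 ^+ 2).
  apply: jet2_ext (jet2M jA' jI) => //.
  - by rewrite invr1 mulr1.
  - by rewrite lA; field.
  - by field.
have jtB : jet2 (fun z => B (x.2 + z * v.2) * (poly2 1 l 0 z)^-1) B0 0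
    (B0 * d2 + b1 * v.2 * (- l) + b2 * v.2 ^+ 2).
  apply: jet2_ext (jet2M jB' jI) => //.
  - by rewrite invr1 mulr1.
  - by rewrite lB; field.
  - by field.
have [K2 [r2 [K20 r20 H2]]] := jet2_sqr jtA.
have [K3 [r3 [K30 r30 H3]]] := jet2_sqr jtB.
have [r4 r40 H4] : exists2 r : R, 0 < r & forall z, cabs z < r -> 0 < sqsum (affine2 x v z).
  case: AB0 => n0.
    have [r r0 H] := jet2_lower jA' n0; exists r => // z /H h; apply: pos; left.
    by rewrite -cabs_gt0; apply: lt_le_trans h; rewrite divr_gt0// cabs_gt0.
  have [r r0 H] := jet2_lower jB' n0; exists r => // z /H h; apply: pos; right.
  by rewrite -cabs_gt0; apply: lt_le_trans h; rewrite divr_gt0// cabs_gt0.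
move: (A0 * d2 + _ + _) (B0 * d2 + _ + _) H2 H3 {jtA jtB} => al be H2 H3.
pose S := sqsum x.
pose sg : C := cmk S^-1 0 * (2 * (cconj A0 * al + cconj B0 * be)).
exists v, (2 * l), (sg - l ^+ 2), (K1 + (K2 + K3) / S), (Num.min (Num.min r1 r2) (Num.min r3 r4)).
split=> //; first by rewrite !lt_min r10 r20 r30 r40.
move=> z; rewrite !lt_min => /andP[/andP[/H1[n1 h1] /H2 h2] /andP[/H3 h3 /H4 h4]].
split=> //.
have p1 : poly2 1 l 0 z = 1 + l * z by rewrite /poly2 mul0r addr0.
rewrite p1 in h2 h3.
pose T := cabs (A (x.1 + z * v.1) / (1 + l * z)) ^+ 2 + cabs (B (x.2 + z * v.2) / (1 + l * z)) ^+ 2.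
have n10 : 0 < cabs (1 + l * z) ^+ 2 by rewrite exprn_gt0// cabs_gt0.
have ST : sqsum (affine2 x v z) = cabs (1 + l * z) ^+ 2 * T.
  rewrite /sqsum /affine2 /T /= !cabsM !cabsV !expr_div_n.
  by field; rewrite cabs_eq0.
have T0 : 0 < T by move: h4; rewrite ST pmulr_rgt0.
have S0' : 0 < S := S0.
rewrite ST lnM ?posrE//.
have lT : ln T <= ln S + (T / S - 1).
  rewrite -[T in ln T](divfK (lt0r_neq0 S0')) lnM ?posrE ?divr_gt0// addrC lerD2l.
  by apply: ln_le_sub1; rewrite divr_gt0.
have TS : T / S - 1 <= Re (sg * z ^+ 2) + (K2 + K3) / S * cabs z ^+ 3.
  have Esg : Re (sg * z ^+ 2) = (2 * Re (cconj A0 * al * z ^+ 2) + 2 * Re (cconj B0 * be * z ^+ 2)) / S.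
    rewrite (_ : sg * z ^+ 2 = cmk S^-1 0 * (2 * (cconj A0 * al * z ^+ 2 + cconj B0 * be * z ^+ 2))).
      by case: (_ * z ^+ 2) (cconj B0 * be * z ^+ 2) => [p q] [p' q'] /=; ring.
    by rewrite /sg; ring.
  rewrite Esg.
  have -> : T / S - 1 = (T - S) / S by rewrite mulrBl divff// gt_eqF.
  rewrite [(K2 + K3) / S * _]mulrAC -mulrDl ler_pM2r ?invr_gt0//.
  rewrite /T /S /sqsum -/A0 -/B0; lra.
have -> : Re (2 * l * z + (sg - l ^+ 2) * z ^+ 2) =
   Re (2 * l * z - l ^+ 2 * z ^+ 2) + Re (sg * z ^+ 2) by rewrite -raddfD /=; congr Re; ring.
rewrite -/S; lra.
Qed.

Lemma sqsum_cont x : hasjet A x.1 -> hasjet B x.2 ->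
  forall e : R, 0 < e -> \forall y \near x, `|sqsum y - sqsum x| < e.
Proof.
have one f (z : C) : hasjet f z -> forall e : R, 0 < e -> exists2 d : R, 0 < d &
    forall w : C, cabs (w - z) < d -> `|cabs (f w) ^+ 2 - cabs (f z) ^+ 2| < e.
  move=> /hasjet_cont/ccontP cf e e0; pose M := 2 * cabs (f z) + 1.
  have M0 : 0 < M by rewrite ltr_wpDl// mulr_ge0// cabs_ge0.
  have [|d d0 Hd] := cf (Num.min 1 (e / M)); first by rewrite lt_min ltr01 divr_gt0.
  exists d => // w /Hd; rewrite lt_min => /andP[h1]; rewrite ltr_pdivlMr// => h2.
  have a1 := cabs_subl (f w) (f z); have a2 := cabs_subl (f z) (f w).
  rewrite cabsBC in a2; have := cabs_ge0 (f w); have := cabs_ge0 (f z).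
  rewrite /M in h2; move: (cabs (f w - f z)) (cabs (f w)) (cabs (f z)) a1 a2 h1 h2.
  clear => D X Y a1 a2 h1 h2 Y0 X0.
  rewrite (_ : X ^+ 2 - Y ^+ 2 = (X - Y) * (X + Y)); last by ring.
  rewrite normrM (ger0_norm (addr_ge0 X0 Y0)).
  have aXY : `|X - Y| <= D by rewrite ler_norml; apply/andP; split; lra.
  have D0 : 0 <= D by apply: le_trans aXY; exact: normr_ge0.
  apply: le_lt_trans h2; apply: ler_pM => //; first exact: addr_ge0.
  lra.
move=> hA hB e e0; have e20 : 0 < e / 2 by rewrite divr_gt0.
have [d1 d10 H1] := one _ _ hA _ e20; have [d2 d20 H2] := one _ _ hB _ e20.
apply/cnbhs2P; exists (Num.min d1 d2); first by rewrite lt_min d10.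
move=> y; rewrite !lt_min => /andP[/H1 h1 _] /andP[_ /H2 h2].
rewrite /sqsum (_ : _ - _ = (cabs (A y.1) ^+ 2 - cabs (A x.1) ^+ 2) +
  (cabs (B y.2) ^+ 2 - cabs (B x.2) ^+ 2)); last by ring.
by apply: le_lt_trans (ler_normD _ _) _; lra.
Qed.

Lemma ln_sqsum_cont x : hasjet A x.1 -> hasjet B x.2 -> 0 < sqsum x ->
  forall e : R, 0 < e -> \forall y \near x, 0 < sqsum y /\ `|ln (sqsum y) - ln (sqsum x)| < e.
Proof.
move=> hA hB S0 e e0.
have cl : {for sqsum x, continuous (@ln R)} by exact: continuous_ln.
have /cl/nbhs_ballP[d /= d0 Hd] : nbhs (ln (sqsum x)) [set s | `|s - ln (sqsum x)| < e].
  by apply/nbhs_ballP; exists e => //= s; rewrite /ball /= distrC.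
have m0 : 0 < Num.min d (sqsum x) by rewrite lt_min d0.
apply: filterS (sqsum_cont hA hB m0) => y; rewrite lt_min => /andP[yd].
rewrite ltr_norml => /andP[ys _]; split; first by lra.
by apply: Hd; rewrite /ball /= distrC.
Qed.

End Pair.

Lemma affine2_in_polydisc (r : R) (x v : C2) : cabs x.1 < r -> cabs x.2 < r ->
  exists2 d : R, 0 < d & forall z : C, cabs z < d ->
    cabs (affine2 x v z).1 <= r /\ cabs (affine2 x v z).2 <= r.
Proof.
move=> x1 x2; have one (p q : C) : cabs p < r -> exists2 d : R, 0 < d &
    forall z : C, cabs z < d -> cabs (p + z * q) <= r.
  move=> pr; have q0 : 0 < cabs q + 1 by rewrite ltr_wpDl ?cabs_ge0.
  exists ((r - cabs p) / (cabs q + 1)); first by rewrite divr_gt0// subr_gt0.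
  move=> z; rewrite ltr_pdivlMr// => zr.
  apply: le_trans (cabsD _ _) _; rewrite cabsM; have := cabs_ge0 z; lra.
have [d1 d10 H1] := one _ v.1 x1; have [d2 d20 H2] := one _ v.2 x2.
exists (Num.min d1 d2); first by rewrite lt_min d10.
by move=> z; rewrite lt_min => /andP[/H1 h1 /H2 h2].
Qed.

Lemma hasjet_id (z : C) : hasjet id z.
Proof.
by exists 1, 0; apply: jet2_ext (jet2_poly z 1 0) => // w; rewrite /poly2 mul0r mul1r addr0.
Qed.

Section Maximum.
Variables A B : C -> C.
Local Notation sqsum := (sqsum A B).
Hypothesis jetA : forall z, disc z -> hasjet A z.
Hypothesis jetB : forall z, disc z -> hasjet B z.
Hypothesis boundary : forall e : R, 0 < e -> exists2 r : R, 0 < r < 1 &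
  forall x, bidisc x -> r <= cabs x.1 \/ r <= cabs x.2 -> 1 - e <= sqsum x.

(* If [u - c ln sqsum] were positive somewhere, [u - H] would have an interior maximum for
   [H = (1 - d) c ln sqsum - k |x|^2]: the factor [1 - d] makes [u - H] tend to [-oo] at the
   zeros of [sqsum].  On the line of [ln_sqsum_line] the mean of [H] drops by a multiple of
   [k r^2], contradicting the sub-mean value property there. *)
Lemma green_comparison (u : C2 -> \bar R) (c : R) : 0 < c -> neg_psh_bidisc u ->
  (forall p, bidisc p -> sqsum p = 0 -> exists K : R,
     \forall x \near p, 0 < sqsum x -> (u x <= (c * ln (sqsum x) + K)%:E)%E) ->
  forall x, bidisc x -> 0 < sqsum x -> (u x <= (c * ln (sqsum x))%:E)%E.
Proof.
move=> c0 [psh neg] pole x0 x0D S0; rewrite leNgt; apply/negP => ux0.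
have [usc fin] : usc_on bidisc u /\ forall x, bidisc x -> (u x < +oo)%E by case: psh.
have [m0 um0] : exists m0 : R, u x0 = m0%:E.
  have := neg _ x0D; move: ux0; case: (u x0) => [s|//|]; first by exists s.
  by rewrite ltNge leNye.
have g0 : 0 < m0 - c * ln (sqsum x0) by rewrite subr_gt0 -lte_fin -um0.
pose g := m0 - c * ln (sqsum x0).
(* With [d L <= g / 2] one gets [m0 - H x0 >= 4 k], whereas [u - H] stays below [3 k] near the
   boundary. *)
pose k := g / 8; have k0 : 0 < k by rewrite divr_gt0.
pose L := `|c * ln (sqsum x0)| + 1; have L0 : 0 < L by rewrite ltr_wpDl.
pose d := Num.min (1 / 2) (g / (2 * L)).
have d0 : 0 < d by rewrite lt_min; apply/andP; split; [lra|rewrite divr_gt0// mulr_gt0].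
have d1 : d <= 1 / 2 by rewrite ge_min lexx.
have dL : d * (2 * L) <= g by rewrite -ler_pdivlMr ?mulr_gt0// ge_min lexx orbT.
pose c' := (1 - d) * c; have c'0 : 0 < c' by rewrite mulr_gt0//; lra.
have c'c : c' <= c by rewrite /c' ler_piMl ?(ltW c0)//; lra.
pose H x := c' * ln (sqsum x) - k * (cabs x.1 ^+ 2 + cabs x.2 ^+ 2).
(* With this [e], [c ln sqsum >= - k] near the boundary; the term [k |x|^2] adds at most [2 k]. *)
have e0 : 0 < 1 - expR (- (k / c)).
  by rewrite subr_gt0 expR_lt1 oppr_lt0 divr_gt0.
have [r /andP[r0 r1] Hr] := boundary e0.
have sq1 x : bidisc x -> 0 <= cabs x.1 ^+ 2 + cabs x.2 ^+ 2 <= 2.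
  move=> [y1 y2]; rewrite addr_ge0 ?sqr_ge0//=.
  have : cabs x.1 ^+ 2 <= 1 by rewrite exprn_ile1 ?cabs_ge0// ltW.
  have : cabs x.2 ^+ 2 <= 1 by rewrite exprn_ile1 ?cabs_ge0// ltW.
  lra.
have Hbd x : bidisc x -> 0 < sqsum x -> r <= cabs x.1 \/ r <= cabs x.2 -> - (3 * k) <= H x.
  move=> xD Sx /(Hr _ xD); rewrite opprB addrCA subrr addr0 => h.
  have : - (k / c) <= ln (sqsum x) by rewrite -[leLHS]expRK ler_ln ?posrE// expR_gt0.
  have /andP[_ q2] := sq1 _ xD.
  move=> /(ler_wpM2l (ltW c'0)); rewrite mulrN => h1.
  have h2 : c' * (k / c) <= k.
    by rewrite mulrCA ler_piMr ?(ltW k0)// ler_pdivrMr// mul1r.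
  have h3 := ler_wpM2l (ltW k0) q2.
  rewrite /H; lra.
have Hx0 : 3 * k < m0 - H x0.
  have /andP[q1 _] := sq1 _ x0D; have := mulr_ge0 (ltW k0) q1.
  have : d * (c * ln (sqsum x0)) >= - (d * L).
    have := ler_norm (- (c * ln (sqsum x0))); rewrite normrN => h.
    have : d * (- (c * ln (sqsum x0))) <= d * L by apply: ler_wpM2l; [exact: ltW|rewrite /L; lra].
    by rewrite mulrN; lra.
  rewrite /H /c'.
  have -> : (1 - d) * c * ln (sqsum x0) = c * ln (sqsum x0) - d * (c * ln (sqsum x0)) by ring.
  have kg : k = g / 8 by []. have gE : g = m0 - c * ln (sqsum x0) by [].
  lra.
pose Kr : set C2 := [set z : C | cabs z <= r] `*` [set z : C | cabs z <= r].
have cKr : compact Kr by apply: compact_setX; exact: closed_disc_compact.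
have KrD x : Kr x -> bidisc x by move=> [/= a1 a2]; split; exact: le_lt_trans r1.
have x0K : Kr x0.
  have no : ~ (r <= cabs x0.1 \/ r <= cabs x0.2).
    move=> /(Hbd _ x0D S0) h; have := neg _ x0D; rewrite um0 lte_fin; lra.
  by split; rewrite /= leNgt; apply/negP => /ltW ?; apply: no; [left|right].
pose w x : \bar R := if 0 < sqsum x then (u x - (H x)%:E)%E else -oo%E.
have w_lt x (s : R) : 0 < sqsum x -> (w x < s%:E)%E = (u x < (s + H x)%:E)%E.
  by move=> Sx; rewrite /w Sx lteBlDr// EFinD.
have wfin x : Kr x -> (w x < +oo)%E.
  move=> /KrD xD; rewrite /w; case: ifP => // _.
  by have := neg _ xD; case: (u x) => [s _|//|_]; rewrite -?EFinB ?ltry.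
have near_sq (x : C2) (e : R) : 0 < e -> \forall y \near x,
    `|(cabs y.1 ^+ 2 + cabs y.2 ^+ 2) - (cabs x.1 ^+ 2 + cabs x.2 ^+ 2)| < e.
  by move=> e_gt0; exact: (sqsum_cont (hasjet_id x.1) (hasjet_id x.2) e_gt0).
have wusc x : Kr x -> forall s : R, (w x < s%:E)%E -> \forall y \near x, (w y < s%:E)%E.
  move=> /KrD xD s; have [xD1 xD2] := xD.
  have [Sx|Sx] := ltP 0 (sqsum x).
    rewrite w_lt// => uxs.
    have [t ut ts] : exists2 t : R, (u x < t%:E)%E & t < s + H x.
      have := neg _ xD; move: uxs; case: (u x) => [p|//|] pq _.
        by exists ((p + (s + H x)) / 2); rewrite ?lte_fin in pq *; lra.
      by exists (s + H x - 1); [rewrite ltNyr|lra].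
    pose e := (s + H x - t) / 4; have e_gt0 : 0 < e by rewrite divr_gt0// subr_gt0.
    have ec0 : 0 < e / c' by rewrite divr_gt0.
    have ek0 : 0 < e / k by rewrite divr_gt0.
    have F1 := usc _ xD _ ut.
    have F2 := ln_sqsum_cont (jetA xD1) (jetB xD2) Sx ec0.
    have F3 := near_sq x _ ek0.
    apply: filterS3 F1 F2 F3 => y u1 [Sy l1] n1; rewrite w_lt//.
    apply: lt_le_trans u1 _; rewrite lee_fin /H.
    move: l1 n1; rewrite (ltr_pdivlMr _ _ c'0) (ltr_pdivlMr _ _ k0) => l1 n1.
    have l2 : c' * (ln (sqsum x) - ln (sqsum y)) <= e.
      apply: le_trans (ltW l1); rewrite mulrC; apply: ler_wpM2r; first exact: ltW.
      by rewrite distrC ler_norm.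
    have n2 : k * ((cabs y.1 ^+ 2 + cabs y.2 ^+ 2) - (cabs x.1 ^+ 2 + cabs x.2 ^+ 2)) <= e.
      apply: le_trans (ltW n1); rewrite mulrC; apply: ler_wpM2r; first exact: ltW.
      by rewrite ler_norm.
    have eE : 4 * e = s + H x - t by rewrite /e; field.
    rewrite /H in eE; move: (ln (sqsum x)) (ln (sqsum y)) (_ + cabs x.2 ^+ 2) (_ + cabs y.2 ^+ 2) l2 n2 eE.
    by clear -e_gt0 => p1 p2 p3 p4 l2 n2 eE; lra.
  move=> _; have Sx0 : sqsum x = 0 by apply/eqP; rewrite eq_le Sx sqsum_ge0.
  have [K poleK] := pole _ xD Sx0.
  have dc0 : 0 < d * c by rewrite mulr_gt0.
  (* Near a zero of [sqsum], [u - H] is at most [d c ln sqsum + K + 3 k]; below [tau] this is less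
     than [s - 1]. *)
  pose tau := expR ((s - K - 3 * k - 1) / (d * c)); have tau0 : 0 < tau by exact: expR_gt0.
  have F2 := sqsum_cont (jetA xD1) (jetB xD2) tau0.
  have F3 := near_sq x _ ltr01.
  apply: filterS3 poleK F2 F3 => y u1 s1 n1.
  have [Sy|Sy] := ltP 0 (sqsum y); last by rewrite /w (le_gtF Sy) ltNyr.
  rewrite w_lt//; apply: le_lt_trans (u1 Sy) _; rewrite lte_fin /H.
  move: s1; rewrite Sx0 subr0 ger0_norm ?sqsum_ge0// => s1.
  have : ln (sqsum y) < (s - K - 3 * k - 1) / (d * c).
    by rewrite -[ltRHS]expRK ltr_ln ?posrE.
  rewrite (ltr_pdivlMr _ _ dc0) => lS.
  have y3 : cabs y.1 ^+ 2 + cabs y.2 ^+ 2 <= 3.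
    have /andP[_ x2] := sq1 _ xD; have := ler_norm ((cabs y.1 ^+ 2 + cabs y.2 ^+ 2) - (cabs x.1 ^+ 2 + cabs x.2 ^+ 2)).
    by clear -n1 x2; move: (_ + cabs x.2 ^+ 2) (_ + cabs y.2 ^+ 2) n1 x2 => p q n1 x2 h; lra.
  have k3 := ler_wpM2l (ltW k0) y3.
  rewrite /c'; move: (ln (sqsum y)) lS (_ + cabs y.2 ^+ 2) k3; clear => p lS q k3.
  rewrite mulrDl mulrDl mul1r mulNr mulNr; lra.
have [x xK xmax] := usc_max cKr x0K wfin wusc.
have xD := KrD _ xK; have [xD1 xD2] := xD.
have wx0 : w x0 = (m0 - H x0)%:E by rewrite /w S0 um0 -EFinB.
have := xmax _ x0K; rewrite wx0 => wx.
have Sx : 0 < sqsum x.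
  by rewrite ltNge; apply/negP => Sx; move: wx; rewrite /w (le_gtF Sx) leeNy_eq.
have [m um] : exists m : R, u x = m%:E.
  have := neg _ xD; move: wx; rewrite /w Sx; case: (u x) => [p|//|]; first by exists p.
  by rewrite /= leeNy_eq.
have mneg : m < 0 by have := neg _ xD; rewrite um lte_fin.
have mH : m0 - H x0 <= m - H x by move: wx; rewrite /w Sx um -EFinB lee_fin.
have no : ~ (r <= cabs x.1 \/ r <= cabs x.2) by move=> /(Hbd _ xD Sx) h; lra.
have xr1 : cabs x.1 < r by rewrite ltNge; apply/negP => ?; apply: no; left.
have xr2 : cabs x.2 < r by rewrite ltNge; apply/negP => ?; apply: no; right.
have [v [c1 [c2 [K [r' [v0 r'0 Hl]]]]]] := ln_sqsum_line (jetA xD1) (jetB xD2) Sx.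
have [r2 r20 Hr2] := affine2_in_polydisc v xr1 xr2.
(* Maximality gives [u y <= m + H y - H x]. Expanding [k |x + z v|^2] puts its linear part into [C1]
   and leaves the strict loss [k |v|^2 |z|^2]. *)
pose C1 : C := cmk c' 0 * c1 - cmk (2 * k) 0 * (cconj x.1 * v.1 + cconj x.2 * v.2).
pose C3 : C := cmk c' 0 * c2.
have kv0 : 0 < k * (cabs v.1 ^+ 2 + cabs v.2 ^+ 2) by rewrite mulr_gt0.
have rr0 : 0 < Num.min r' r2 by rewrite lt_min r'0.
apply: (@psh_no_strict_max R u x v C1 C3 m _ (c' * K) _ psh um kv0 rr0) => z.
rewrite lt_min => /andP[/Hl[Sy ly] /Hr2 yK].
have yKr : Kr (affine2 x v z) by [].
split; first exact: KrD.
have := xmax _ yKr; rewrite {2}/w Sx um -EFinB /w Sy leeBlDr// => h.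
apply: le_trans h _; rewrite -EFinD lee_fin {2}/H.
have e1 : cabs (affine2 x v z).1 ^+ 2 = cabs x.1 ^+ 2 + 2 * Re (cconj x.1 * (z * v.1)) + cabs z ^+ 2 * cabs v.1 ^+ 2.
  by rewrite sqr_cabsD cabsM exprMn.
have e2 : cabs (affine2 x v z).2 ^+ 2 = cabs x.2 ^+ 2 + 2 * Re (cconj x.2 * (z * v.2)) + cabs z ^+ 2 * cabs v.2 ^+ 2.
  by rewrite sqr_cabsD cabsM exprMn.
rewrite e1 e2 /H.
have -> : Re (C1 * z + C3 * z ^+ 2) = c' * Re (c1 * z + c2 * z ^+ 2) -
    2 * k * (Re (cconj x.1 * (z * v.1)) + Re (cconj x.2 * (z * v.2))).
  rewrite (_ : C1 * z + _ = cmk c' 0 * (c1 * z + c2 * z ^+ 2) -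
    cmk (2 * k) 0 * (cconj x.1 * (z * v.1) + cconj x.2 * (z * v.2))); last by rewrite /C1 /C3; ring.
  case: (c1 * z + _) (cconj x.1 * _) (cconj x.2 * _) => [p1 p2] [p3 p4] [p5 p6] /=; ring.
have := ler_wpM2l (ltW c'0) ly.
move: (ln _) (ln _) (Re _) (Re _) (Re _) (cabs z ^+ 3) (cabs z ^+ 2) => q1 q2 q3 q4 q5 q6 q7.
move: (cabs x.1 ^+ 2) (cabs x.2 ^+ 2) (cabs v.1 ^+ 2) (cabs v.2 ^+ 2) => q8 q9 q10 q11.
by clear => h; lra.
Qed.

End Maximum.
End Comparison.

(** * Upper bound for the Green functions *)

Section GreenBound.
Variable R : realType.
Local Notation C := (CC R).
Local Notation C2 := (C * C)%type.
Local Notation cabs := (@cabs R).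
Local Notation disc := (@disc R).
Local Notation bidisc := (@bidisc R).

Definition blaschke2 (p q z : C) : C := mob p z * mob q z.

Lemma blaschke2C p q z : blaschke2 p q z = blaschke2 q p z.
Proof. exact: mulrC. Qed.

Lemma blaschke2_eq0 p q z : disc p -> disc q -> disc z ->
  blaschke2 p q z = 0 -> z = p \/ z = q.
Proof.
move=> p1 q1 z1 /eqP; rewrite mulf_eq0 !mob_eq0 ?(ltW z1)//.
by move=> /orP[/eqP|/eqP]; [left|right].
Qed.

Lemma hasjet_blaschke2 p q n z : disc p -> disc q -> disc z ->
  hasjet (fun z => blaschke2 p q z ^+ n) z.
Proof.
move=> p1 q1 z1; apply: hasjetX; apply: hasjetM; apply: hasjet_mob => //; exact: ltW.
Qed.

Lemma bernoulli_sub (e : R) n : 0 <= e <= 1 -> 1 - n%:R * e <= (1 - e) ^+ n.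
Proof.
move=> /andP[e0 e1]; elim: n => [|n IH]; first by rewrite mul0r subr0 expr0.
rewrite exprS -natr1; have e1' : 0 <= 1 - e by lra.
apply: le_trans (ler_wpM2l e1' IH).
have : 0 <= n%:R * e * e by rewrite !mulr_ge0 ?ler0n.
lra.
Qed.

Lemma blaschke2_boundary p q n : disc p -> disc q -> forall e : R, 0 < e ->
  exists2 r : R, 0 < r < 1 & forall z, disc z -> r <= cabs z ->
    1 - e <= cabs (blaschke2 p q z ^+ n) ^+ 2.
Proof.
move=> p1 q1 e e0.
(* Two Mobius factors, the power [n] and the final square give the exponent [4 n]. *)
pose N := (2 * (n * 2))%N.
pose s := Num.min 1 (e / (N%:R + 1)).
have N0 : 0 < N%:R + 1 :> R by rewrite ltr_wpDl ?ler0n.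
have s0 : 0 < s by rewrite lt_min ltr01 divr_gt0.
have s1 : s <= 1 by rewrite ge_min lexx.
have sN : s * (N%:R + 1) <= e by rewrite -ler_pdivlMr// ge_min lexx orbT.
have [r1 /andP[r10 r11] H1] := mob_boundary p1 s0.
have [r2 /andP[r20 r21] H2] := mob_boundary q1 s0.
exists (Num.max r1 r2); first by rewrite lt_max gt_max r10 r11 r21.
move=> z z1; rewrite ge_max => /andP[/H1/(_ z1) h1 /H2/(_ z1) h2].
have s1' : 0 <= 1 - s by lra.
have h : (1 - s) ^+ 2 <= cabs (blaschke2 p q z).
  by rewrite /blaschke2 cabsM expr2; apply: ler_pM.
have /(bernoulli_sub N) B : 0 <= s <= 1 by rewrite (ltW s0).
apply: le_trans (le_trans B _); first by lra.
by rewrite /N exprM cabsX -[leRHS]exprM lerXn2r ?nnegrE ?exprn_ge0 ?cabs_ge0.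
Qed.

Lemma blaschke2_lower p q : disc p -> disc q -> p != q -> exists2 k : R, 0 < k &
  \forall z \near p, k * cabs (z - p) <= cabs (blaschke2 p q z).
Proof.
move=> p1 q1 pq; pose m := cabs (mob q p).
have m0 : 0 < m by rewrite cabs_gt0 mob_eq0// ltW.
have /ccontP cq := hasjet_cont (hasjet_mob q1 (ltW p1)).
have [|d d0 Hd] := cq (m / 2); first by rewrite divr_gt0.
have p1' : 0 < 1 - cabs p by rewrite subr_gt0.
exists (m / 4); first by rewrite divr_gt0.
apply/cnbhsP; exists (Num.min d (1 - cabs p)); first by rewrite lt_min d0.
move=> z; rewrite lt_min => /andP[/Hd h1 zp].
have z1 : cabs z < 1 by have := cabs_subl z p; lra.
have h2 : m / 2 <= cabs (mob q z).
  by have := cabs_subl (mob q p) (mob q z); rewrite cabsBC -/m; lra.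
have h3 : cabs (z - p) / 2 <= cabs (mob p z).
  have D0 : 0 < cabs (1 - cconj p * z) by rewrite cabs_gt0 mob_den_neq0// ltW.
  rewrite /mob cabsM cabsV ler_wpM2l ?cabs_ge0// lef_pV2 ?posrE//.
  apply: le_trans (cabsB _ _) _; rewrite cabs1 cabsM cabsC.
  have := cabs_ge0 p; have := cabs_ge0 z; nra.
rewrite /blaschke2 cabsM.
rewrite (_ : m / 4 * cabs (z - p) = cabs (z - p) / 2 * (m / 2)); last by field.
by apply: ler_pM; rewrite ?divr_ge0 ?cabs_ge0// ltW.
Qed.

(** A common form of both pole conditions: [q] is the distance to [p] for simple poles and
    [max (|x1 - p1|, |x2|^2)] for [PsiV]. The factor [1 / (2n)] makes the majorant at least
    [ln (max (|P|, |Q|))], so it allows every such singularity. *)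
Lemma green_upper (u : C2 -> \bar R) (a eps gamma : C) (n : nat) : (0 < n)%N ->
  a != 0 -> disc a -> disc eps -> disc gamma ->
  cabs (blaschke2 0 eps gamma) <= cabs a ^+ 2 -> neg_psh_bidisc u ->
  (forall p : C2, (p.1 = a \/ p.1 = - a) -> (p.2 = 0 \/ p.2 = eps) ->
    exists k K : R, 0 < k /\ \forall x \near p, x <> p -> exists q : R, [/\ 0 < q,
      q <= k * Num.max (cabs (blaschke2 a (- a) x.1)) (cabs (blaschke2 0 eps x.2)) &
      (u x <= (ln q + K)%:E)%E]) ->
  (u (0%R, gamma) <= (ln (cabs a ^+ 2) + ln 2 / (2 * n%:R))%:E)%E.
Proof.
move=> n0 a0 a1 e1 g1 Qg neg pole.
have na1 : disc (- a) by rewrite /Defs.disc /mkset cabsN.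
have D0 : disc 0 by rewrite /Defs.disc /mkset cabs0.
pose P := blaschke2 a (- a); pose Q := blaschke2 0 eps.
pose A z := P z ^+ n; pose B z := Q z ^+ n.
have nR : 0 < 2 * n%:R :> R by rewrite mulr_gt0// ltr0n.
pose c : R := (2 * n%:R)^-1; have c0 : 0 < c by rewrite invr_gt0.
pose M (x : C2) := Num.max (cabs (P x.1)) (cabs (Q x.2)).
have M0 x : 0 <= M x by rewrite le_max cabs_ge0.
have SM x : M x ^+ (2 * n) <= sqsum A B x.
  rewrite /sqsum /A /B !cabsX -!exprM mulnC /M.
  have [h|h] := leP (cabs (P x.1)) (cabs (Q x.2)); rewrite ?lerDl ?lerDr ?exprn_ge0 ?cabs_ge0//.
have lnM_le x : 0 < M x -> ln (M x) <= c * ln (sqsum A B x).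
  move=> Mx; rewrite /c mulrC ler_pdivlMr// mulrC -natrM mulr_natl -lnXn//.
  by rewrite ler_ln ?posrE ?exprn_gt0// (lt_le_trans _ (SM x))// exprn_gt0.
have := @green_comparison R A B _ _ _ u c c0 neg.
have jA z : disc z -> hasjet A z by move=> z1; exact: hasjet_blaschke2.
have jB z : disc z -> hasjet B z by move=> z1; exact: hasjet_blaschke2.
have bd (e : R) : 0 < e -> exists2 r : R, 0 < r < 1 &
    forall x, bidisc x -> r <= cabs x.1 \/ r <= cabs x.2 -> 1 - e <= sqsum A B x.
  move=> e0; have [r1 /andP[r10 r11] H1] := blaschke2_boundary n a1 na1 e0.
  have [r2 /andP[r20 r21] H2] := blaschke2_boundary n D0 e1 e0.
  exists (Num.max r1 r2); first by rewrite lt_max gt_max r10 r11 r21.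
  move=> x [x1 x2]; rewrite !ge_max => -[/andP[h _]|/andP[_ h]].
    by apply: le_trans (H1 _ x1 h) _; rewrite lerDl sqr_ge0.
  by apply: le_trans (H2 _ x2 h) _; rewrite lerDr sqr_ge0.
move=> /(_ jA jB bd) cmp.
have S0E x : sqsum A B x = 0 -> P x.1 = 0 /\ Q x.2 = 0.
  move=> S0; have Mx : ~~ (0 < M x).
    by apply/negP => Mx; have := SM x; rewrite S0 leNgt exprn_gt0.
  move: Mx; rewrite -leNgt ge_max => /andP[h1 h2].
  by split; apply/eqP; rewrite -cabs_eq0 eq_le cabs_ge0 andbT.
have poles p : bidisc p -> sqsum A B p = 0 -> exists K : R,
    \forall x \near p, 0 < sqsum A B x -> (u x <= (c * ln (sqsum A B x) + K)%:E)%E.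
  move=> [p1 p2] /S0E[P0 Q0].
  have [k [K [k0 H]]] := pole p (blaschke2_eq0 a1 na1 p1 P0) (blaschke2_eq0 D0 e1 p2 Q0).
  exists (ln k + K); apply: filterS H => x H Sx.
  have [|q [q0 qM uq]] := H.
    have z0 : (0 : C) ^+ n = 0 by rewrite expr0n gtn_eqF.
    by move=> xp; move: Sx; rewrite xp /sqsum /A /B P0 Q0 z0 cabs0 expr2 mulr0 addr0 ltxx.
  apply: le_trans uq _; rewrite lee_fin addrA lerD2r.
  have Mx : 0 < M x by move: (lt_le_trans q0 qM); rewrite pmulr_rgt0.
  have : ln q <= ln (k * M x) by rewrite ler_ln ?posrE ?mulr_gt0.
  by rewrite lnM ?posrE//; have := lnM_le x Mx; lra.
have {}cmp := cmp poles (0%R, gamma).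
have P0 : cabs (P 0) = cabs a ^+ 2 by rewrite /P /blaschke2 !mobx0 cabsM !cabsN expr2.
have A0 : 0 < cabs a ^+ 2 by rewrite exprn_gt0// cabs_gt0.
have S1 : sqsum A B (0%R, gamma) <= 2 * cabs a ^+ 2 ^+ (2 * n).
  have -> : sqsum A B (0%R, gamma) = cabs (P 0) ^+ (2 * n) + cabs (Q gamma) ^+ (2 * n).
    by rewrite /sqsum /A /B /= !cabsX -!exprM mulnC.
  rewrite P0; have : cabs (Q gamma) ^+ (2 * n) <= cabs a ^+ 2 ^+ (2 * n) by rewrite lerXn2r ?nnegrE ?cabs_ge0// ltW.
  lra.
have S0 : 0 < sqsum A B (0%R, gamma).
  by rewrite /sqsum /A /B /= ltr_pwDl ?sqr_ge0// cabsX P0 !exprn_gt0// cabs_gt0.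
apply: le_trans (cmp _ S0) _; first by split.
rewrite lee_fin; have SA : 0 < cabs a ^+ 2 ^+ (2 * n) by rewrite exprn_gt0.
have : ln (sqsum A B (0%R, gamma)) <= ln (2 * cabs a ^+ 2 ^+ (2 * n)).
  by rewrite ler_ln ?posrE ?mulr_gt0.
rewrite lnM ?posrE// lnXn// => /(ler_wpM2l (ltW c0)).
rewrite -[_ *+ (2 * n)]mulr_natl natrM => h; apply: le_trans h _.
have cE : c * (2 * n%:R) = 1 by rewrite mulVf// gt_eqF.
by rewrite mulrDr mulrA cE mul1r addrC [c * _]mulrC.
Qed.

End GreenBound.

(** * The two Green functions of the statement *)

Section GreenPoles.
Variable R : realType.
Local Notation C := (CC R).
Local Notation C2 := (C * C)%type.
Local Notation cabs := (@cabs R).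
Local Notation disc := (@disc R).

Lemma near_fst (p : C2) (P : C -> Prop) : (\forall z \near p.1, P z) -> \forall x \near p, P x.1.
Proof. by move=> /cnbhsP[d d0 H]; apply/cnbhs2P; exists d => // y /H. Qed.

Lemma near_snd (p : C2) (P : C -> Prop) : (\forall z \near p.2, P z) -> \forall x \near p, P x.2.
Proof. by move=> /cnbhsP[d d0 H]; apply/cnbhs2P; exists d => // y _ /H. Qed.

Lemma norm2_le (x : C2) : norm2 x <= cabs x.1 + cabs x.2.
Proof.
have s0 : 0 <= cabs x.1 + cabs x.2 by rewrite addr_ge0 ?cabs_ge0.
rewrite /norm2 -[leRHS]ger0_norm// -sqrtr_sqr ler_wsqrtr// sqrrD.
by rewrite lerD2r lerDl mulrn_wge0// mulr_ge0 ?cabs_ge0.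
Qed.

Lemma norm2_gt0 (x p : C2) : x <> p -> 0 < norm2 (sub2 x p).
Proof.
move=> xp; rewrite /norm2 sqrtr_gt0 /sub2.
have [x1|x1] := eqVneq (x.1 - p.1) 0; last first.
  by rewrite ltr_pwDl ?sqr_ge0// exprn_gt0// cabs_gt0.
have [x2|x2] := eqVneq (x.2 - p.2) 0; last first.
  by rewrite ltr_wpDl ?sqr_ge0// exprn_gt0// cabs_gt0.
case: xp; move/eqP: x1; move/eqP: x2; rewrite !subr_eq0 => /eqP x2 /eqP x1.
by rewrite [x]surjective_pairing x1 x2 -surjective_pairing.
Qed.

Lemma neq_opp (a : C) : a != 0 -> a != - a.
Proof.
move=> a0; rewrite -addr_eq0 -mulr2n -mulr_natl mulf_eq0 (negbTE a0) orbF.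
by rewrite pnatr_eq0.
Qed.

Lemma blaschke2_opp_lower (a p : C) : a != 0 -> disc a -> p = a \/ p = - a ->
  exists2 k : R, 0 < k & \forall z \near p, k * cabs (z - p) <= cabs (blaschke2 a (- a) z).
Proof.
move=> a0 a1; have na1 : disc (- a) by rewrite /Defs.disc /mkset cabsN.
case=> ->; first exact: blaschke2_lower a1 na1 (neq_opp a0).
have naa : - a != a by rewrite eq_sym neq_opp.
have [k k0 H] := blaschke2_lower na1 a1 naa; exists k => //.
by apply: filterS H => z; rewrite blaschke2C.
Qed.

Lemma G_eps_upper (a eps gamma : C) (n : nat) : (0 < n)%N -> a != 0 -> eps != 0 ->
  disc a -> disc eps -> disc gamma -> cabs (blaschke2 0 eps gamma) <= cabs a ^+ 2 ->
  (G_eps a (- a) eps (0%R, gamma) <= (ln (cabs a ^+ 2) + ln 2 / (2 * n%:R))%:E)%E.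
Proof.
move=> n0 a0 e0 a1 e1 g1 Qg; apply: ge_ereal_sup => _ [u [neg H] <-].
apply: (green_upper n0 a0 a1 e1 g1 Qg neg) => p p1 p2.
have D0 : disc 0 by rewrite /Defs.disc /mkset cabs0.
have [j jp] : exists j, four_poles a (- a) eps j = p.
  rewrite [p]surjective_pairing; case: p1 p2 => -> [] ->.
  - by exists (Ordinal (isT : 0 < 4)%N).
  - by exists (Ordinal (isT : 3 < 4)%N).
  - by exists (Ordinal (isT : 1 < 4)%N).
  - by exists (Ordinal (isT : 2 < 4)%N).
have [K HK] := H j; rewrite jp in HK.
have [k1 k10 H1] := blaschke2_opp_lower a0 a1 p1.
have [k2 k20 H2] : exists2 k : R, 0 < k &
    \forall z \near p.2, k * cabs (z - p.2) <= cabs (blaschke2 0 eps z).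
  case: p2 => ->; first by apply: blaschke2_lower => //; rewrite eq_sym.
  have [k k0 Hk] := blaschke2_lower e1 D0 e0; exists k => //.
  by apply: filterS Hk => z; rewrite blaschke2C.
exists (k1^-1 + k2^-1), K; split; first by rewrite addr_gt0 ?invr_gt0.
apply: filterS3 HK (near_fst H1) (near_snd H2) => x ux h1 h2 xp.
have q0 := norm2_gt0 xp.
exists (norm2 (sub2 x p)); split=> //; last by move: ux; rewrite /elog gt_eqF// -EFinD.
apply: le_trans (norm2_le _) _; rewrite mulrDl /sub2 /=.
apply: lerD; rewrite ler_pdivlMl//.
  by apply: le_trans h1 _; rewrite le_max lexx.
by apply: le_trans h2 _; rewrite le_max lexx orbT.
Qed.

Lemma PsiV_le (x p : C2) : x <> p ->
  let q := Num.max (cabs (x.1 - p.1)) (cabs (x.2 - p.2) ^+ 2) in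
  0 < q /\ (PsiV (sub2 x p) <= (ln q)%:E)%E.
Proof.
move=> xp; rewrite /PsiV /sub2 /=.
have q0 : 0 < Num.max (cabs (x.1 - p.1)) (cabs (x.2 - p.2) ^+ 2).
  have := norm2_gt0 xp; rewrite /norm2 sqrtr_gt0 /sub2 => h.
  rewrite lt_max -[_ || _]negbK negb_or -!leNgt; apply/negP => /andP[w1 w2].
  have w1' : cabs (x.1 - p.1) = 0 by apply/eqP; rewrite eq_le w1 cabs_ge0.
  by move: h; rewrite w1' expr2 mul0r add0r ltNge w2.
split=> //; rewrite ge_max; apply/andP; split.
  rewrite /elog; case: eqVneq => // n0; first by rewrite leNye.
  have w0 : 0 < cabs (x.1 - p.1) by rewrite lt_def n0 cabs_ge0.
  by rewrite lee_fin ler_ln ?posrE// le_max lexx.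
rewrite /elog; case: eqVneq => [_|n0].
  by rewrite gt0_muleNy ?leNye.
have w0 : 0 < cabs (x.2 - p.2) by rewrite lt_def n0 cabs_ge0.
rewrite -EFinM lee_fin mulr_natl -lnXn//.
by rewrite ler_ln ?posrE ?exprn_gt0// le_max lexx orbT.
Qed.

(** The case [eps = 0]: then [|Q z| = |z|^2], which matches the term [2 log |w2|] of [PsiV]. *)
Lemma G_aVbV_upper (a gamma : C) (n : nat) : (0 < n)%N -> a != 0 ->
  disc a -> disc gamma -> cabs gamma <= cabs a ->
  (green_aVbV a (- a) (0%R, gamma) <= (ln (cabs a ^+ 2) + ln 2 / (2 * n%:R))%:E)%E.
Proof.
move=> n0 a0 a1 g1 ga; apply: ge_ereal_sup => _ [u [neg [[K1 H1] [K2 H2]]] <-].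
have D0 : disc 0 by rewrite /Defs.disc /mkset cabs0.
have Q2 z : cabs (blaschke2 0 0 z) = cabs z ^+ 2 by rewrite /blaschke2 !mob0x cabsM expr2.
have Qg : cabs (blaschke2 0 0 gamma) <= cabs a ^+ 2.
  by rewrite Q2 lerXn2r ?nnegrE ?cabs_ge0.
apply: (green_upper n0 a0 a1 D0 g1 Qg neg) => p p1 p2.
have {}p2 : p.2 = 0 by case: p2.
have [K HK] : exists K : R, \forall x \near p, (u x <= PsiV (sub2 x p) + K%:E)%E.
  by rewrite [p]surjective_pairing p2; case: p1 => ->; [exists K1|exists K2].
have [k1 k10 Hk] := blaschke2_opp_lower a0 a1 p1.
exists (k1^-1 + 1), K; split; first by rewrite addr_gt0 ?invr_gt0.
apply: filterS2 HK (near_fst Hk) => x ux h1 xp.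
have [q0 qE] := PsiV_le xp.
eexists; split; [exact: q0| |]; last first.
  by apply: le_trans ux _; rewrite EFinD leeD2r.
set M := Num.max (cabs (blaschke2 _ _ _)) _.
have M0 : 0 <= M by rewrite le_max cabs_ge0.
rewrite mulrDl mul1r ge_max; apply/andP; split.
  apply: (@le_trans _ _ (k1^-1 * M)); last by rewrite lerDl.
  by rewrite ler_pdivlMl//; apply: le_trans h1 _; rewrite le_max lexx.
apply: (@le_trans _ _ M); last by rewrite lerDr mulr_ge0// invr_ge0 ltW.
by rewrite /M Q2 p2 subr0 le_max lexx orbT.
Qed.

(** At [eps = 0] this is [|gamma|^2 <= |a|^2], with slack. Numerator and denominator each lose at
    most [|eps|], whence the factor [1 / 2]. *)
Lemma blaschke2_small_eps (a gamma eps : C) : disc gamma -> cabs gamma < cabs a -> disc a ->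
  cabs eps <= (cabs a ^+ 2 - cabs gamma ^+ 2) / 2 -> cabs (blaschke2 0 eps gamma) <= cabs a ^+ 2.
Proof.
move=> g1 ga a1 he; have g0 := cabs_ge0 gamma; have a0 := cabs_ge0 a; have e0 := cabs_ge0 eps.
have A2 : cabs a ^+ 2 <= 1 by rewrite exprn_ile1// ltW.
have G2 : 0 <= cabs gamma ^+ 2 by exact: sqr_ge0.
have e1 : cabs eps < 1 by lra.
rewrite /blaschke2 mob0x cabsM /mob cabsM cabsV mulrA.
have den : 1 - cabs eps <= cabs (1 - cconj eps * gamma) by apply: mob_den_ge => //; exact: ltW.
have den0 : 0 < cabs (1 - cconj eps * gamma) by apply: lt_le_trans den; rewrite subr_gt0.
rewrite ler_pdivrMr//; apply: le_trans (ler_wpM2l (sqr_ge0 _) den).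
apply: le_trans (ler_wpM2l g0 (cabsB gamma eps)) _.
rewrite mulrDr mulrBr mulr1 -expr2.
have h1 : cabs gamma * cabs eps <= cabs eps by rewrite ler_piMl// ltW.
have h2 : cabs a ^+ 2 * cabs eps <= cabs eps by rewrite ler_piMl.
lra.
Qed.

End GreenPoles.

Unset Implicit Arguments.

Theorem mainTheorem17 (R : realType) (a b gamma : CC R) :
  disc a -> b = - a ->
  cabs a `^ (3 / 2) < cabs gamma -> cabs gamma < cabs a ->
  (green_aVbV a b (0%R, gamma) <
     limf_einf (fun eps : CC R => L_eps a b eps (0%R, gamma)) (0%R : CC R)^')%E /\
  (exists delta : R, 0 < delta /\
     forall eps : CC R, 0 < cabs eps < delta ->
       (G_eps a b eps (0%R, gamma) < L_eps a b eps (0%R, gamma))%E).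
Proof.
move=> a1 -> ag ga.
have g0 := cabs_ge0 gamma.
have A0 : 0 < cabs a by exact: le_lt_trans ga.
have a0 : a != 0 by rewrite -cabs_gt0.
have g1 : disc gamma by exact: lt_trans ga a1.
have cube : cabs a ^+ 3 < cabs gamma ^+ 2.
  have -> : cabs a ^+ 3 = (cabs a `^ (3 / 2)) ^+ 2.
    by rewrite -[RHS]powR_mulrn ?powR_ge0// -powRrM divfK ?pnatr_eq0// powR_mulrn// ltW.
  by rewrite ltr_pXn2r ?nnegrE ?powR_ge0.
have [e [d [e0 d0 L_low]]] := L_eps_lower a0 a1 g1 cube.
have A2 : 0 < cabs a ^+ 2 by rewrite exprn_gt0.
have e1 : 0 < ln (1 + e) by rewrite ln_gt0// ltrDl.
(* Any such [n] gives [ln 2 / (2n) < ln (1 + e)], so the smoothing cost stays below the Lempert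
   gain. *)
have [n Hn] : exists n, ln 2 / ln (1 + e) < n%:R :> R.
  by exists (Num.truncn (ln 2 / ln (1 + e))).+1; rewrite truncnS_gt.
have ln2 : 0 < ln 2 :> R by rewrite ln_gt0// ltr1n.
have nR : 0 < n%:R :> R by apply: lt_trans Hn; rewrite divr_gt0.
have n0 : (0 < n)%N by rewrite -(ltr0n R).
have gap : ln (cabs a ^+ 2) + ln 2 / (2 * n%:R) < ln (cabs a ^+ 2 * (1 + e)).
  rewrite lnM ?posrE ?addr_gt0// ltrD2l ltr_pdivrMr ?mulr_gt0//.
  move: Hn; rewrite ltr_pdivrMr// => Hn.
  have := mulr_gt0 nR e1; lra.
split.
  apply: le_lt_trans (G_aVbV_upper n0 a0 a1 g1 (ltW ga)) _.
  apply: (@lt_le_trans _ _ (ln (cabs a ^+ 2 * (1 + e)))%:E); first by rewrite lte_fin.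
  (* The lower limit is a supremum of infima over punctured neighbourhoods; the one of radius [d]
     already has a large enough infimum. *)
  rewrite limf_einfE; apply: le_ereal_sup_tmp.
  exists (ereal_inf ((fun eps : CC R => L_eps a (- a) eps (0%R, gamma)) @`
      [set eps | 0 < cabs eps < d])).
    exists [set eps | 0 < cabs eps < d] => //.
    rewrite /dnbhs /within /=; apply/cnbhsP; exists d => // w.
    by rewrite subr0 => wd w0; rewrite cabs_gt0 w0.
  by apply: le_ereal_inf_tmp => _ [eps epsd <-]; exact: L_low.
pose dg := (cabs a ^+ 2 - cabs gamma ^+ 2) / 2.
have dg0 : 0 < dg by rewrite divr_gt0// subr_gt0 ltr_pXn2r ?nnegrE ?cabs_ge0.
exists (Num.min d (Num.min 1 dg)); split; first by rewrite !lt_min d0 ltr01.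
move=> eps; rewrite !lt_min => /and4P[eps0 epsd eps1 epsg].
apply: le_lt_trans (@G_eps_upper R a eps gamma n n0 a0 _ a1 eps1 g1 _) _.
- by rewrite -cabs_gt0.
- exact: blaschke2_small_eps (ltW epsg).
by apply: lt_le_trans (L_low _ _); rewrite ?lte_fin// eps0.
Qed.
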